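(* Let $p$ be a prime, let $m \ge 1$, and suppose that the family $\{P_1, \dots, P_m\} \subseteq (\mathbb{F}_p[t])[y]$ is good for irrational equidistribution. Then there exists $\gamma > 0$ such that for any $q = p^k$ and any $A_0, A_1, \dots, A_m \subseteq \mathbb{F}_q$, $$\left| \left\{ (x,y) \in \mathbb{F}_q^2 : x \in A_0, x + P_1(y) \in A_1, \dots, x + P_m(y) \in A_m \right\} \right| = q^{-(m-1)} \prod_{i=0}^m |A_i| + O_{q \to \infty; P_1, \dots, P_m}\left( |A_0|^{1/2} q^{3/2 - \gamma} \right).$$ In particular, if $A \subseteq \mathbb{F}_q$ contains no nontrivial pattern $\{x, x + P_1(y), \dots, x + P_m(y)\}$ (i.e. there are no $x, y \in \mathbb{F}_q$ such that $x, x + P_1(y), \dots, x + P_m(y)$ are $m+1$ distinct elements all belonging to $A$), then $$|A| \le K q^{1 - \gamma/\left( m + \frac{1}{2} \right)},$$ where $K > 0$ is a constant depending only on $P_1, \dots, P_m$.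
   Context: Notation. The notation $a(q) = O_{q \to \infty; P_1, \dots, P_m}(b(q))$ means that for some constant $C = C(P_1, \dots, P_m) > 0$ one has $|a(q)| \le C|b(q)|$ for all large enough $q$ (here uniformly in the sets $A_0, \dots, A_m$). Polynomials over $\mathbb{F}_q$. For $q = p^k$, the field $\mathbb{F}_q$ is identified with $\mathbb{F}_p[t]/Q(t)\mathbb{F}_p[t]$ for a monic irreducible $Q(t) \in \mathbb{F}_p[t]$ of degree $k$, and $P \in (\mathbb{F}_p[t])[y]$ acts as a function $\mathbb{F}_q \to \mathbb{F}_q$ by reducing its coefficients mod $Q$; the constants do not depend on the choice of $Q$. Good for irrational equidistribution. For nonzero $n \in \mathbb{F}_p[t]$ of degree $N$ put $|n| = p^N$, and extend to $\mathbb{F}_p(t)$ by $|m/n| = |m|/|n|$. The completion of $\mathbb{F}_p(t)$ is $\mathbb{F}_p((t^{-1})) = \left\{ \sum_{j=-\infty}^N c_j t^j : N \in \mathbb{Z}, c_j \in \mathbb{F}_p \right\}$. An element of $\mathbb{F}_p((t^{-1}))$ is rational if it lies in $\mathbb{F}_p(t)$ and irrational otherwise. A F{\o}lner sequence in $\mathbb{F}_p[t]$ is a sequence $(\Phi_N)_{N \in \mathbb{N}}$ of finite (nonempty) subsets of $\mathbb{F}_p[t]$ with $\lim_{N \to \infty} |(\Phi_N + n) \triangle \Phi_N| / |\Phi_N| = 0$ for every $n \in \mathbb{F}_p[t]$. A map $a : \mathbb{F}_p[t] \to \mathbb{F}_p((t^{-1}))$ is well-distributed mod $\mathbb{F}_p[t]$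 if $$\lim_{N \to \infty} \frac{1}{|\Phi_N|} \sum_{n \in \Phi_N} f(a(n)) = \int_{\mathbb{F}_p((t^{-1}))/\mathbb{F}_p[t]} f \, dm$$ for every continuous $f : \mathbb{F}_p((t^{-1}))/\mathbb{F}_p[t] \to \mathbb{C}$ and every F{\o}lner sequence $(\Phi_N)$ in $\mathbb{F}_p[t]$, where $m$ is the Haar probability measure on the compact group $\mathbb{F}_p((t^{-1}))/\mathbb{F}_p[t]$ and $a(n)$ is reduced mod $\mathbb{F}_p[t]$. A family $a_1, \dots, a_m : \mathbb{F}_p[t] \to \mathbb{F}_p[t]$ is good for irrational equidistribution if for any $\alpha_1, \dots, \alpha_m \in \mathbb{F}_p((t^{-1}))$, not all rational, $\left( \sum_{i=1}^m a_i(n) \alpha_i \right)_{n \in \mathbb{F}_p[t]}$ is well-distributed mod $\mathbb{F}_p[t]$. Polynomials $P_i \in (\mathbb{F}_p[t])[y]$ are regarded as sequences $n \mapsto P_i(n)$, $\mathbb{F}_p[t] \to \mathbb{F}_p[t]$. *)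

(* Defs.v *)
From HB Require Import structures.
From mathcomp Require Import all_boot all_order all_algebra all_field.
From mathcomp Require Import ring_quotient finmap complex.
From mathcomp Require Import all_classical all_reals all_analysis.
From mathcomp Require Import measurable_realfun.
Set Implicit Arguments.
Unset Strict Implicit.
Unset Printing Implicit Defensive.
Import Order.TTheory GRing.Theory Num.Theory.
Import numFieldNormedType.Exports.
Local Open Scope ring_scope.
Local Open Scope quotient_scope.
Local Open Scope classical_set_scope.

(* The completion F_p((t^-1)): [x j] is the coefficient of t^j, and x j = 0 for
   j large. *)
Section Laurent.
Variable p : nat.

Definition laurent_pred : pred (int -> 'F_p) :=
  fun c => `[< exists N : int, forall j, (N < j)%R -> c j = 0 >].

Record laurent : Type := Laurent {
  lcoef :> int -> 'F_p;
  _ : lcoef \in laurent_pred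
}.

HB.instance Definition _ := [isSub for lcoef].
HB.instance Definition _ := [Choice of laurent by <:].

Lemma laurentP (x : laurent) : exists N : int, forall j, N < j -> x j = 0.
Proof. by case: x => c /= /asboolP. Qed.

Lemma laurent_eqP (x y : laurent) : (forall j, x j = y j) <-> x = y.
Proof. by split=> [e|-> //]; apply/val_inj/funext. Qed.

Lemma laurent_zmod_closed : zmod_closed laurent_pred.
Proof.
split=> [|c d /asboolP[N hN] /asboolP[M hM]]; apply/asboolP; first by exists 0.
exists (Num.max N M) => j; rewrite gt_max => /andP[Nj Mj].
by rewrite !fctE hN ?hM ?subr0.
Qed.
HB.instance Definition _ :=
  GRing.isZmodClosed.Build (int -> 'F_p) laurent_pred laurent_zmod_closed.
HB.instance Definition _ := [SubChoice_isSubZmodule of laurent by <:].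

Lemma lcoefD (x y : laurent) j : (x + y) j = x j + y j. Proof. by []. Qed.
Lemma lcoefN (x : laurent) j : (- x) j = - x j. Proof. by []. Qed.
Lemma lcoefB (x y : laurent) j : (x - y) j = x j - y j. Proof. by []. Qed.

(* The action of F_p[t] on F_p((t^-1)) by multiplication. *)
Definition lscale_coef (n : {poly 'F_p}) (x : laurent) : int -> 'F_p :=
  fun j => \sum_(i < size n) n`_i * x (j - i%:Z).

Lemma lscale_coef_subproof n x : lscale_coef n x \in laurent_pred.
Proof.
have [N hN] := laurentP x; apply/asboolP; exists (N + (size n)%:Z) => j Nj.
rewrite /lscale_coef big1// => i _; rewrite hN ?mulr0// ltrBrDr.
by apply: le_lt_trans Nj; rewrite lerD2l lez_nat ltnW.
Qed.

Definition lscale n x : laurent := Laurent (lscale_coef_subproof n x).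

Lemma lscaleE m (n : {poly 'F_p}) x j : (size n <= m)%N ->
  lscale n x j = \sum_(i < m) n`_i * x (j - i%:Z).
Proof.
move=> nm; rewrite /= /lscale_coef.
rewrite (big_ord_widen_cond m predT (fun i => n`_i * x (j - i%:Z)))//=.
rewrite [in RHS](bigID (fun i : 'I_m => (i < size n)%N))/=.
rewrite [X in _ = _ + X]big1 ?addr0// => i; rewrite -leqNgt => ni.
by rewrite nth_default ?mul0r.
Qed.

Lemma lscaleDl x n m : lscale (n + m) x = lscale n x + lscale m x.
Proof.
apply/laurent_eqP => j; rewrite lcoefD.
rewrite !(@lscaleE (maxn (size n) (size m))) ?size_polyD ?leq_maxl ?leq_maxr//.
by rewrite -big_split/=; apply: eq_bigr => i _; rewrite coefD mulrDl.
Qed.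

Lemma lscaleDr n x y : lscale n (x + y) = lscale n x + lscale n y.
Proof.
apply/laurent_eqP => j; rewrite lcoefD /= /lscale_coef -big_split/=.
by apply: eq_bigr => i _; rewrite mulrDr.
Qed.

Lemma lscaleC c x j : lscale c%:P x j = c * x j.
Proof.
by rewrite (@lscaleE 1) ?size_polyC_leq1// big_ord1 coefC eqxx subr0.
Qed.

Lemma lscaleX n x j : lscale ('X * n) x j = lscale n x (j - 1).
Proof.
rewrite (@lscaleE (size n).+1); last by rewrite (leq_trans (size_polyMleq _ _))// size_polyX.
rewrite (@lscaleE (size n))// big_ord_recl coefXM/= mul0r add0r.
by apply: eq_bigr => i _; rewrite coefXM/= intS opprD addrA.
Qed.

Lemma lscaleCM c n x : lscale (c%:P * n) x = lscale c%:P (lscale n x).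
Proof.
apply/laurent_eqP => j; rewrite lscaleC.
rewrite (@lscaleE (size n)); last by rewrite mul_polyC size_scale_leq.
rewrite /= /lscale_coef mulr_sumr.
by apply: eq_bigr => i _; rewrite coefCM mulrA.
Qed.

Lemma lscaleA n m x : lscale n (lscale m x) = lscale (n * m) x.
Proof.
elim/poly_ind: n m x => [|n c IHn] m x.
  by apply/laurent_eqP => j; rewrite mul0r /= /lscale_coef size_poly0 !big_ord0.
rewrite mulrDl !lscaleDl lscaleCM -!mulrA -!IHn; congr (lscale n _ + _).
apply/laurent_eqP => j.
by rewrite lscaleX -[in LHS](mulr1 'X) lscaleX -polyC1 lscaleC mul1r.
Qed.

Lemma lscale1 x : lscale 1 x = x.
Proof. by apply/laurent_eqP => j; rewrite -polyC1 lscaleC mul1r. Qed.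

HB.instance Definition _ := GRing.Zmodule_isLmodule.Build {poly 'F_p} laurent
  lscaleA lscale1 lscaleDr lscaleDl.

Definition laurent_of_poly_coef (n : {poly 'F_p}) (j : int) : 'F_p :=
  if j is Posz i then n`_i else 0.

Lemma laurent_of_poly_subproof n : laurent_of_poly_coef n \in laurent_pred.
Proof.
by apply/asboolP; exists (size n)%:Z => -[i|//] /ltW ni; rewrite /= nth_default.
Qed.

Definition laurent_of_poly n : laurent := Laurent (laurent_of_poly_subproof n).

(* x = m / n in F_p(t) *)
Definition is_rational (x : laurent) :=
  exists m n : {poly 'F_p}, n != 0 /\ n *: x = laurent_of_poly m.

(* The topology of the absolute value |.|: y and x agree in all degrees >= N iff
   |y - x| < p ^ N. *)
Definition laurent_open (U : set laurent) := forall x, U x ->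
  exists N : int, forall y : laurent, (forall j, N <= j -> y j = x j) -> U y.

Lemma laurent_openT : laurent_open setT.
Proof. by move=> x _; exists 0. Qed.

Lemma laurent_openI : setI_closed laurent_open.
Proof.
move=> U V oU oV x [/oU[N hN] /oV[M hM]]; exists (Num.min N M) => y hy.
by split; [apply: hN|apply: hM] => j hj; apply: hy; rewrite ge_min hj ?orbT.
Qed.

Lemma laurent_open_bigU (I : Type) (f : I -> set laurent) :
  (forall i, laurent_open (f i)) -> laurent_open (\bigcup_i f i).
Proof.
move=> of_ x [i _ /of_[N hN]]; exists N => y /hN fy; by exists i.
Qed.

HB.instance Definition _ := isOpenTopological.Build laurent
  laurent_openT laurent_openI laurent_open_bigU.

Definition laurent_poly : {pred laurent} :=
  fun x => `[< exists n, x = laurent_of_poly n >].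

Lemma laurent_int_part (x : laurent) :
  exists n, forall i : nat, laurent_of_poly n i = x i.
Proof.
have [N hN] := laurentP x; exists (\poly_(i < `|N|.+1) x i) => i.
rewrite /= coef_poly; case: ifPn => //; rewrite -leqNgt => iN; rewrite hN//.
by rewrite (le_lt_trans (ler_norm N))// -abszE ltz_nat.
Qed.

Lemma laurent_polyP (x : laurent) :
  reflect (forall j, x (Negz j) = 0) (x \in laurent_poly).
Proof.
rewrite /laurent_poly unfold_in; apply: (iffP (asboolP _)) => [[n -> //]|x0].
have [n nx] := laurent_int_part x; exists n.
by apply/laurent_eqP => -[i|i]; rewrite ?nx// x0.
Qed.

Lemma laurent_poly_zmod_closed : zmod_closed laurent_poly.
Proof.
split=> [|x y /laurent_polyP x0 /laurent_polyP y0]; apply/laurent_polyP => j//.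
by rewrite lcoefB x0 y0 subrr.
Qed.
HB.instance Definition _ :=
  GRing.isZmodClosed.Build laurent laurent_poly laurent_poly_zmod_closed.

(* The group F_p((t^-1)) / F_p[t], with the quotient topology. *)
Definition torus := Quotient.quot laurent_poly.
HB.instance Definition _ := EqQuotient.on torus.
HB.instance Definition _ := GRing.Zmodule.on torus.

HB.instance Definition _ := isPointed.Build torus 0.

Fact torus_openT : quotient_open [set: torus].
Proof. exact: openT. Qed.
Fact torus_openI : setI_closed (@quotient_open _ torus).
Proof. by move=> U V; exact: openI. Qed.
Fact torus_open_bigU (I : Type) (f : I -> set torus) :
  (forall i, quotient_open (f i)) -> quotient_open (\bigcup_i f i).
Proof. by move=> of_; apply: bigcup_open => i _; exact: of_. Qed.
HB.instance Definition _ := isOpenTopological.Build torus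
  torus_openT torus_openI torus_open_bigU.

Definition borel_torus := g_sigma_algebraType (@open torus).
End Laurent.

Definition haar_probability (R : realType) (p : nat)
    (mu : probability (borel_torus p) R) :=
  forall (x : torus p) (A : set (torus p)), measurable (A : set (borel_torus p)) ->
    mu ((fun y => x + y) @` A) = mu A.

(* Existence of a translation-invariant Borel probability on the torus: the image
   of the uniform distribution on [0, 1[ under the expansion in base [b], where
   [b] is the cardinal of 'F_p (so [b = p] when p is prime). *)
Section HaarExists.
Variables (R : realType) (p : nat).
Local Notation torus := (torus p).
Local Notation borel := (borel_torus p).
Local Notation laurent := (laurent p).

Definition frac_coef (x : torus) (j : nat) : 'F_p := repr x (Negz j).

Lemma frac_coef_pi (x : laurent) j : frac_coef (\pi_torus x) j = x (Negz j).
Proof.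
rewrite /frac_coef; apply/eqP; rewrite -subr_eq0 -lcoefB.
have /laurent_polyP -> // : repr (\pi_torus x) - x \in @laurent_poly p.
by rewrite Quotient.idealrBE reprK.
Qed.

Lemma frac_coefD (x y : torus) j :
  frac_coef (x + y) j = frac_coef x j + frac_coef y j.
Proof.
by rewrite -[x]reprK -[y]reprK -raddfD !frac_coef_pi lcoefD.
Qed.

Lemma frac_coefN (x : torus) j : frac_coef (- x) j = - frac_coef x j.
Proof. by rewrite -[x]reprK -raddfN !frac_coef_pi lcoefN. Qed.

Lemma frac_coef_inj (x y : torus) : frac_coef x =1 frac_coef y -> x = y.
Proof.
rewrite -[x]reprK -[y]reprK => xy; apply/eqP.
rewrite -Quotient.idealrBE; apply/laurent_polyP => j.
by rewrite lcoefB -!frac_coef_pi xy subrr.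
Qed.

Definition cyl (s : seq 'F_p) : set torus :=
  [set x | forall j, (j < size s)%N -> frac_coef x j = s`_j].

Lemma cyl_open s : open (cyl s).
Proof.
move=> x /= sx; exists (- (size s)%:Z) => y xy j js.
rewrite frac_coef_pi xy -?frac_coef_pi ?sx//.
by rewrite NegzE lerN2 lez_nat.
Qed.

Lemma open_cyl (U : set torus) (x : torus) : open U -> U x ->
  exists2 s, cyl s x & cyl s `<=` U.
Proof.
move=> oU Ux; have : (\pi_torus @^-1` U) (repr x) by rewrite /= reprK.
move=> /oU[N hN]; exists (mkseq (frac_coef x) `|N|).
  by move=> j; rewrite size_mkseq => jN; rewrite nth_mkseq.
move=> y; rewrite /cyl/= size_mkseq => xy.
pose z := repr x - repr y.
have [n nE] := laurent_int_part z.
have <- : \pi_torus (repr y + laurent_of_poly n) = y.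
  by apply/frac_coef_inj => j; rewrite frac_coef_pi lcoefD addr0.
apply: hN => -[i _|i iN]; first by rewrite lcoefD nE lcoefB addrC subrK.
have iN' : (i < `|N|)%N.
  by case: N iN {xy} => // k; rewrite !NegzE lerN2 lez_nat.
by rewrite lcoefD addr0 -!/(frac_coef _ _) xy// nth_mkseq.
Qed.

Let G : set (set borel) := [set A | A = set0 \/ exists s, A = cyl s].

Let measurable_G : measurable = <<s G >>.
Proof.
apply/seteqP; split => A.
  apply: smallest_sub; first exact: smallest_sigma_algebra.
  move=> {}A oA; rewrite (_ : A = \bigcup_n
     if @choice.unpickle (seq 'F_p) n is Some s then
       if `[< cyl s `<=` A >] then cyl s else set0 else set0).
    apply: sigma_algebra_bigcup => n;
    case: ifPn => _; last exact: sigma_algebra0.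
    by apply: sub_sigma_algebra; right; eexists.
  apply/seteqP; split => x.
    move=> /(open_cyl oA)[s sx sA]; exists (choice.pickle s) => //.
    by rewrite choice.pickleK asboolT.
  by case=> n _ /=; case: asboolP => // sA; exact: sA.
apply: smallest_sub; first exact: sigma_algebra_measurable.
move=> _ [->|[s ->]]; first exact: measurable0.
by apply: sub_sigma_algebra; exact: cyl_open.
Qed.

Let setI_G : setI_closed G.
Proof.
have cylI s t : (size s <= size t)%N -> G (cyl s `&` cyl t).
  move=> st; have [pst|pst] := eqVneq s (take (size s) t).
    right; exists t; apply/seteqP; split => [x [_ tx]|x tx]; first exact: tx.
    split; last exact: tx.
    move=> j js.
    by rewrite tx ?(leq_trans js)// pst nth_take.
  left; apply/seteqP; split => x //= -[sx tx]; move/eqP : pst; apply.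
  apply: (@eq_from_nth _ 0) => [|j js]; first by rewrite size_takel.
  by rewrite -sx// tx ?(leq_trans js)// nth_take.
move=> A B [->|[s ->]] [->|[t ->]]; rewrite ?set0I ?setI0; do ?by left.
have [st|/ltnW ts] := leqP (size s) (size t); first exact: cylI.
by rewrite setIC; exact: cylI.
Qed.

Let b := (Zp_trunc (pdiv p)).+2.

Definition digit (x : R) (j : nat) : 'F_p := inZp (Num.truncn (b%:R ^+ j.+1 * x)).

Definition of_digits_coef (x : R) (j : int) : 'F_p :=
  if j is Negz i then digit x i else 0.

Lemma of_digits_subproof x : of_digits_coef x \in @laurent_pred p.
Proof. by apply/asboolP; exists 0 => -[]. Qed.

Definition of_digits x : torus := \pi_torus (Laurent (of_digits_subproof x)).

Lemma frac_coef_of_digits x j : frac_coef (of_digits x) j = digit x j.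
Proof. by rewrite frac_coef_pi. Qed.

Lemma measurable_truncn_eq (c : R) (k : nat) :
  measurable [set x | Num.truncn (c * x) = k].
Proof.
have mle n : measurable [set x : R | (Num.truncn (c * x) <= n)%N].
  rewrite (_ : [set _ | _] = (fun x : R => c * x) @^-1` `]-oo, n.+1%:R[%classic).
    by rewrite -[X in measurable X]setTI; apply: mulrl_measurable.
  by apply/seteqP; split => x /=; rewrite in_itv/= truncn_le_nat.
case: k => [|k].
  rewrite (_ : [set _ | _] = [set x | (Num.truncn (c * x) <= 0)%N]) //.
  by apply/seteqP; split => x /=; rewrite leqn0 => /eqP.
rewrite (_ : [set _ | _] = [set x | (Num.truncn (c * x) <= k.+1)%N] `\`
  [set x | (Num.truncn (c * x) <= k)%N]); first exact: measurableD.
apply/seteqP; split => x /= => [->|[+ /negP]]; first by rewrite ltnn.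
by rewrite -ltnNge => h1 h2; apply/eqP; rewrite eqn_leq h1.
Qed.

Lemma measurable_digit j a : measurable [set x | digit x j = a].
Proof.
rewrite (_ : [set _ | _] = \bigcup_(k in [set k | inZp k = a])
   [set x | Num.truncn (b%:R ^+ j.+1 * x) = k]).
  by apply: bigcup_measurable => k _; exact: measurable_truncn_eq.
by apply/seteqP; split => x /= => [<-|[k /= <- <-]//]; exists (Num.truncn (b%:R ^+ j.+1 * x)).
Qed.

Lemma preimage_cyl s : of_digits @^-1` cyl s =
  \bigcap_(j in `I_(size s)) [set x | digit x j = s`_j].
Proof.
apply/seteqP; split => x h j js.
  by rewrite -(h j js) frac_coef_of_digits.
by rewrite frac_coef_of_digits; exact: h.
Qed.

Lemma measurable_of_digits :
  measurable_fun setT (of_digits : R -> borel).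
Proof.
apply: (measurability G) => //.
move=> _ [_ [->|[s ->]] <-]; first by rewrite preimage_set0 setI0.
rewrite setTI preimage_cyl.
by apply: bigcap_measurableType => j _; exact: measurable_digit.
Qed.

Definition digits_val (s : seq 'F_p) : nat := foldl (fun k (a : 'F_p) => k * b + a)%N 0%N s.

Lemma digits_val_rcons s a : digits_val (rcons s a) = (digits_val s * b + a)%N.
Proof. by rewrite /digits_val -cats1 foldl_cat. Qed.

Lemma digits_val_lt s : (digits_val s < b ^ size s)%N.
Proof.
elim/last_ind: s => [//|s a IHs]; rewrite digits_val_rcons size_rcons expnSr.
rewrite (@leq_trans (digits_val s * b + b)%N)//; first by rewrite ltn_add2l (ltn_ord a).
by rewrite -mulSnr leq_mul2r IHs orbT.
Qed.

Lemma truncn_divb (y : R) : 0 <= y -> (Num.truncn (b%:R * y) %/ b)%N = Num.truncn y.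
Proof.
move=> y0; apply/esym/truncn_def.
have b0 : (0 : R) < b%:R by rewrite ltr0n.
have /andP[ty yt] := truncn_itv (mulr_ge0 (ltW b0) y0).
rewrite -(ler_pM2l b0) -(ltr_pM2l b0) -!natrM; apply/andP; split.
  by apply: le_trans ty; rewrite ler_nat mulnC leq_divM.
by apply: (lt_le_trans yt); rewrite ler_nat mulnC -ltn_divLR.
Qed.

Lemma cyl_digitsP s (x : R) : 0 <= x < 1 ->
  (of_digits @^-1` cyl s) x <-> Num.truncn (b%:R ^+ size s * x) = digits_val s.
Proof.
move=> x01; rewrite preimage_cyl; elim/last_ind: s => [|s a IHs].
  split => //= _; rewrite expr0 mul1r; apply: truncn_def.
  by rewrite mulr0n.
have /andP[x0 _] := x01.
have E : (Num.truncn (b%:R ^+ (size s).+1 * x) %/ b)%N = Num.truncn (b%:R ^+ size s * x).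
  by rewrite exprS -mulrA truncn_divb// mulr_ge0// exprn_ge0.
rewrite digits_val_rcons size_rcons; split => [h|h].
  rewrite (divn_eq (Num.truncn _) b) E; congr (_ * _ + _)%N.
    apply/IHs => j js; have := h j (ltnW js).
    by rewrite /= nth_rcons js.
  have := h (size s) (ltnSn _); rewrite /= nth_rcons ltnn eqxx.
  by move=> /(congr1 val).
move=> j; rewrite /= ltnS leq_eqVlt nth_rcons => /predU1P[->|js].
  rewrite ltnn eqxx; apply/val_inj => /=; rewrite h.
  by rewrite modnMDl modn_small// (ltn_ord a).
rewrite js; apply: (IHs.2 _ j js).
by rewrite -E h divnMDl// divn_small ?addn0// (ltn_ord a).
Qed.

Let D01 : measurable (`[0, 1[%classic : set R).
Proof. exact: measurable_itv. Qed.

Definition unif01 : set (measurableTypeR R) -> \bar R :=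
  mrestr lebesgue_measure D01.

HB.instance Definition _ := Measure.on unif01.

Let unif01_setT : unif01 setT = 1%E.
Proof.
by rewrite /unif01 /mrestr setTI lebesgue_measure_itv/= lte01 oppr0 adde0.
Qed.

HB.instance Definition _ :=
  Measure_isProbability.Build _ _ _ unif01 unif01_setT.

Definition of_digits_borel : measurableTypeR R -> borel := of_digits.

HB.instance Definition _ :=
  isMeasurableFun.Build _ _ _ _ of_digits_borel measurable_of_digits.

Definition digit_prob : probability borel R :=
  distribution unif01 of_digits_borel.

Lemma digit_prob_cyl s : digit_prob (cyl s) = ((b%:R ^- size s)%:E)%E.
Proof.
have b0 : (0 : R) < b%:R ^+ size s by rewrite exprn_gt0// ltr0n.
rewrite /= /distribution /pushforward /unif01 /mrestr.
rewrite (_ : _ `&` _ = `[(digits_val s)%:R / b%:R ^+ size s,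
    (digits_val s).+1%:R / b%:R ^+ size s[%classic).
  rewrite lebesgue_measure_itv/= lte_fin ltr_pM2r ?invr_gt0// ltr_nat ltnSn.
  by rewrite -EFinB -mulrBl -natr1 addrAC subrr add0r mul1r.
apply/seteqP; split => x /=; rewrite !in_itv/=.
  move=> [sx x01]; have := (cyl_digitsP s x01).1 sx.
  have /andP[x0 _] := x01.
  have := truncn_itv (mulr_ge0 (ltW b0) x0) => /[swap] ->.
  by rewrite ler_pdivrMr// ltr_pdivlMr// ![x * _]mulrC.
rewrite ler_pdivrMr// ltr_pdivlMr// ![x * _]mulrC => /andP[kx xk].
have x01 : 0 <= x < 1.
  rewrite -(pmulr_rge0 x b0) (le_trans _ kx)//= -(ltr_pM2l b0) mulr1.
  by rewrite (lt_le_trans xk)// -natrX ler_nat digits_val_lt.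
by split => //; apply/cyl_digitsP => //; apply: truncn_def; rewrite kx.
Qed.

Definition translate (x : torus) : borel -> borel := fun y => x + y.

Lemma translate_cyl x s : translate x @^-1` cyl s =
  cyl (mkseq (fun j => s`_j - frac_coef x j) (size s)).
Proof.
apply/seteqP; split => y; rewrite /cyl/= size_mkseq => h j js.
  by rewrite nth_mkseq// -h// /translate frac_coefD addrAC subrr add0r.
by rewrite /translate frac_coefD h// nth_mkseq// addrC subrK.
Qed.

Lemma measurable_translate x : measurable_fun setT (translate x).
Proof.
apply: (measurability G) => //.
move=> _ [_ [->|[s ->]] <-]; first by rewrite preimage_set0 setI0.
rewrite setTI translate_cyl measurable_G.
by apply: sub_sigma_algebra; right; eexists.
Qed.

HB.instance Definition _ x := isMeasurableFun.Build _ _ borel borel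
  (translate x) (measurable_translate x).

Lemma haar_probability_exists :
  exists mu : probability borel R, haar_probability mu.
Proof.
exists digit_prob => x A mA.
rewrite (_ : _ @` A = translate (- x) @^-1` A); last first.
  apply/seteqP; split => y /=; rewrite /translate.
    by move=> [z Az <-]; rewrite addKr.
  by move=> Ay; exists (- x + y) => //; rewrite addNKr.
rewrite -[LHS]/(distribution digit_prob (translate (- x)) A).
apply: (measure_unique G (fun=> setT)) => //.
- by move=> _; right; exists [::]; apply/seteqP; split.
- by rewrite bigcup_const//; exists 0%N.
- move=> _ [->|[s ->]]; first by rewrite !measure0.
  rewrite -[LHS]/(digit_prob (translate (- x) @^-1` cyl s)).
  rewrite translate_cyl; apply: etrans (digit_prob_cyl _) _.
  by rewrite size_mkseq; exact: esym (digit_prob_cyl s).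
- move=> _; have : (digit_prob setT < +oo)%E by rewrite (probability_setT digit_prob) ltry.
  exact.
Qed.

End HaarExists.

Definition haar (R : realType) (p : nat) : probability (borel_torus p) R :=
  projT1 (cid (haar_probability_exists R p)).

Lemma haarP (R : realType) (p : nat) : haar_probability (haar R p).
Proof. exact: projT2 (cid (haar_probability_exists R p)). Qed.

(* The library integrates real-valued functions only. *)
Definition haar_integral (R : realType) (p : nat) (f : torus p -> R[i]) : R[i] :=
  Complex (\int[haar R p]_x complex.Re (f x)) (\int[haar R p]_x complex.Im (f x)).

Definition folner (R : realType) (p : nat) (Phi : nat -> {fset {poly 'F_p}}) :=
  (forall N, Phi N != fset0) /\
  forall n : {poly 'F_p},
    let shift N := [fset (x + n)%R | x in Phi N]%fset in
    (fun N => #|` ((shift N `\` Phi N) `|` (Phi N `\` shift N))%fset|%:R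
              / #|` Phi N|%:R : R) @ \oo --> (0 : R).

Definition well_distributed (R : realType) (p : nat)
    (a : {poly 'F_p} -> laurent p) :=
  forall f : torus p -> R[i], continuous (f : torus p -> (R[i])^o) ->
  forall Phi : nat -> {fset {poly 'F_p}}, folner R Phi ->
    (fun N => (#|` Phi N|%:R)^-1 * \sum_(n <- Phi N) f (\pi_(torus p) (a n))
      : (R[i])^o) @ \oo --> (haar_integral f : (R[i])^o).

Definition good_for_irrational_equidistribution (R : realType) (p m : nat)
    (a : 'I_m -> {poly 'F_p} -> {poly 'F_p}) :=
  forall alpha : 'I_m -> laurent p, ~ (forall i, is_rational (alpha i)) ->
    well_distributed R (fun n => \sum_(i < m) a i n *: alpha i).

Section FiniteField.
Variables (p : nat) (Q : {poly 'F_p}) (hQ : monic_irreducible_poly Q).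
Local Notation Fq := {poly %/ Q with hQ}.

Definition eval_mod (P : {poly {poly 'F_p}}) (y : Fq) : Fq :=
  (map_poly (in_qpoly Q : {poly 'F_p} -> Fq) P).[y].

Definition pattern (m : nat) (P : 'I_m -> {poly {poly 'F_p}}) (x y : Fq) :
    seq Fq :=
  x :: [seq x + eval_mod (P i) y | i <- enum 'I_m].
End FiniteField.

(* Main.v *)
Require Import Defs.
From mathcomp Require Import all_boot all_order all_algebra all_field.
From mathcomp Require Import all_classical all_reals all_analysis.
From mathcomp Require Import ring_quotient complex finmap.
From mathcomp Require Import zify ring lra.
Set Implicit Arguments.
Unset Strict Implicit.
Unset Printing Implicit Defensive.
Import Order.TTheory GRing.Theory Num.Theory.
Import numFieldNormedType.Exports.
Local Open Scope ring_scope.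

(** Let F be the field with q elements, write avg for normalized sums and let
    P_0 = 0. The number of patterns is q^2 times the average over x and y of
    prod_j f_j(x + P_j(y)), where f_j is the indicator of A_j. So the point is
    that for all 1-bounded functions f_j this average equals prod_j avg f_j up
    to an error O(q^-c), with c and the constant independent of F; this is
    [pattern_asymptotics]. All estimates are proved in the form X^(2^N) <= K / q
    ([small]), which is stable under sums and Cauchy-Schwarz.

    The hypothesis enters through additive characters. Let psi be a character of
    F = F_p[t] / Q that factors through the trace. If psi o sum_i c_i P_i were
    constant on F, with c <> 0, for infinitely many Q, then the functionals
    v_i |-> trace (c_i v_i mod Q) would be points x of (F_p((t^-1)) / F_p[t])^m
    for which the coefficient of t^-1 in sum_i P_i(n) x_i does not depend on n.
    These x form a closed group, infinitely many Q produce nonzero elements of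
    it that are arbitrarily small, and so the group is uncountable
    ([closed_group_uncountable]) and contains a point with an irrational
    coordinate. But a sequence with constant coefficient of t^-1 is not
    well-distributed. So the family is [nondegenerate] over F once Q has large
    degree ([annihilator_prime], [nondegenerate_pattern]).

    When all f_j are characters, nondegeneracy reduces the claim to a nontrivial
    bound for exponential sums ([exp_sum]). This is Weyl differencing, applied
    to polynomials without exponents divisible by p: since psi (z ^ p) = psi z,
    every polynomial can be brought into this form, and psi o P only changes by
    a constant factor.

    The general case is by induction on the number of functions that are not
    characters ([pattern_estimateS]). Singling out one of them, f, the average
    is the correlation of f with a dual function, and one has to show that the
    dual function minus its mean is small in L^2. Two facts combine. By PET
    induction ([pet_control]) pattern averages are controlled by some Gowers
    norm of each of the functions. And by degree lowering ([degree_lowering])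
    every Gowers norm of the centered dual function is small: were the norm of
    order s + 1 large, many differences of the dual function would correlate
    with characters; the induction hypothesis forces their frequencies to
    satisfy additive relations, so these characters are products of functions
    of fewer variables, and the norm of order s would be large as well. At the
    end there is only the correlation with one character, to which the induction
    hypothesis applies once more.

    The factor |A_0|^(1/2) comes from Cauchy-Schwarz ([pattern_asymptotics_L2]).
    For the density bound, a set without nontrivial patterns only contains
    patterns for which y is a root of some P_i - P_j, and there are at most
    O(|A|) of them ([trivial_pattern_card]). *)

(** * Averages and Gowers norms *)

Section Averages.
Variable C : numClosedFieldType.

Definition avg (T : finType) (f : T -> C) : C := (\sum_x f x) / #|T|%:R.

Definition bounded1 (T : Type) (f : T -> C) := forall x, `|f x| <= 1.

Section AvgTheory.
Variable T : finType.
Implicit Types f g : T -> C.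

Lemma eq_avg f g : f =1 g -> avg f = avg g.
Proof. by move=> fg; congr (_ / _); apply: eq_bigr. Qed.

Lemma avgD f g : avg (fun x => f x + g x) = avg f + avg g.
Proof. by rewrite /avg big_split/= mulrDl. Qed.

Lemma avgN f : avg (fun x => - f x) = - avg f.
Proof. by rewrite /avg sumrN mulNr. Qed.

Lemma avgB f g : avg (fun x => f x - g x) = avg f - avg g.
Proof. by rewrite avgD avgN. Qed.

Lemma avgMl c f : avg (fun x => c * f x) = c * avg f.
Proof. by rewrite /avg -mulr_sumr mulrA. Qed.

Lemma avgMr c f : avg (fun x => f x * c) = avg f * c.
Proof. by rewrite /avg -mulr_suml mulrAC. Qed.

Lemma avg_conj f : avg (fun x => (f x)^*) = (avg f)^*.
Proof. by rewrite /avg rmorphM/= fmorphV/= rmorph_nat rmorph_sum. Qed.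

Lemma avg_ge0 f : (forall x, 0 <= f x) -> 0 <= avg f.
Proof. by move=> f0; rewrite divr_ge0 ?ler0n// sumr_ge0. Qed.

Lemma ler_avg f g : (forall x, f x <= g x) -> avg f <= avg g.
Proof.
by move=> fg; rewrite ler_wpM2r ?invr_ge0 ?ler0n// ler_sum.
Qed.

Lemma ler_norm_avg f : `|avg f| <= avg (fun x => `|f x|).
Proof.
rewrite /avg normrM [ `|_^-1|]ger0_norm ?invr_ge0 ?ler0n//.
by rewrite ler_wpM2r ?invr_ge0 ?ler0n// ler_norm_sum.
Qed.

Lemma avg_const_le c : 0 <= c -> avg (fun _ : T => c) <= c.
Proof.
move=> c0; rewrite /avg sumr_const; have [->|T0] := eqVneq #|T| 0%N.
  by rewrite mulr0n mul0r.
by rewrite -[c *+ _]mulr_natr mulfK// pnatr_eq0.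
Qed.

Lemma avg_le c f : 0 <= c -> (forall x, f x <= c) -> avg f <= c.
Proof. by move=> c0 fc; apply: le_trans (ler_avg fc) (avg_const_le c0). Qed.

Lemma avg_bounded1 f : bounded1 f -> `|avg f| <= 1.
Proof. by move=> fb; apply: le_trans (ler_norm_avg _) _; apply: avg_le. Qed.

Lemma avg_const c (x0 : T) : avg (fun _ : T => c) = c.
Proof.
rewrite /avg sumr_const -[c *+ _]mulr_natr mulfK// pnatr_eq0 -lt0n.
by apply/card_gt0P; exists x0.
Qed.

(** Cauchy-Schwarz, by summing 2 f(x) f(y) <= f(x)^2 + f(y)^2 over A x A. *)
Lemma sum_sqr_le (A : pred T) f : (forall x, 0 <= f x) ->
  (\sum_(x | A x) f x) ^+ 2 <= #|A|%:R * \sum_(x | A x) f x ^+ 2.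
Proof.
move=> f0; rewrite -(ler_pM2r (ltr0Sn C 1)) expr2 big_distrlr/= mulr_suml.
have -> : #|A|%:R * (\sum_(x | A x) f x ^+ 2) * 2 =
    \sum_(x | A x) \sum_(y | A y) (f x ^+ 2 + f y ^+ 2).
  apply/esym; rewrite (eq_bigr (fun x => f x ^+ 2 *+ #|A| + \sum_(y | A y) f y ^+ 2)).
    rewrite big_split/= sumr_const sumrMnl/= -mulr2n.
    by rewrite -[LHS]mulr_natr [X in _ = X * _]mulr_natl.
  by move=> x _; rewrite big_split/= sumr_const.
apply: ler_sum => x _; rewrite mulr_suml; apply: ler_sum => y _.
rewrite -subr_ge0 (_ : _ - _ = (f x - f y) ^+ 2); last by ring.
by rewrite real_exprn_even_ge0// rpredB// ger0_real.
Qed.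

Lemma avg_sqr f : (forall x, 0 <= f x) -> avg f ^+ 2 <= avg (fun x => f x ^+ 2).
Proof.
move=> f0; have [T0|T0] := eqVneq #|T| 0%N.
  by rewrite /avg T0 invr0 !mulr0 expr0n.
have h : (\sum_x f x) ^+ 2 <= #|T|%:R * \sum_x f x ^+ 2 := sum_sqr_le predT f0.
rewrite /avg exprMn -(ler_pM2r (_ : 0 < #|T|%:R ^+ 2)); last first.
  by rewrite exprn_gt0// ltr0n lt0n.
rewrite -mulrA -exprMn mulVf ?pnatr_eq0// expr1n mulr1.
rewrite expr2 mulrA mulfVK ?pnatr_eq0//.
by move: h; rewrite mulrC.
Qed.

End AvgTheory.

Lemma exchange_avg (S T : finType) (f : S -> T -> C) :
  avg (fun x => avg (f x)) = avg (fun y => avg (fun x => f x y)).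
Proof. by rewrite /avg -!mulr_suml exchange_big/= mulrAC. Qed.

(** Exponents 2 ^ n are the ones that iterating Cauchy-Schwarz produces. *)
Lemma expr_2S (R : pzSemiRingType) (a : R) n :
  a ^+ (2 ^ n.+1) = (a ^+ 2) ^+ (2 ^ n).
Proof. by rewrite expnS exprM. Qed.

Lemma expr_2Sr (R : pzSemiRingType) (a : R) n :
  a ^+ (2 ^ n.+1) = (a ^+ (2 ^ n)) ^+ 2.
Proof. by rewrite expnSr exprM. Qed.

Lemma avg_pow2 (T : finType) n (f : T -> C) : (forall x, 0 <= f x) ->
  avg f ^+ (2 ^ n) <= avg (fun x => f x ^+ (2 ^ n)).
Proof.
elim: n f => [|n IHn] f f0; first by rewrite expr1; exact: ler_avg.
rewrite expr_2S (le_trans (lerXn2r (2 ^ n) _ _ (avg_sqr f0))) ?nnegrE//.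
- by rewrite exprn_ge0// avg_ge0.
- by apply: avg_ge0 => x; rewrite exprn_ge0.
rewrite (le_trans (IHn _ _))// => [x|]; first by rewrite exprn_ge0.
by apply: ler_avg => x; rewrite expr_2S.
Qed.

Lemma norm_avg_pow2 (T : finType) n (f : T -> C) :
  `|avg f| ^+ (2 ^ n) <= avg (fun x => `|f x| ^+ (2 ^ n)).
Proof.
apply: le_trans (avg_pow2 n (fun x => normr_ge0 (f x))).
by rewrite lerXn2r ?nnegrE ?ler_norm_avg// avg_ge0.
Qed.

Lemma pow2D_le (a b : C) n : 0 <= a -> 0 <= b ->
  (a + b) ^+ (2 ^ n) <= (2 ^ 2 ^ n)%:R * (a ^+ (2 ^ n) + b ^+ (2 ^ n)).
Proof.
move=> a0 b0; have h (c d : C) : 0 <= c -> c <= d ->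
    (c + d) ^+ (2 ^ n) <= (2 ^ 2 ^ n)%:R * (c ^+ (2 ^ n) + d ^+ (2 ^ n)).
  move=> c0 cd; have d0 := le_trans c0 cd.
  apply: (@le_trans _ _ ((2 * d) ^+ (2 ^ n))).
    by rewrite lerXn2r ?nnegrE ?addr_ge0 ?mulr_ge0// mulr_natl mulr2n lerD2r.
  by rewrite exprMn natrX ler_wpM2l ?exprn_ge0// lerDr exprn_ge0.
have /orP[ab|ba] := real_leVge (ger0_real a0) (ger0_real b0).
  exact: h.
by rewrite addrC [X in _ * X]addrC; apply: h.
Qed.

Section Group.
Variable G : finZmodType.
Implicit Types f g : G -> C.

Lemma avg_shift f a : avg (fun x => f (x + a)) = avg f.
Proof.
by rewrite /avg [in RHS](reindex_inj (addIr a)).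
Qed.

Definition dmul (k : G) f : G -> C := fun x => f (x + k) * (f x)^*.

(** Expand the square and substitute y = x + k; every differencing step below
    comes from this identity. *)
Lemma norm_avg_sqr f : `|avg f| ^+ 2 = avg (fun k => avg (dmul k f)).
Proof.
rewrite normCK -avg_conj -avgMl exchange_avg; apply: eq_avg => x.
rewrite -avgMr -(avg_shift _ x); apply: eq_avg => k.
by rewrite /dmul addrC.
Qed.

Lemma bounded1_dmul k f : bounded1 f -> bounded1 (dmul k f).
Proof. by move=> fb x; rewrite normrM norm_conjC mulr_ile1. Qed.

Lemma eq_dmul k f g : f =1 g -> dmul k f =1 dmul k g.
Proof. by move=> fg x; rewrite /dmul !fg. Qed.

Lemma dmul_conj k f : dmul k (fun x => (f x)^*) =1 fun x => (dmul k f x)^*.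
Proof. by move=> x; rewrite /dmul rmorphM. Qed.

Lemma dmulC k l f : dmul k (dmul l f) =1 dmul l (dmul k f).
Proof.
move=> x; rewrite /dmul !rmorphM /= !conjCK addrAC; ring.
Qed.

(** The Gowers uniformity norm of order s + 1 of f, raised to the power 2 ^
    (s + 1). *)
Fixpoint gowers s f : C :=
  if s is s'.+1 then avg (fun k => gowers s' (dmul k f)) else `|avg f| ^+ 2.

Lemma eq_gowers s f g : f =1 g -> gowers s f = gowers s g.
Proof.
elim: s f g => [|s IHs] f g fg /=; first by rewrite (eq_avg fg).
by apply: eq_avg => k; apply: IHs; apply: eq_dmul.
Qed.

Lemma gowers_ge0 s f : 0 <= gowers s f.
Proof.
by elim: s f => [|s IHs] f /=; [rewrite exprn_ge0|apply: avg_ge0].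
Qed.

Lemma gowers_conj s f : gowers s (fun x => (f x)^*) = gowers s f.
Proof.
elim: s f => [|s IHs] f /=; first by rewrite avg_conj norm_conjC.
by apply: eq_avg => k; rewrite (eq_gowers _ (dmul_conj k f)) IHs.
Qed.

(** For s = 0 this is Cauchy-Schwarz for k |-> avg (dmul k f), whose average
    is |avg f|^2; for larger s, Cauchy-Schwarz in the outermost difference
    reduces s by one. *)
Lemma gowersS s f : gowers s f ^+ 2 <= gowers s.+1 f.
Proof.
elim: s f => [|s IHs] f; last first.
  rewrite [gowers s.+1 f]/= (le_trans (avg_sqr _))// => [k|].
    exact: gowers_ge0.
  by apply: ler_avg => k; exact: IHs.
rewrite /= -[X in X ^+ 2]ger0_norm ?exprn_ge0// norm_avg_sqr.
exact: (norm_avg_pow2 1).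
Qed.

Lemma gowers_mono s j f : gowers s f ^+ (2 ^ j) <= gowers (s + j) f.
Proof.
elim: j => [|j IHj]; first by rewrite addn0 expr1.
rewrite expr_2Sr addnS (le_trans _ (gowersS _ _))//.
by rewrite lerXn2r ?nnegrE ?exprn_ge0 ?gowers_ge0.
Qed.

End Group.
End Averages.

(** * Degrees of polynomial maps and the PET step *)

Section DifferenceDegree.
Variable F : finFieldType.
Implicit Types p q r b : {poly F}.

Definition shiftp (h : F) p : {poly F} := p \Po ('X + h%:P).

Lemma horner_shiftp h p y : (shiftp h p).[y] = p.[y + h].
Proof. by rewrite /shiftp horner_comp !hornerE. Qed.

Lemma shiftpB h p q : shiftp h (p - q) = shiftp h p - shiftp h q.
Proof. by rewrite /shiftp linearB. Qed.

Lemma shiftpD h p q : shiftp h (p + q) = shiftp h p + shiftp h q.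
Proof. by rewrite /shiftp linearD. Qed.

Lemma shiftp0 p : shiftp 0 p = p.
Proof. by rewrite /shiftp addr0 comp_polyXr. Qed.

Lemma shiftpA h k p : shiftp h (shiftp k p) = shiftp (h + k) p.
Proof.
rewrite /shiftp -comp_polyA; congr (_ \Po _).
by rewrite linearD/= comp_polyX comp_polyC polyCD addrA.
Qed.

Lemma shiftpK h p : shiftp (- h) (shiftp h p) = p.
Proof. by rewrite shiftpA addNr shiftp0. Qed.

Lemma size_shiftp h p : size (shiftp h p) = size p.
Proof. by rewrite size_comp_poly2// size_XaddC. Qed.

Lemma size_diffp h p : (size (shiftp h p - p)%R <= (size p).-1)%N.
Proof.
have [->|p0] := eqVneq p 0; first by rewrite /shiftp comp_poly0 subrr size_poly0.
have sp : (size p).-1.+1 = size p by rewrite prednK// size_poly_gt0.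
have sle : (size (shiftp h p - p)%R <= size p)%N.
  by rewrite (leq_trans (size_polyD _ _))// size_polyN size_shiftp maxnn.
rewrite -ltnS sp ltn_neqAle sle andbT; apply/eqP => e.
have : lead_coef (shiftp h p - p) = 0.
  rewrite /lead_coef e coefB.
  have -> : (shiftp h p)`_(size p).-1 = lead_coef (shiftp h p).
    by rewrite /lead_coef size_shiftp.
  rewrite lead_coef_comp ?size_XaddC//.
  by rewrite lead_coefXaddC expr1n mulr1 /lead_coef subrr.
by move/eqP; rewrite lead_coef_eq0 -size_poly_eq0 e size_poly_eq0 (negbTE p0).
Qed.

(** The degree of p as a map of the additive group of F: [deg_lt d p] holds
    when all d-fold differences vanish. It can be much smaller than the
    degree of the polynomial, since x |-> x ^ p is additive in characteristic
    p. *)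
Fixpoint deg_lt d p : bool :=
  if d is d'.+1 then [forall h, deg_lt d' (shiftp h p - p)]
  else [forall y, p.[y] == 0].

Lemma deg_lt0P p : reflect (forall y, p.[y] = 0) (deg_lt 0 p).
Proof. by apply: (iffP forallP) => h y; apply/eqP. Qed.

Lemma deg_ltSP d p : reflect (forall h, deg_lt d (shiftp h p - p)) (deg_lt d.+1 p).
Proof. exact: forallP. Qed.

Lemma deg_lt_diff d p h : deg_lt d.+1 p -> deg_lt d (shiftp h p - p).
Proof. by move/deg_ltSP. Qed.

Lemma deg_ltD d p q : deg_lt d p -> deg_lt d q -> deg_lt d (p + q).
Proof.
elim: d p q => [|d IHd] p q.
  by move=> /deg_lt0P hp /deg_lt0P hq; apply/deg_lt0P => y; rewrite hornerD hp hq addr0.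
by move=> /deg_ltSP hp /deg_ltSP hq; apply/deg_ltSP => h; rewrite shiftpD opprD addrACA IHd.
Qed.

Lemma deg_ltN d p : deg_lt d p -> deg_lt d (- p).
Proof.
elim: d p => [|d IHd] p.
  by move=> /deg_lt0P hp; apply/deg_lt0P => y; rewrite hornerN hp oppr0.
by move=> /deg_ltSP hp; apply/deg_ltSP => h; rewrite /shiftp linearN/= -opprD IHd//; exact: hp.
Qed.

Lemma deg_ltB d p q : deg_lt d p -> deg_lt d q -> deg_lt d (p - q).
Proof. by move=> hp hq; rewrite deg_ltD ?deg_ltN. Qed.

Lemma deg_lt_subC d p q : deg_lt d (p - q) = deg_lt d (q - p).
Proof. by apply/idP/idP => /deg_ltN; rewrite opprB. Qed.

Lemma deg_lt_shiftW d h p : deg_lt d p -> deg_lt d (shiftp h p).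
Proof.
elim: d p => [|d IHd] p.
  by move=> /deg_lt0P hp; apply/deg_lt0P => y; rewrite horner_shiftp hp.
move=> /deg_ltSP hp; apply/deg_ltSP => k.
by rewrite shiftpA (addrC k) -shiftpA -shiftpB IHd//; exact: hp.
Qed.

Lemma deg_lt_shift d h p : deg_lt d (shiftp h p) = deg_lt d p.
Proof.
by apply/idP/idP => [/(deg_lt_shiftW (- h))|/deg_lt_shiftW->//]; rewrite shiftpK.
Qed.

Lemma deg_ltS d p : deg_lt d p -> deg_lt d.+1 p.
Proof. by move=> hp; apply/deg_ltSP => h; rewrite deg_ltB ?deg_lt_shift. Qed.

Lemma deg_lt_leq d e p : (d <= e)%N -> deg_lt d p -> deg_lt e p.
Proof.
by move=> /subnK <-; elim: (e - d)%N => // k IHk /IHk; rewrite addSn; exact: deg_ltS.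
Qed.

Lemma deg_lt_size d p : (size p <= d)%N -> deg_lt d p.
Proof.
elim: d p => [|d IHd] p sp.
  apply/deg_lt0P => y.
  by move: sp; rewrite leqn0 size_poly_eq0 => /eqP ->; rewrite horner0.
by apply/deg_ltSP => h; apply: IHd; rewrite (leq_trans (size_diffp _ _))//; case: (size p) sp.
Qed.

Lemma deg_lt1P p : reflect (forall x y, p.[x] = p.[y]) (deg_lt 1 p).
Proof.
apply: (iffP (deg_ltSP _ _)) => [h x y|h k].
  have /deg_lt0P/(_ y)/eqP := h (x - y).
  by rewrite hornerD hornerN horner_shiftp (addrC y) subrK subr_eq0 => /eqP.
by apply/deg_lt0P => y; apply/eqP; rewrite hornerD hornerN horner_shiftp subr_eq0 (h _ y).
Qed.

Lemma deg_lt2_horner p x h : deg_lt 2 p -> p.[x + h] = p.[x] + (p.[h] - p.[0]).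
Proof.
move=> /(deg_lt_diff h) /deg_lt1P /(_ x 0).
rewrite !hornerD !hornerN !horner_shiftp add0r => e.
by rewrite -e addrCA subrr addr0.
Qed.

Lemma card_roots_le D p : p != 0 -> (size p <= D)%N ->
  (#|[pred x | root p x]| <= D)%N.
Proof.
move=> p0 pD; apply: leq_trans pD.
rewrite ltnW// cardE; apply: max_poly_roots p0 _ (enum_uniq _).
by apply/allP => x; rewrite mem_enum.
Qed.

(** For fixed y and fixed differences, the d-fold difference of u h at y is a
    polynomial in h of size at most D, and it does not vanish at h0 for some
    choice of them. Hence the degree of the members of a polynomial family is
    generically the largest one. *)
Lemma deg_lt_generic d D (u : F -> {poly F}) :
  (forall y, exists2 c : {poly F}, (size c <= D)%N & forall h, (u h).[y] = c.[h]) ->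
  forall h0, ~~ deg_lt d (u h0) -> (#|[pred h | deg_lt d (u h)]| <= D)%N.
Proof.
elim: d u => [|d IHd] u uD h0.
  move=> /forallPn[y uy]; have [c cD cE] := uD y.
  have c0 : c != 0 by apply: contraNneq uy => c0; rewrite cE c0 horner0.
  apply: leq_trans (card_roots_le c0 cD); apply: subset_leq_card.
  by apply/fintype.subsetP => h; rewrite !inE => /deg_lt0P/(_ y); rewrite cE => /eqP.
move=> /forallPn[k uk]; apply: leq_trans (IHd (fun h => shiftp k (u h) - u h) _ h0 uk).
  by apply: subset_leq_card; apply/fintype.subsetP => h; rewrite !inE => /deg_ltSP.
move=> y; have [c cD cE] := uD (y + k); have [c' cD' cE'] := uD y.
exists (c - c') => [|h]; last by rewrite !hornerD !hornerN horner_shiftp cE cE'.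
by rewrite (leq_trans (size_polyD _ _))// size_polyN geq_max cD.
Qed.

Lemma shiftp_param D p b : (size p <= D)%N -> (0 < D)%N -> forall y,
  exists2 c : {poly F}, (size c <= D)%N & forall h, (shiftp h p - b).[y] = c.[h].
Proof.
move=> pD D0 y; exists (shiftp y p - b.[y]%:P) => [|h].
  rewrite (leq_trans (size_polyD _ _))// size_polyN size_shiftp geq_max pD.
  by rewrite (leq_trans (size_polyC_leq1 _)).
by rewrite !hornerD !hornerN !horner_shiftp hornerC (addrC y).
Qed.

Lemma card_shift_deg_lt_le d D p b h0 : (size p <= D)%N ->
  ~~ deg_lt d (shiftp h0 p - b) ->
  (#|[pred h | deg_lt d (shiftp h p - b)%R]| <= D.+1)%N.
Proof.
by move=> pD; apply: deg_lt_generic; apply: shiftp_param => //; apply: leqW.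
Qed.

(** The data of the PET induction. The tracked polynomial p1 has the largest
    degree, and differs from every other member by a nonconstant map. The
    weight w bounds, for each degree i, the number of classes of members of
    exact degree i modulo maps of smaller degree. The bounds D and n do not
    refer to F, so that the final constants do not depend on it. *)
Definition pet_family (d0 D : nat) (w : nat -> nat) (n : nat) (p1 : {poly F})
    (ps : seq {poly F}) : Prop :=
  [/\ exists d, [/\ (0 < d <= d0)%N, ~~ deg_lt d p1 & {in p1 :: ps, forall p, deg_lt d.+1 p}],
      {in p1 :: ps, forall p : {poly F}, (size p <= D)%N},
      {in ps, forall p, ~~ deg_lt 1 (p1 - p)},
      (size ps <= n)%N &
      exists R : nat -> seq {poly F}, forall i, (0 < i <= d0)%N ->
        (size (R i) <= w i)%N /\
        {in p1 :: ps, forall p, deg_lt i.+1 p -> ~~ deg_lt i p ->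
           has (fun r => deg_lt i (p - r)) (R i)}].

(** What one van der Corput step with base b makes of the family, apart from
    its tracked member [shiftp h p1 - b]. *)
Definition pet_next (ps : seq {poly F}) (p1 b : {poly F}) (h : F) : seq {poly F} :=
  (p1 - b) :: [seq shiftp h p - b | p <- ps] ++ [seq p - b | p <- ps].

(** Subtracting a base of degree i0 preserves the classes of degree above i0
    and destroys the class of the base; the new classes of degree below i0
    are only bounded by the number of all members. *)
Definition pet_weight (w : nat -> nat) (n i0 i : nat) : nat :=
  if (i0 < i)%N then w i else if i == i0 then (w i).-1 else n.+1.*2.

Lemma deg_lt_min_level (d : nat) (A : seq {poly F}) :
  A != [::] -> {in A, forall p, ~~ deg_lt 1 p} -> {in A, forall p, deg_lt d.+1 p} ->
  exists i0, [/\ (0 < i0 <= d)%N, exists2 b, b \in A & deg_lt i0.+1 b &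
    {in A, forall p, ~~ deg_lt i0 p}].
Proof.
move=> A0 A1 Ad.
have exi : exists i, has (deg_lt i.+1) A.
  by exists d; case: A A0 A1 Ad => //= p A _ _ ->//; rewrite mem_head.
case: (ex_minnP exi) => i0 /hasP[b bA bi] imin.
have i0_gt0 : (0 < i0)%N by case: i0 bi {imin} => // b1; have := A1 b bA; rewrite b1.
exists i0; split; first by rewrite i0_gt0/= imin//; apply/hasP; exists b => //; apply: Ad.
  by exists b.
move=> p pA; apply/negP => pi; have : (i0 <= i0.-1)%N.
  by apply: imin; apply/hasP; exists p; rewrite ?prednK.
by rewrite leqNgt ltn_predL i0_gt0.
Qed.

Lemma card_predU_le (A B : pred F) : (#|[predU A & B]| <= #|A| + #|B|)%N.
Proof. by rewrite -cardUI leq_addr. Qed.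

Lemma card_has_le D (P : {poly F} -> pred F) (A : seq {poly F}) :
  {in A, forall p, #|P p| <= D}%N ->
  (#|[pred h | has (fun p => P p h) A]| <= size A * D)%N.
Proof.
elim: A => [|p A IHA] PA /=; first by rewrite eq_card0.
rewrite (leq_trans (card_predU_le (P p) [pred h | has (fun p => P p h) A]))//.
rewrite mulSn leq_add ?PA ?mem_head// IHA// => q qA.
by rewrite PA// inE qA orbT.
Qed.

(** The base b has the least degree i0 among the nonconstant members. An h is
    exceptional if some [shiftp h p1 - p] is constant, or if p1 - b has a
    smaller degree than p1 and [shiftp h p1 - b] drops by more than one
    degree; by [deg_lt_generic] there are few such h. *)
Lemma pet_step d0 D w n (p1 : {poly F}) (ps : seq {poly F}) :
  pet_family d0 D w n p1 ps ->
  {in p1 :: ps, forall p, deg_lt 2 p} \/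
  exists i0 b (B : pred F),
    [/\ (0 < i0 <= d0)%N, (0 < w i0)%N, (#|B| <= n.+2 * D.+1)%N &
     forall h, ~~ B h -> pet_family d0 D (pet_weight w n i0) n.+1.*2
       (shiftp h p1 - b) (pet_next [seq p <- ps | ~~ deg_lt 1 p] p1 b h)].
Proof.
move=> [[d [dd0 p1d psd]] psD p1ps psn [R hR]].
have [d1|d2] := leqP d 1.
  by left => p pps; apply: deg_lt_leq (psd p pps).
right; set psc := [seq p <- ps | ~~ deg_lt 1 p].
pose A := p1 :: psc.
have subA : {subset A <= p1 :: ps}.
  by move=> p; rewrite !inE mem_filter => /orP[->//|/andP[_ ->]]; rewrite orbT.
have [d_gt0 dled0] := andP dd0.
have A1 : {in A, forall p, ~~ deg_lt 1 p}.
  move=> p; rewrite inE mem_filter => /predU1P[->|/andP[]//].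
  by apply: contra p1d; apply: deg_lt_leq.
have Ad : {in A, forall p, deg_lt d.+1 p} by move=> p /subA/psd.
have [//|i0 [/andP[i0_gt0 i0d] [b0 b0A b0i] i0A]] := deg_lt_min_level _ A1 Ad.
have i0d0 := leq_trans i0d dled0.
(* A base outside the top class of p1 keeps the degree d of the tracked
   member. If no such base exists, all members lie in the top class of p1,
   and the tracked member gets degree d.-1 instead. *)
have [b [bA bi hb]] : exists b, [/\ b \in A, deg_lt i0.+1 b &
    ~~ deg_lt d (p1 - b) \/ [/\ b = p1, i0 = d & {in A, forall p, deg_lt d (p - p1)}]].
  have [/hasP[b bA /andP[bi bp]]|/hasPn h] := boolP (has (fun b => deg_lt i0.+1 b && ~~ deg_lt d (p1 - b)) A).
    by exists b; split => //; left.
  have hd p : p \in A -> deg_lt i0.+1 p -> deg_lt d (p1 - p).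
    by move=> pA pi; have := h p pA; rewrite pi/= negbK.
  have i0E : i0 = d.
    apply/eqP; rewrite eqn_leq i0d leqNgt; apply/negP => i0d'.
    move/negP: p1d; apply; rewrite -(subrK b0 p1) deg_ltD ?hd//.
    exact: deg_lt_leq b0i.
  exists p1; split; [exact: mem_head|by rewrite i0E Ad// mem_head|].
  by right; split=> // p pA; rewrite deg_lt_subC hd// i0E Ad.
have wi0 : (0 < w i0)%N.
  have [Rw hRi] := hR i0 (introT andP (conj i0_gt0 i0d0)).
  apply: leq_trans Rw; have := hRi b (subA b bA) bi (i0A b bA).
  by case: (R i0).
(* The first set makes the tracked member differ from the others by
   nonconstant maps, the second one guards its degree when b is in the top
   class of p1. *)
pose P p : pred F := [pred h | deg_lt 1 (shiftp h p1 - p)%R].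
pose Q : pred F := [pred h | deg_lt d (p1 - b) && deg_lt d.-1 (shiftp h p1 - b)%R].
exists i0, b, [predU [pred h | has (fun p => P p h) A] & Q].
split; rewrite ?i0_gt0//.
  apply: leq_trans (card_predU_le _ _) _.
  rewrite -[n.+2]addn1 mulnDl mul1n leq_add//.
    apply: (leq_trans (card_has_le (D := D.+1) _)).
      move=> p; rewrite inE => /predU1P[->|]; last first.
        move=> pp; apply: (@card_shift_deg_lt_le 1 D p1 p 0).
          by rewrite psD// mem_head.
        by rewrite shiftp0 p1ps//; move: pp; rewrite mem_filter => /andP[].
      have : ~~ deg_lt 2 p1 by apply: contra p1d; apply: deg_lt_leq.
      case/forallPn => h0 hh0; apply: (@card_shift_deg_lt_le 1 D p1 p1 h0) => //; rewrite ?psD ?mem_head//.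
    rewrite leq_mul2r/= ltnS size_filter (leq_trans (count_size _ _))//.
  have [p1b|p1b] := boolP (deg_lt d (p1 - b)); last first.
    by rewrite eq_card0// => h; rewrite inE/= (negbTE p1b).
  apply: (@leq_trans #|[pred h | deg_lt d.-1 (shiftp h p1 - b)%R]|).
    by apply: subset_leq_card; apply/fintype.subsetP => h; rewrite !inE => /andP[].
  have : ~~ deg_lt d.-1.+1 p1 by rewrite prednK.
  case/forallPn => h1 ph1.
  have [h0 hh0] : exists h0, ~~ deg_lt d.-1 (shiftp h0 p1 - b).
    have [e|] := boolP (deg_lt d.-1 (p1 - b)); last by exists 0; rewrite shiftp0.
    exists h1; apply: contra ph1 => e1.
    by have := deg_ltB e1 e; rewrite opprB addrA subrK.
  by apply: (@card_shift_deg_lt_le d.-1 D p1 b h0) => //; rewrite psD// mem_head.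
move=> h; rewrite inE negb_or => /andP[/hasPn/= hP hQ].
set t := shiftp h p1 - b; set N := pet_next psc p1 b h.
have memN e : e \in t :: N -> exists p k, p \in A /\ e = shiftp k p - b.
  rewrite inE => /predU1P[->|]; first by exists p1, h; rewrite mem_head.
  rewrite inE mem_cat => /predU1P[->|/orP[]/mapP[p pp ->]].
  - by exists p1, 0; rewrite shiftp0 mem_head.
  - by exists p, h; rewrite inE pp orbT.
  - by exists p, 0; rewrite shiftp0 inE pp orbT.
have eE k p : shiftp k p - b = (p - b) + (shiftp k p - p).
  by rewrite [RHS]addrC addrA subrK.
have deg_ltA k p i : p \in A -> (d <= i)%N -> deg_lt i (shiftp k p - p).
  by move=> pA di; apply: deg_lt_leq di _; apply: deg_lt_diff; apply: Ad.
have sN : (size N <= n.*2.+1)%N.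
  rewrite /N /= size_cat !size_map -/psc addnn ltnS leq_double.
  by rewrite (leq_trans _ psn)// size_filter count_size.
split.
- case: hb => [p1b|[bE i0E hA]].
    exists d; split => //.
      apply: contra p1b => td.
      have := deg_ltB td (deg_ltA h p1 d (mem_head _ _) (leqnn d)).
      by rewrite /t eE addrK.
    move=> e /memN[p [k [pA ->]]]; apply: deg_ltB; first by rewrite deg_lt_shift Ad.
    exact: Ad.
  have d'_gt0 : (0 < d.-1)%N by case: (d) d2 => [|[]].
  exists d.-1; split.
  + by rewrite d'_gt0 (leq_trans (leq_pred d)).
  + by move: hQ; rewrite /Q/= {1}bE subrr (deg_lt_size _)// size_poly0.
  + move=> e /memN[p [k [pA ->]]]; rewrite prednK// eE deg_ltD ?deg_ltA//.
    by rewrite bE hA.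
- move=> e /memN[p [k [pA ->]]].
  rewrite (leq_trans (size_polyD _ _))// size_polyN size_shiftp geq_max.
  by rewrite !psD// subA.
- move=> e; rewrite inE mem_cat => /predU1P[->|/orP[]/mapP[p]].
  + by rewrite /t opprB addrA subrK; apply: hP; rewrite mem_head.
  + rewrite mem_filter => /andP[_ pp] ->.
    by rewrite /t opprB addrA subrK -shiftpB deg_lt_shift p1ps.
  + by move=> pp ->; rewrite /t opprB addrA subrK; apply: hP; rewrite inE pp orbT.
- by rewrite (leq_trans sN)// doubleS.
exists (fun i => if (i0 < i)%N then R i else if i == i0 then
   [seq r - b | r <- R i0 & ~~ deg_lt i0 (b - r)] else t :: N) => i idd0.
have [/andP[i_gt0 _] [Rw hRi]] := (idd0, hR i idd0).
rewrite /pet_weight; case: ltngtP => [i0i|ii0|iE].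
- split => // e /memN[p [k [pA ->]]] ei eni.
  have bi' : deg_lt i b by apply: deg_lt_leq bi.
  have pi' : deg_lt i.+1 p.
    by rewrite -(deg_lt_shift _ k) -(subrK b (shiftp k p)) deg_ltD// deg_ltS.
  have [|r rR pr] := hasP (hRi p (subA p pA) pi' _).
    by apply: contra eni => pi1; rewrite deg_ltB// deg_lt_shift.
  apply/hasP; exists r => //.
  rewrite (_ : _ - r = (p - r) + (shiftp k p - p) - b); last by ring.
  by rewrite deg_ltB// deg_ltD// deg_lt_diff.
- split; first by rewrite /= (leq_ltn_trans sN)// doubleS.
  move=> e eN _ _; apply/hasP; exists e => //.
  by rewrite subrr deg_lt_size// size_poly0.
subst i.
have [r0 r0R br0] := hasP (hRi b (subA b bA) bi (i0A b bA)).
split.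
  rewrite size_map size_filter -ltnS prednK// (leq_trans _ Rw)//.
  rewrite -(count_predC (fun r => deg_lt i0 (b - r)) (R i0)) -[X in (X < _)%N]add0n.
  by rewrite ltn_add2r -has_count; apply/hasP; exists r0.
move=> e /memN[p [k [pA ->]]] ei eni.
have pi' : deg_lt i0.+1 p.
  by rewrite -(deg_lt_shift _ k) -(subrK b (shiftp k p)) deg_ltD.
have [r rR pr] := hasP (hRi p (subA p pA) pi' (i0A p pA)).
apply/hasP; exists (r - b).
  apply: map_f; rewrite mem_filter rR andbT.
  apply: contra eni => br; rewrite eE deg_ltD ?deg_lt_diff//.
  by have := deg_ltB pr br; rewrite opprB addrA subrK.
by rewrite opprB addrA subrK -(subrK p (shiftp k p)) -addrA deg_ltD ?deg_lt_diff.
Qed.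

End DifferenceDegree.

(** * Van der Corput inequality and control by Gowers norms *)

Section VanDerCorput.
Variables (C : numClosedFieldType) (F : finFieldType).

(** Bundled with its bound, so that a list of functions carries the bounds of
    its entries. *)
Record bfun := BFun { bfun_val :> F -> C; bfunP : bounded1 bfun_val }.

Lemma bounded1_conj (f : F -> C) : bounded1 f -> bounded1 (fun x => (f x)^*).
Proof. by move=> fb x; rewrite norm_conjC. Qed.

Definition bconj (f : bfun) := BFun (bounded1_conj (@bfunP f)).
Definition bdmul k (f : bfun) := BFun (bounded1_dmul k (@bfunP f)).

Lemma avg2_shift (V : F -> F -> C) (s : F -> F) :
  avg (fun x => avg (fun y => V x y)) = avg (fun x => avg (fun y => V (x + s y) y)).
Proof.
rewrite exchange_avg [RHS]exchange_avg; apply: eq_avg => y.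
by rewrite [RHS](avg_shift (fun x => V x y)).
Qed.

(** Cauchy-Schwarz in x discards the factor a, which does not depend on y;
    the square of the average over y is then a difference in y by
    [norm_avg_sqr]. *)
Lemma avg_vdc (a : F -> C) (W : F -> F -> C) : bounded1 a ->
  `|avg (fun x => avg (fun y => a x * W x y))| ^+ 2 <=
  avg (fun h => `|avg (fun x => avg (fun y => W x (y + h) * (W x y)^*))|).
Proof.
move=> ab; apply: le_trans (_ : avg (fun x => `|avg (W x)| ^+ 2) <= _).
  apply: le_trans (norm_avg_pow2 1 _) _; apply: ler_avg => x.
  rewrite avgMl normrM lerXn2r ?nnegrE ?mulr_ge0//.
  by rewrite ler_piMl// ab.
rewrite -[leLHS]ger0_norm; last by apply: avg_ge0 => x; rewrite exprn_ge0.
rewrite (eq_avg (fun x => norm_avg_sqr (W x))) exchange_avg.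
exact: ler_norm_avg.
Qed.

(** The pair (f, p1) is kept apart from L because f is the function whose
    Gowers norm will control the average. *)
Definition pet_avg (f : F -> C) (p1 : {poly F}) (L : seq (bfun * {poly F})) : C :=
  avg (fun x => avg (fun y =>
    f (x + p1.[y]) * \prod_(gp <- L) gp.1 (x + gp.2.[y]))).

Lemma norm_prod_le1 (I : Type) (r : seq I) (P : pred I) (g : I -> C) :
  (forall i, `|g i| <= 1) -> `|\prod_(i <- r | P i) g i| <= 1.
Proof.
move=> gb; elim/big_ind: _ => [|a b a1 b1|i _]; last exact: gb.
  by rewrite normr1.
by rewrite normrM mulr_ile1.
Qed.

Lemma eq_prod_unzip2 (L : seq (bfun * {poly F})) (G H : bfun * {poly F} -> C) :
  (forall gp, gp.2 \in unzip2 L -> G gp = H gp) ->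
  \prod_(gp <- L) G gp = \prod_(gp <- L) H gp.
Proof.
elim: L => [|gp L IHL] GH; first by rewrite !big_nil.
rewrite !big_cons GH ?mem_head// IHL// => gp' hgp'.
by rewrite GH// inE hgp' orbT.
Qed.

Lemma pet_avg_bounded1 f p1 L : bounded1 f -> `|pet_avg f p1 L| <= 1.
Proof.
move=> fb; apply: avg_bounded1 => x; apply: avg_bounded1 => y.
by rewrite normrM mulr_ile1// norm_prod_le1// => gp; apply: bfunP.
Qed.

Lemma avg_fibers (D : nat) (l : F -> F) (phi : F -> C) :
  (forall k, #|[pred h | l h == k]| <= D)%N -> (forall k, 0 <= phi k) ->
  avg (fun h => phi (l h)) <= D%:R * avg phi.
Proof.
move=> lD phi0; rewrite /avg mulrA ler_wpM2r ?invr_ge0 ?ler0n//.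
rewrite (partition_big l predT)//= mulr_sumr; apply: ler_sum => k _.
rewrite (eq_bigr (fun=> phi k)) => [|h /eqP->//].
by rewrite sumr_const -[phi k *+ _]mulr_natl ler_wpM2r// ler_nat lD.
Qed.

(** After a shift of x by - b(y), Cauchy-Schwarz removes the function g of
    the base and differences all others; for maps of degree at most 1 the
    difference steps depend on h alone. The step of f is (p1 - b)(h) - (p1 -
    b)(0), which takes every value at most D.+1 times because p1 - b is a
    nonconstant polynomial; so the average over h is bounded by an average
    over all steps. *)
Lemma pet_linear n D (L : seq (bfun * {poly F})) f p1 :
  size L = n -> bounded1 f ->
  {in p1 :: unzip2 L, forall p : {poly F}, (size p <= D)%N && deg_lt 2 p} ->
  {in unzip2 L, forall p, ~~ deg_lt 1 (p1 - p)} ->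
  `|pet_avg f p1 L| ^+ (2 ^ n.+1) <= (D.+1 ^ n)%:R * gowers n f.
Proof.
elim: n L f p1 => [|n IHn] L f p1 sL fb LD Ln.
  rewrite (size0nil sL) /pet_avg mul1r /= expr2 -expr2.
  rewrite (avg2_shift _ (fun y => - p1.[y])).
  rewrite (eq_avg (g := f))// => x.
  rewrite -[RHS](avg_const _ (0 : F)); apply: eq_avg => y.
  by rewrite big_nil mulr1 subrK.
case: L sL LD Ln => // -[g b] L [sL] LD Ln.
pose l (p : {poly F}) h := (p - b).[h] - (p - b).[0].
pose L' h := [seq (bdmul (l gp.2 h) gp.1, gp.2 - b) | gp <- L].
have sub p : p \in p1 :: unzip2 L -> p \in p1 :: unzip2 ((g, b) :: L).
  by rewrite !inE => /orP[->|->//]; rewrite ?orbT.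
have bD : (size b <= D)%N && deg_lt 2 b by apply: LD; rewrite !inE eqxx orbT.
have pbD p : p \in p1 :: unzip2 L -> (size (p - b)%R <= D)%N && deg_lt 2 (p - b).
  move=> /sub/LD/andP[pD p2]; case/andP: bD => bD b2; rewrite deg_ltB// andbT.
  by rewrite (leq_trans (size_polyD _ _))// size_polyN geq_max pD.
have step : `|pet_avg f p1 ((g, b) :: L)| ^+ 2 <=
    avg (fun h => `|pet_avg (dmul (l p1 h) f) (p1 - b) (L' h)|).
  rewrite /pet_avg (avg2_shift _ (fun y => - b.[y])).
  pose W x y := f (x + (p1 - b).[y]) * \prod_(gp <- L) gp.1 (x + (gp.2 - b).[y]).
  rewrite [in leLHS](eq_avg (g := fun x => avg (fun y => g x * W x y))); last first.
    move=> x /=; apply: eq_avg => y; rewrite /W big_cons/= subrK mulrCA.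
    congr (_ * (f _ * _)).
      by rewrite hornerD hornerN addrAC addrA.
    by apply: eq_bigr => gp _; rewrite hornerD hornerN addrAC addrA.
  apply: le_trans (avg_vdc _ (@bfunP g)) _; apply: ler_avg => h.
  rewrite le_eqVlt; apply/orP; left; apply/eqP; congr (`|_|).
  apply: eq_avg => x; apply: eq_avg => y.
  have e p : p \in p1 :: unzip2 L -> (p - b).[y + h] = (p - b).[y] + l p h.
    by move=> /pbD/andP[_ p2]; rewrite deg_lt2_horner.
  rewrite /W e ?mem_head// rmorphM/= rmorph_prod mulrACA -big_split/= big_map.
  congr (_ * _); first by rewrite /dmul addrA.
  apply: eq_prod_unzip2 => gp gpL /=.
  by rewrite /dmul e ?addrA// inE gpL orbT.
have uL' h : unzip2 (L' h) = [seq p - b | p <- unzip2 L].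
  by rewrite /unzip2 -!map_comp.
rewrite expr_2S; apply: le_trans (lerXn2r _ _ _ step) _; rewrite ?nnegrE ?exprn_ge0//.
  exact: avg_ge0.
apply: le_trans (avg_pow2 _ _) _ => //.
rewrite [X in _ <= X%:R * _]expnSr natrM -mulrA.
apply: le_trans (_ : avg (fun h => (D.+1 ^ n)%:R * gowers n (dmul (l p1 h) f)) <= _).
  apply: ler_avg => h; apply: IHn.
  - by rewrite size_map.
  - exact: bounded1_dmul.
  - move=> p; rewrite uL' inE => /predU1P[->|/mapP[q qL ->]].
      by apply: pbD; rewrite mem_head.
    by apply: pbD; rewrite inE qL orbT.
  - move=> p; rewrite uL' => /mapP[q qL ->].
    by rewrite opprB addrA subrK Ln// inE qL orbT.
rewrite avgMl ler_wpM2l//.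
apply: (avg_fibers (phi := fun k => gowers n (dmul k f))) => [k|k]; last exact: gowers_ge0.
have /deg_lt1P nc : ~~ deg_lt 1 (p1 - b) by apply: Ln; rewrite mem_head.
pose c := (p1 - b) - ((p1 - b).[0] + k)%:P.
have c0 : c != 0.
  apply/eqP => c0; apply: nc => x y.
  have e z : (p1 - b).[z] = (p1 - b).[0] + k.
    by apply/eqP; rewrite -subr_eq0 -(hornerC (_ + k) z) -hornerN -hornerD -/c c0 horner0.
  exact: etrans (e x) (esym (e y)).
have cD : (size c <= D.+1)%N.
  rewrite (leq_trans (size_polyD _ _))// size_polyN geq_max.
  rewrite (leq_trans (size_polyC_leq1 _))// andbT ltnW// ltnS.
  by have /andP[] := pbD p1 (mem_head _ _).
apply: leq_trans (card_roots_le c0 cD); apply: subset_leq_card.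
apply/fintype.subsetP => h; rewrite !inE => /eqP lk.
by rewrite /root hornerD hornerN hornerC -lk /l addrCA subrr addr0 subrr.
Qed.

(** The functions attached to constant polynomials depend on x only, and
    Cauchy-Schwarz in x discards them. The shift of x by - b(y) then
    subtracts the base from all polynomials, which is what lowers the weight
    of the family. *)
Lemma pet_vdc (f : bfun) p1 b (L : seq (bfun * {poly F})) :
  `|pet_avg f p1 L| ^+ 2 <= avg (fun h => `|pet_avg f (shiftp h p1 - b)
    ((bconj f, p1 - b) :: [seq (gp.1, shiftp h gp.2 - b) | gp <- L & ~~ deg_lt 1 gp.2]
       ++ [seq (bconj gp.1, gp.2 - b) | gp <- L & ~~ deg_lt 1 gp.2])|).
Proof.
pose Ln := [seq gp <- L | ~~ deg_lt 1 gp.2]; pose a x := \prod_(gp <- L | deg_lt 1 gp.2) gp.1 (x + gp.2.[0]).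
pose W x y := f (x + p1.[y]) * \prod_(gp <- Ln) gp.1 (x + gp.2.[y]).
have -> : pet_avg f p1 L = avg (fun x => avg (fun y => a x * W x y)).
  apply: eq_avg => x; apply: eq_avg => y; rewrite /a /W mulrCA; congr (_ * _).
  rewrite (bigID (fun gp => deg_lt 1 gp.2))/= big_filter; congr (_ * _).
  by apply: eq_bigr => gp /deg_lt1P h; rewrite (h y 0).
apply: le_trans (avg_vdc _ _) _.
  by move=> x; apply: norm_prod_le1 => gp; apply: bfunP.
apply: ler_avg => h; rewrite le_eqVlt; apply/orP; left; apply/eqP; congr (`|_|).
rewrite (avg2_shift _ (fun y => - b.[y])).
apply: eq_avg => x; apply: eq_avg => y.
rewrite /W rmorphM/= big_cons big_cat !big_map/= rmorph_prod mulrACA -mulrA.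
have e p : x - b.[y] + p = x + (p - b.[y]) by rewrite addrAC addrA.
rewrite !hornerD !hornerN !horner_shiftp !e; congr (_ * (_ * (_ * _))).
  by apply: eq_bigr => gp _; rewrite !hornerD !hornerN !horner_shiftp e.
by apply: eq_bigr => gp _; rewrite !hornerD !hornerN e.
Qed.

End VanDerCorput.

(** Weights are compared lexicographically on the indices 1, ..., d0, the
    index d0 being the most significant one; smaller indices may grow. *)
Lemma lex_ind (d0 : nat) (P : (nat -> nat) -> Prop) :
  (forall w, (forall i0 w', (0 < i0 <= d0)%N ->
      (forall i, (i0 < i)%N -> w' i = w i) -> (w' i0 < w i0)%N -> P w') -> P w) ->
  forall w, P w.
Proof.
move=> H; suff A j : (j <= d0)%N -> forall w, (forall i0 w', (j < i0 <= d0)%N ->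
      (forall i, (i0 < i)%N -> w' i = w i) -> (w' i0 < w i0)%N -> P w') -> P w.
  by move=> w; apply: (A d0) => // i0 w' /andP[/leq_trans h /h]; rewrite ltnn.
elim: j => [|j IHj] jd w; first exact: H.
move: {2}(w j.+1) (leqnn (w j.+1)) => a; elim: a w => [|a IHa] w wa hw.
  apply: (IHj (ltnW jd)) => i0 w' /andP[]; rewrite leq_eqVlt => /predU1P[<-|ji i0d e].
    by move=> _ _ /leq_trans/(_ wa).
  by apply: hw => //; rewrite ji.
apply: (IHj (ltnW jd)) => i0 w' /andP[]; rewrite leq_eqVlt => /predU1P[<-|ji i0d e]; last first.
  by apply: hw => //; rewrite ji.
move=> _ e lt; apply: IHa => [|i1 w1 /andP[ji i1d] e1 lt1].
  by rewrite -ltnS (leq_trans lt).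
apply: (hw i1) => //; first by rewrite ji.
  by move=> i ii; rewrite e1// e// (ltn_trans ji).
by rewrite -(e i1 ji).
Qed.

Section PETInduction.
Variable C : numClosedFieldType.

Definition pet_controlled (X : forall F : finFieldType, {poly F} -> seq {poly F} -> Prop) :=
  exists s N K, forall (F : finFieldType) p1 (L : seq (bfun C F * {poly F})) (f : bfun C F),
    X F p1 (unzip2 L) ->
    `|pet_avg f p1 L| ^+ (2 ^ N) <= K%:R * (gowers s f + #|F|%:R^-1).

(** Bounds with different orders and exponents become comparable after
    raising them to powers, by [gowers_mono]. *)
Lemma gowers_weaken (F : finFieldType) (a : C) (f : F -> C) s N (K : nat) j e :
  0 <= a <= 1 -> a ^+ (2 ^ N) <= K%:R * (gowers s f + #|F|%:R^-1) ->
  a ^+ (2 ^ (N + j + e)) <= ((2 * K) ^ (2 ^ j))%:R * (gowers (s + j) f + #|F|%:R^-1).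
Proof.
move=> /andP[a0 a1] h; have U0 := gowers_ge0 s f.
have q0 : (0 : C) <= #|F|%:R^-1 by rewrite invr_ge0 ler0n.
have q1 : (#|F|%:R^-1 : C) <= 1.
  by rewrite invf_le1 ?ler1n ?ltr0n; apply/card_gt0P; exists 0.
apply: (@le_trans _ _ (a ^+ (2 ^ (N + j)))).
  by rewrite ler_wiXn2l// leq_exp2l// leq_addr.
rewrite expnD exprM (le_trans (lerXn2r _ _ _ h))// ?nnegrE ?exprn_ge0//.
  by rewrite mulr_ge0// addr_ge0.
rewrite exprMn expnMn natrM mulrC [leRHS]mulrAC natrX [in leRHS]natrX ler_wpM2r ?exprn_ge0//.
rewrite -natrX; apply: le_trans (pow2D_le _ U0 q0) _.
rewrite ler_wpM2l// lerD ?gowers_mono//.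
by rewrite -[leRHS]expr1 ler_wiXn2l// expn_gt0.
Qed.

Lemma pet_controlledU X Y : pet_controlled X -> pet_controlled Y ->
  pet_controlled (fun F p ps => X F p ps \/ Y F p ps).
Proof.
move=> [s [N [K hX]]] [s' [N' [K' hY]]].
exists (s + s')%N, (N + N' + s + s')%N.
exists ((2 * K) ^ (2 ^ s') + (2 * K') ^ (2 ^ s))%N => F p1 L f.
have a01 : 0 <= `|pet_avg f p1 L| <= 1.
  by rewrite normr_ge0 pet_avg_bounded1//; apply: bfunP.
have U0 : 0 <= gowers (s + s') f + #|F|%:R^-1.
  by rewrite addr_ge0 ?gowers_ge0// invr_ge0.
case=> [/hX|/hY] h.
  rewrite (_ : (N + N' + s + s' = N + s' + (N' + s))%N); last by lia.
  apply: le_trans (gowers_weaken s' (N' + s) a01 (h f)) _.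
  by rewrite natrD ler_wpM2r// lerDl.
rewrite (_ : (N + N' + s + s' = N' + s + (N + s'))%N); last by lia.
have := gowers_weaken s (N + s') a01 (h f); rewrite (addnC s' s) => h'.
apply: le_trans h' _.
by rewrite natrD ler_wpM2r// lerDr.
Qed.

Lemma pet_controlled_bigU n X : (forall i, (i < n)%N -> pet_controlled (X i)) ->
  pet_controlled (fun F p ps => exists2 i, (i < n)%N & X i F p ps).
Proof.
elim: n => [|n IHn] hX; first by exists 0%N, 0%N, 0%N => F p1 L f [].
have [s [N [K h]]] := pet_controlledU (IHn (fun i i_n => hX i (ltnW i_n))) (hX n (ltnSn n)).
exists s, N, K => F p1 L f [j j_n Xj]; move: j_n Xj.
rewrite ltnS leq_eqVlt => /predU1P[->|j_n] Xj.
  by apply: h; right.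
by apply: h; left; exists j.
Qed.

(** On the exceptional set only a <= 1 is known, which costs its density. *)
Lemma avg_exceptional (F : finFieldType) (a : F -> C) (B : pred F) N M (c : C) :
  (forall h, 0 <= a h <= 1) -> 0 <= c -> (#|B| <= M)%N ->
  (forall h, ~~ B h -> a h ^+ (2 ^ N) <= c) ->
  avg a ^+ (2 ^ N) <= c + M%:R * #|F|%:R^-1.
Proof.
move=> a01 c0 BM aB; apply: le_trans (avg_pow2 _ _) _ => [h|].
  by have /andP[] := a01 h.
apply: (@le_trans _ _ (avg (fun h => c + (B h)%:R))).
  apply: ler_avg => h; have /andP[ah0 ah1] := a01 h.
  have [Bh|/aB ah] := boolP (B h); last by rewrite addr0.
  by rewrite (le_trans (exprn_ile1 _ ah0 ah1))// lerDr.
rewrite avgD lerD ?avg_const_le// /avg ler_wpM2r ?invr_ge0//.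
by rewrite -natr_sum ler_nat -big_mkcond/= sum1_card.
Qed.

(** Lower the weight by [pet_vdc] and [pet_step] until all maps have degree
    at most 1, where [pet_linear] applies. The degree i0 at which a step acts
    depends on the family, so the induction hypotheses for all of the
    finitely many i0 are merged first. *)
Theorem pet_control d0 D w n : pet_controlled (fun F => @pet_family F d0 D w n).
Proof.
elim/(lex_ind (d0 := d0)): w n => w IHw n.
have [s [N [K hK]]] : pet_controlled (fun F p ps => exists2 i0, (i0 < d0.+1)%N &
    (0 < i0)%N /\ (0 < w i0)%N /\ pet_family d0 D (pet_weight w n i0) n.+1.*2 p ps).
  apply: pet_controlled_bigU => i0; rewrite ltnS => i0d.
  have [i00|i00] := posnP i0; first by exists 0%N, 0%N, 0%N => F p1 L f [].
  have [w0|w0] := posnP (w i0); first by exists 0%N, 0%N, 0%N => F p1 L f [_ []].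
  have [|i ii||s [N [K h]]] := IHw i0 (pet_weight w n i0) _ _ _ n.+1.*2.
  - by rewrite i00.
  - by rewrite /pet_weight ii.
  - by rewrite /pet_weight ltnn eqxx prednK.
  - by exists s, N, K => F p1 L f [_ [_]]; exact: h.
have lin : pet_controlled (fun F p ps => [/\ {in p :: ps, forall r, deg_lt 2 r},
    {in p :: ps, forall r : {poly F}, (size r <= D)%N},
    {in ps, forall r, ~~ deg_lt 1 (p - r)} & (size ps <= n)%N]).
  exists n, n.+1, ((2 * D.+1 ^ n) ^ (2 ^ n))%N => F p1 L f [l2 lD l1 ln].
  rewrite size_map in ln.
  have h : `|pet_avg f p1 L| ^+ (2 ^ (size L).+1) <=
      (D.+1 ^ size L)%:R * (gowers (size L) f + #|F|%:R^-1).
    apply: le_trans (pet_linear (D := D) erefl (@bfunP _ _ f) _ l1) _.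
      by move=> r rL; rewrite lD// l2.
    by rewrite ler_wpM2l// lerDl invr_ge0.
  have a01 : 0 <= `|pet_avg f p1 L| <= 1.
    by rewrite normr_ge0 pet_avg_bounded1//; apply: bfunP.
  have := gowers_weaken (n - size L) 0 a01 h.
  rewrite addn0 addSn subnKC// => /le_trans; apply.
  rewrite ler_wpM2r ?addr_ge0 ?gowers_ge0 ?invr_ge0// ler_nat.
  apply: (@leq_trans ((2 * D.+1 ^ n) ^ 2 ^ (n - size L))).
    by rewrite leq_exp2r ?expn_gt0// leq_mul2l/= leq_pexp2l.
  by rewrite leq_pexp2l ?muln_gt0 ?expn_gt0// leq_exp2l// leq_subr.
have step : pet_controlled (fun F p ps => pet_family d0 D w n p ps /\
    exists i0 b (B : pred F), [/\ (0 < i0 <= d0)%N, (0 < w i0)%N, (#|B| <= n.+2 * D.+1)%N &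
     forall h, ~~ B h -> pet_family d0 D (pet_weight w n i0) n.+1.*2
       (shiftp h p - b) (pet_next [seq r <- ps | ~~ deg_lt 1 r] p b h)]).
  exists s, N.+1, (K + n.+2 * D.+1)%N => F p1 L f [_ [i0 [b [B [/andP[i00 i0d] w0 BM hB]]]]].
  rewrite expr_2S (le_trans (lerXn2r _ _ _ (pet_vdc f p1 b L)))// ?nnegrE ?exprn_ge0//.
    exact: avg_ge0.
  have U0 := gowers_ge0 s f.
  have q0 : (0 : C) <= #|F|%:R^-1 by rewrite invr_ge0 ler0n.
  apply: le_trans (avg_exceptional (B := B) (N := N)
    (c := K%:R * (gowers s f + #|F|%:R^-1)) _ _ BM _) _; last first.
  + rewrite natrD mulrDl lerD2l ler_wpM2l// lerDr//.
  + move=> h /hB fam; apply: hK; exists i0 => //; split=> //; split=> //.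
    rewrite /= /unzip2 map_cat -!map_comp.
    move: fam; rewrite /pet_next filter_map -!map_comp; exact.
  + by rewrite mulr_ge0 ?addr_ge0.
  + by move=> h; rewrite normr_ge0 pet_avg_bounded1//; apply: bfunP.
have [s' [N' [K' h]]] := pet_controlledU lin step.
exists s', N', K' => F p1 L f fam; apply: h.
have [l2|] := pet_step fam; last by right.
by left; case: fam.
Qed.

End PETInduction.

(** * Exponential sums in fixed characteristic *)

Section FrobeniusCharacter.
Variables (C : numClosedFieldType) (p : nat) (F : finFieldType).
Hypotheses (p_prime : prime p) (charF : p \in [pchar F]).

(** Invariance under Frobenius is what trades a monomial a x ^ (p r) for a ^
    (1 / p) x ^ r inside psi; the characters that factor through the trace to
    the prime field have it. *)
Definition frob_char (psi : F -> C) :=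
  [/\ {morph psi : x y / x + y >-> x * y}, psi 0 = 1, exists x, psi x != 1 &
      forall x, psi (x ^+ p) = psi x].

Section Char.
Variables (psi : F -> C) (psiP : frob_char psi).

Lemma charD : {morph psi : x y / x + y >-> x * y}. Proof. by case: psiP. Qed.
Lemma char0 : psi 0 = 1. Proof. by case: psiP. Qed.

(** The values are p-th roots of unity, since p x = 0. *)
Lemma char_norm x : `|psi x| = 1.
Proof.
have e n : psi (x *+ n) = psi x ^+ n.
  elim: n => [|n IHn]; first by rewrite mulr0n char0 expr0.
  by rewrite mulrS charD IHn exprS.
apply/eqP; rewrite -(pexpr_eq1 (prime_gt0 p_prime))// -normrX -e.
by rewrite (mulrn_pchar charF) char0 normr1.
Qed.

Lemma char_conj x : (psi x)^* = psi (- x).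
Proof.
have xx : psi x * psi (- x) = 1 by rewrite -charD subrr char0.
have := normCK (psi x); rewrite char_norm expr1n => e.
have u : psi x != 0 by apply/eqP => u; move: e; rewrite u mul0r; apply/eqP/oner_neq0.
by apply: (mulfI u); rewrite xx -e.
Qed.

Lemma char_sum (I : Type) (r : seq I) (P : pred I) (a : I -> F) :
  psi (\sum_(i <- r | P i) a i) = \prod_(i <- r | P i) psi (a i).
Proof. exact: (big_morph psi charD char0). Qed.

Lemma char_frob j x : psi (x ^+ (p ^ j)) = psi x.
Proof.
elim: j => [|j IHj]; first by rewrite expr1.
by rewrite expnSr exprM; case: psiP => _ _ _ ->.
Qed.

(** Translating the average by z / c multiplies it by psi z, and psi z
    differs from 1 for some z. *)
Lemma avg_char c : c != 0 -> avg (fun x => psi (c * x)) = 0.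
Proof.
move=> c0; have [_ _ [z z1] _] := psiP.
have : avg (fun x => psi (c * x)) = avg (fun x => psi (c * x)) * psi z.
  rewrite -avgMr -[LHS](avg_shift _ (c^-1 * z)); apply: eq_avg => x.
  by rewrite mulrDr mulrA mulfV// mul1r charD.
move/eqP; rewrite -subr_eq0 -{1}[avg _]mulr1 -mulrBr mulf_eq0 subr_eq0.
by rewrite [1 == _]eq_sym (negbTE z1) orbF => /eqP.
Qed.

End Char.

Definition frob_root : F -> F := invF (fmorph_inj (pFrobenius_aut charF)).

Lemma frob_rootK x : frob_root x ^+ p = x.
Proof. by rewrite -(pFrobenius_autE charF) /frob_root f_invF. Qed.

Lemma iter_frob_rootK j k x : (k <= j)%N -> iter k frob_root x ^+ (p ^ j) = x ^+ (p ^ (j - k)).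
Proof.
elim: k j => [|k IHk] [|j]//= kj.
by rewrite expnS exprM frob_rootK IHk.
Qed.

Lemma expr_p_sum j (I : Type) (r : seq I) (P : pred I) (a : I -> F) :
  (\sum_(i <- r | P i) a i) ^+ (p ^ j) = \sum_(i <- r | P i) a i ^+ (p ^ j).
Proof.
elim: j a => [|j IHj] a; first by rewrite expr1; apply: eq_bigr => i; rewrite expr1.
rewrite expnS exprM -(pFrobenius_autE charF) rmorph_sum/= IHj.
by apply: eq_bigr => i _; rewrite pFrobenius_autE exprM.
Qed.

(** Coefficient of x ^ r, for r prime to p, once every monomial a x ^ (r p ^
    j) of sum_e a_e x ^ e has been replaced by a ^ (1 / p ^ j) x ^ r. *)
Definition red_coef (n : nat) (a : nat -> F) (r : nat) : F :=
  \sum_(e < n.+1 | (0 < e)%N && (e`_p^' == r)%N) iter (logn p e) frob_root (a e).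

Definition red_poly n a : {poly F} := \poly_(r < n.+1) red_coef n a r.

Definition reduced (R : {poly F}) := forall e, (p %| e)%N -> R`_e = 0.

Lemma reduced_red_poly n a : reduced (red_poly n a).
Proof.
move=> e pe; rewrite coef_poly; case: ifP => // _.
apply: big1 => i /andP[i0 /eqP ie]; exfalso; move: pe; rewrite -ie.
apply/negP; rewrite -prime_coprime//.
exact: (pnat_coprime (pnat_id p_prime) (part_pnat _ _)).
Qed.

(** Group the exponents by their part prime to p, and apply Frobenius [logn p
    e] times to the monomial of exponent e. *)
Lemma char_red_poly psi n (a : nat -> F) x : frob_char psi ->
  psi (\sum_(e < n.+1) a e * x ^+ e) = psi (a 0%N) * psi (red_poly n a).[x].
Proof.
move=> psiP; rewrite big_ord_recl expr0 mulr1 charD//; congr (_ * _).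
rewrite (char_sum psiP) horner_poly (char_sum psiP).
transitivity (\prod_(e < n.+1 | (0 < e)%N) psi (a e * x ^+ e)).
  by rewrite [RHS]big_mkcond big_ord_recl/= mul1r; apply: eq_bigr.
pose r (e : 'I_n.+1) : 'I_n.+1 := inord (e`_p^')%N.
have rE (e : 'I_n.+1) : (0 < e)%N -> r e = (e`_p^')%N :> nat.
  by move=> e0; rewrite inordK// (leq_ltn_trans (dvdn_leq e0 (dvdn_part _ _))).
rewrite (partition_big r predT)//=; apply: eq_bigr => i _.
rewrite /red_coef mulr_suml (char_sum psiP).
apply: eq_big => [e|e /andP[e0 /eqP ei]].
  by apply: andb_id2l => e0; rewrite -val_eqE/= rE.
rewrite -[RHS](char_frob psiP (logn p e)) exprMn iter_frob_rootK// subnn expr1.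
by rewrite -exprM -ei rE// -p_part mulnC partnC.
Qed.

Lemma deriv_expr_p (c : {poly F}) k : (c ^+ (p ^ k.+1))^`() = 0.
Proof.
rewrite deriv_exp expnS -mulr_natr natrM -(rmorph_nat (@polyC F)).
by rewrite (pcharf0 charF) mul0r mulr0.
Qed.

(** The coefficient of y ^ e in R(y + h) - R(y), as a polynomial in h. *)
Definition diff_coef (R : {poly F}) e : {poly F} := R^`N(e) - (R`_e)%:P.

Lemma diff_coefE (R : {poly F}) n y h : (size R <= n.+2)%N ->
  R.[y + h] - R.[y] = \sum_(e < n.+1) (diff_coef R e).[h] * y ^+ e.
Proof.
move=> sR; rewrite [y + h]addrC; have RE : R.[h + y] = \sum_(i < n.+2) R^`N(i).[h] * y ^+ i.
  by apply: nderiv_taylor_wide sR; apply: mulrC.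
rewrite RE (horner_coef_wide y sR) -sumrB big_ord_recr/= [X in _ + X](_ : _ = 0).
  rewrite addr0; apply: eq_bigr => e _.
  by rewrite /diff_coef hornerD hornerN hornerC mulrBl.
rewrite -mulrBl [X in X * _](_ : _ = 0) ?mul0r//.
rewrite (_ : R^`N(n.+1) = (R`_n.+1)%:P) ?hornerC ?subrr//.
apply/polyP => i; rewrite coef_nderivn coefC; case: i => [|i].
  by rewrite addn0 binn.
by rewrite nth_default ?mul0rn// (leq_trans sR)// addnS !addSn !ltnS leq_addr.
Qed.

(** Write n = r p ^ j with r prime to p, and let Z be the p ^ j-th power of
    the coefficient of x ^ r in the reduced difference, as a polynomial in h.
    The exponents e < n contribute p-th powers to Z, so its derivative is
    that of [diff_coef R n], whose constant term is n.+1 times the leading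
    coefficient of R. This is not 0, hence neither is Z, and few h make the
    reduced difference vanish. *)
Lemma red_diff_generic n (R : {poly F}) :
  (size R = n.+2) -> ~~ (p %| n.+1)%N -> (0 < n)%N ->
  exists Z : {poly F}, [/\ Z != 0, (size Z <= (n.+2 * p ^ n).+1)%N &
    forall h, red_poly n (fun e => (diff_coef R e).[h]) = 0 -> root Z h].
Proof.
move=> sR pn n0; pose j := logn p n.
have [p0 p1] := (prime_gt0 p_prime, prime_gt1 p_prime).
have jn : (j <= n)%N by rewrite ltnW ?ltn_logl.
pose Q (e : nat) := (0 < e)%N && (e`_p^' == n`_p^')%N.
have ej e : Q e -> (e <= n)%N -> (logn p e <= j)%N.
  move=> /andP[e0 /eqP ee] en; rewrite -(leq_exp2l _ _ p1).
  rewrite -(leq_pmul2r (part_gt0 p^' n)) -!p_part -{1}ee.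
  by rewrite !partnC.
pose Z := \sum_(e < n.+1 | Q e) diff_coef R e ^+ (p ^ (j - logn p e)).
exists Z; split.
- apply/negP => /eqP Z0; have : (Z^`())`_0 = 0 by rewrite Z0 deriv0 coef0.
  rewrite /Z linear_sum/= (bigD1 (ord_max : 'I_n.+1))/=; last by rewrite /Q n0 eqxx.
  rewrite subnn expr1 big1 => [|e /andP[Qe en]]; last first.
    have : (logn p e < j)%N.
      rewrite ltn_neqAle (ej e Qe (ltn_ord e)) andbT; apply: contra en => /eqP ee.
      have /andP[e0 /eqP e'] := Qe.
      by apply/eqP/val_inj; rewrite /= -(partnC p e0) p_part ee e' -p_part partnC.
    by rewrite -subn_gt0; case: (_ - _)%N => // k _; rewrite deriv_expr_p.
  rewrite addr0 /diff_coef derivB derivC subr0 coef_deriv mulr1n coef_nderivn addn1.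
  rewrite binSn -mulr_natr => /eqP; rewrite mulf_eq0.
  have -> : (R`_n.+1 == 0) = false.
    apply/negbTE; rewrite -[n.+1]/(n.+2.-1) -sR -/(lead_coef R) lead_coef_eq0.
    by rewrite -size_poly_eq0 sR.
  by rewrite -(dvdn_pcharf charF) (negbTE pn).
- rewrite /Z; rewrite (leq_trans (size_sum _ _ _))//; apply/bigmax_leqP => e Qe.
  rewrite (leq_trans (size_poly_exp_leq _ _))// ltnS leq_mul//; last first.
    by rewrite leq_pexp2l// (leq_trans (leq_subr _ _)).
  rewrite -subn1 leq_subLR (leq_trans (size_polyD _ _))// size_polyN geq_max.
  rewrite (leq_trans (size_polyC_leq1 _))// andbT -sR.
  rewrite (@leq_trans (size R))//.
  by apply/leq_sizeP => i si; rewrite coef_nderivn nth_default ?mul0rn// (leq_trans si) ?leq_addl.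
move=> h S0; have : (red_poly n (fun e => (diff_coef R e).[h]))`_(n`_p^') = 0.
  by rewrite S0 coef0.
rewrite coef_poly ltnS dvdn_leq ?dvdn_part// /red_coef => Sn.
have Zh : Z.[h] = (\sum_(e < n.+1 | Q e) iter (logn p e) frob_root (diff_coef R e).[h]) ^+ (p ^ j).
  rewrite /Z horner_sum expr_p_sum; apply: eq_bigr => e Qe.
  by rewrite horner_exp iter_frob_rootK// ej// -ltnS.
by apply/rootP; rewrite Zh Sn expr0n expn_eq0 eqn0Ngt p0.
Qed.

End FrobeniusCharacter.

(** Weyl differencing. The phase R(y + h) - R(y) has smaller degree, and so
    has its reduced form, which by [red_diff_generic] is nonzero outside a
    bounded number of h; thus induction on the degree applies. Reduction
    between the steps is necessary, since differencing y ^ p leaves a phase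
    that is constant in y. *)
Theorem exp_sum_reduced (C : numClosedFieldType) (p : nat) (p_prime : prime p) n :
  exists N K, forall (F : finFieldType) (charF : p \in [pchar F]) (psi : F -> C)
    (R : {poly F}), frob_char p psi -> (size R <= n.+1)%N -> R != 0 -> reduced p R ->
    `|avg (fun y => psi R.[y])| ^+ (2 ^ N) <= K%:R * #|F|%:R^-1.
Proof.
elim: n => [|n [N [K IHn]]].
  exists 0%N, 0%N => F charF psi R psiP sR R0 /(_ 0%N (dvdn0 p)) R00; exfalso.
  by move: R0; rewrite (size1_polyC sR) R00 eqxx.
exists N.+1, (K + (n.+2 * p ^ n).+1)%N => F charF psi R psiP sR R0 Rred.
have q0 : (0 : C) <= #|F|%:R^-1 by rewrite invr_ge0 ler0n.
have psi1 y : `|psi y| <= 1 by rewrite (char_norm p_prime charF psiP).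
have a01 (g : F -> F) : 0 <= `|avg (fun y => psi (g y))| <= 1.
  by rewrite normr_ge0 avg_bounded1.
have [sR'|sR'] := leqP (size R) n.+1.
  have /andP[a0 a1] := a01 (horner R).
  apply: (@le_trans _ _ (`|avg (fun y => psi R.[y])| ^+ (2 ^ N))).
    by rewrite ler_wiXn2l// leq_exp2l.
  apply: le_trans (IHn _ charF _ _ psiP sR' R0 Rred) _.
  by rewrite ler_wpM2r// ler_nat leq_addr.
have {}sR : size R = n.+2 by apply/eqP; rewrite eqn_leq sR.
have lR : R`_n.+1 != 0.
  by rewrite -[n.+1]/(n.+2.-1) -sR -/(lead_coef R) lead_coef_eq0.
have pn : ~~ (p %| n.+1)%N by apply: contra lR => /Rred ->.
have [n0|n0] := posnP n.
  subst n; have -> : avg (fun y => psi R.[y]) = 0.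
    rewrite -[RHS](avg_char psiP lR); apply: eq_avg => y.
    rewrite (@horner_coef_wide _ 2) ?sR// big_ord_recl big_ord1.
    by rewrite (Rred 0%N (dvdn0 p)) mul0r add0r expr1.
  by rewrite normr0 expr0n expn_eq0/= mulr_ge0.
have [Z [Z0 sZ hZ]] := red_diff_generic p_prime charF sR pn n0.
pose a h := `|avg (fun y => psi (R.[y + h] - R.[y]))|.
have step : `|avg (fun y => psi R.[y])| ^+ 2 <= avg a.
  rewrite -[leLHS]ger0_norm ?exprn_ge0// norm_avg_sqr.
  apply: le_trans (ler_norm_avg _) _; apply: ler_avg => h.
  rewrite /a le_eqVlt; apply/orP; left; apply/eqP; congr (`|_|).
  apply: eq_avg => y.
  by rewrite /dmul (char_conj p_prime charF psiP) -(charD psiP).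
have avg_a0 : 0 <= avg a by apply: avg_ge0 => h; rewrite normr_ge0.
rewrite expr_2S (le_trans (lerXn2r _ _ _ step)) ?nnegrE ?exprn_ge0//.
rewrite natrD mulrDl.
apply: (avg_exceptional (B := [pred h | root Z h])).
- by move=> h; apply: a01.
- by rewrite mulr_ge0.
- exact: card_roots_le.
move=> h /= hr; pose S := red_poly charF n (fun e => (diff_coef R e).[h]).
have S0 : S != 0 by apply: contra hr => /eqP; apply: hZ.
have e y : psi (R.[y + h] - R.[y]) = psi (diff_coef R 0).[h] * psi S.[y].
  rewrite (diff_coefE (n := n)) ?sR//.
  exact: (char_red_poly charF n (fun e => (diff_coef R e).[h]) y psiP).
rewrite /a (eq_avg e) avgMl normrM (char_norm p_prime charF psiP) mul1r.
apply: IHn => //; first exact: size_poly.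
exact: reduced_red_poly.
Qed.

(** The reduced form of P is nonzero as soon as psi o P is not constant. *)
Theorem exp_sum (C : numClosedFieldType) (p : nat) (p_prime : prime p) n :
  exists N K, forall (F : finFieldType) (charF : p \in [pchar F]) (psi : F -> C)
    (P : {poly F}), frob_char p psi -> (size P <= n.+1)%N ->
    (exists x y, psi P.[x] != psi P.[y]) ->
    `|avg (fun y => psi P.[y])| ^+ (2 ^ N) <= K%:R * #|F|%:R^-1.
Proof.
have [N [K h]] := exp_sum_reduced C p_prime n.
exists N, K => F charF psi P psiP sP [x [y xy]].
pose S := red_poly charF n (nth 0 P).
have SE z : psi P.[z] = psi P`_0 * psi S.[z].
  by rewrite (horner_coef_wide z sP); apply: char_red_poly.
rewrite (eq_avg SE) avgMl normrM (char_norm p_prime charF psiP) mul1r.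
apply: h => //; first exact: size_poly.
  by apply: contraNneq xy => S0; rewrite !SE S0 !horner0.
exact: reduced_red_poly.
Qed.

(** * Errors that save a power of q *)

Section Small.
Variables (C : numClosedFieldType) (q : nat).
Hypothesis q_gt0 : (0 < q)%N.
Implicit Types X Y : C.

(** X = O(q ^ (- 1 / 2 ^ N)), with N and K meant to be independent of q. The
    lemmas on [small] compute with such errors without ever extracting roots. *)
Definition small N (K : nat) X := X ^+ (2 ^ N) <= K%:R / q%:R.

Lemma invq_ge0 : 0 <= (q%:R^-1 : C).
Proof. by rewrite invr_ge0 ler0n. Qed.

Lemma invq_le1 : (q%:R^-1 : C) <= 1.
Proof. by rewrite invf_le1 ?ler1n ?ltr0n. Qed.

Lemma small_invq : small 0 1 q%:R^-1.
Proof. by rewrite /small expr1 mul1r. Qed.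

Lemma small_le N K X Y : 0 <= Y -> Y <= X -> small N K X -> small N K Y.
Proof.
move=> Y0 YX; apply: le_trans; rewrite lerXn2r ?nnegrE//.
exact: le_trans YX.
Qed.

Lemma small_raise N K X j : 0 <= X -> small N K X -> small (N + j) (K ^ (2 ^ j)) X.
Proof.
move=> X0 h; rewrite /small expnD exprM.
apply: le_trans (lerXn2r _ _ _ h) _; rewrite ?nnegrE ?exprn_ge0// ?divr_ge0//.
rewrite exprMn natrX ler_wpM2l ?exprn_ge0// -[leRHS]expr1.
by rewrite ler_wiXn2l ?invq_ge0 ?invq_le1// expn_gt0.
Qed.

Lemma smallD N K X N' K' Y : 0 <= X -> 0 <= Y -> small N K X -> small N' K' Y ->
  small (N + N') (2 ^ 2 ^ (N + N') * (K ^ (2 ^ N') + K' ^ (2 ^ N))) (X + Y).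
Proof.
move=> X0 Y0 /(small_raise N' X0) hX /(small_raise N Y0) hY.
rewrite addnC in hY; apply: le_trans (pow2D_le _ X0 Y0) _.
by rewrite natrM -mulrA ler_wpM2l// natrD mulrDl lerD.
Qed.

Lemma small_pow (c j N K : nat) X Y : 0 <= X -> X ^+ (2 ^ j) <= c%:R * Y ->
  small N K Y -> small (j + N) (c ^ (2 ^ N) * K) X.
Proof.
move=> X0 XY hY; rewrite /small expnD exprM.
apply: le_trans (lerXn2r _ _ _ XY) _; rewrite ?nnegrE ?exprn_ge0//.
  by apply: le_trans XY; rewrite exprn_ge0.
by rewrite exprMn natrM -natrX -mulrA ler_wpM2l.
Qed.

Lemma small_avg (T : finType) (f : T -> C) N K : (forall x, 0 <= f x) ->
  (forall x, small N K (f x)) -> small N K (avg f).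
Proof.
move=> f0 fs; apply: le_trans (avg_pow2 _ f0) _; apply: avg_le => //.
Qed.

End Small.

(** * Cauchy-Schwarz on boxes *)

Section Box.
Variables (C : numClosedFieldType) (G : finZmodType).
Implicit Types (Phi Psi b : seq G -> C) (f : G -> C).

(** Tuples are lists, so that recursion peels off the first coordinate. *)
Fixpoint mavg t Phi : C :=
  if t is t'.+1 then avg (fun g => mavg t' (fun l => Phi (g :: l))) else Phi [::].

Lemma eq_mavg t Phi Psi : (forall l, size l = t -> Phi l = Psi l) ->
  mavg t Phi = mavg t Psi.
Proof.
elim: t Phi Psi => [|t IHt] Phi Psi h /=; first exact: h.
by apply: eq_avg => g; apply: IHt => l lt; apply: h; rewrite /= lt.
Qed.

Lemma ler_mavg t Phi Psi : (forall l, size l = t -> Phi l <= Psi l) ->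
  mavg t Phi <= mavg t Psi.
Proof.
elim: t Phi Psi => [|t IHt] Phi Psi h /=; first exact: h.
by apply: ler_avg => g; apply: IHt => l lt; apply: h; rewrite /= lt.
Qed.

Lemma mavg_ge0 t Phi : (forall l, 0 <= Phi l) -> 0 <= mavg t Phi.
Proof.
elim: t Phi => [|t IHt] Phi h /=; first exact: h.
by apply: avg_ge0 => g; apply: IHt.
Qed.

Lemma mavg_le t Phi c : 0 <= c -> (forall l, size l = t -> Phi l <= c) ->
  mavg t Phi <= c.
Proof.
move=> c0; elim: t Phi => [|t IHt] Phi h /=; first exact: h.
by apply: avg_le => // g; apply: IHt => l lt; apply: h; rewrite /= lt.
Qed.

Lemma ler_norm_mavg t Phi : `|mavg t Phi| <= mavg t (fun l => `|Phi l|).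
Proof.
elim: t Phi => [|t IHt] Phi //=; apply: le_trans (ler_norm_avg _) _.
by apply: ler_avg => g; apply: IHt.
Qed.

Lemma mavg_pow2 n t Phi : (forall l, 0 <= Phi l) ->
  mavg t Phi ^+ (2 ^ n) <= mavg t (fun l => Phi l ^+ (2 ^ n)).
Proof.
elim: t Phi => [|t IHt] Phi h //=; apply: le_trans (avg_pow2 _ _) _ => [g|].
  by apply: mavg_ge0.
by apply: ler_avg => g; apply: IHt.
Qed.

Lemma mavgD t Phi Psi : mavg t (fun l => Phi l + Psi l) = mavg t Phi + mavg t Psi.
Proof.
by elim: t Phi Psi => [|t IHt] Phi Psi //=; rewrite -avgD; apply: eq_avg => g.
Qed.

Lemma mavgMl t c Phi : mavg t (fun l => c * Phi l) = c * mavg t Phi.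
Proof.
by elim: t Phi => [|t IHt] Phi //=; rewrite -avgMl; apply: eq_avg => g.
Qed.

Lemma mavg_avg (T : finType) t (Phi : T -> seq G -> C) :
  mavg t (fun l => avg (fun x => Phi x l)) = avg (fun x => mavg t (Phi x)).
Proof.
elim: t Phi => [|t IHt] Phi //=.
by rewrite exchange_avg; apply: eq_avg => g; apply: IHt.
Qed.

(** The product of Phi over the vertices of the box {g_1, g_1'} x ... x {g_t,
    g_t'}, with alternating conjugations. *)
Fixpoint cross (hh : seq (G * G)) Phi : C :=
  if hh is gg :: hh' then
    cross hh' (fun l => Phi (gg.1 :: l) * (Phi (gg.2 :: l))^*)
  else Phi [::].

Lemma eq_cross hh Phi Psi : Phi =1 Psi -> cross hh Phi = cross hh Psi.
Proof.
elim: hh Phi Psi => [|gg hh IHhh] Phi Psi e /=; first exact: e.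
by apply: IHhh => l; rewrite !e.
Qed.

Lemma crossM hh Phi Psi :
  cross hh (fun l => Phi l * Psi l) = cross hh Phi * cross hh Psi.
Proof.
elim: hh Phi Psi => [|gg hh IHhh] Phi Psi //=.
by rewrite -IHhh; apply: eq_cross => l; rewrite rmorphM/= mulrACA.
Qed.

Lemma cross_prod (I : Type) (r : seq I) (P : pred I) hh (Phi : I -> seq G -> C) :
  cross hh (fun l => \prod_(i <- r | P i) Phi i l) =
  \prod_(i <- r | P i) cross hh (Phi i).
Proof.
elim: hh Phi => [|gg hh IHhh] Phi //=.
rewrite -IHhh; apply: eq_cross => l.
by rewrite rmorph_prod -big_split.
Qed.

Lemma cross_bounded hh Phi : (forall l, `|Phi l| <= 1) -> `|cross hh Phi| <= 1.
Proof.
elim: hh Phi => [|gg hh IHhh] Phi h /=; first exact: h.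
by apply: IHhh => l; rewrite normrM norm_conjC mulr_ile1.
Qed.

(** Of all the factors only the one at the vertex (g_1, ..., g_t) is kept. *)
Lemma cross_le_top hh Phi : (forall l, `|Phi l| <= 1) ->
  `|cross hh Phi| <= `|Phi (unzip1 hh)|.
Proof.
elim: hh Phi => [|gg hh IHhh] Phi h //=.
apply: le_trans (IHhh _ _) _ => [l|].
  by rewrite normrM norm_conjC mulr_ile1.
by rewrite normrM norm_conjC ler_piMr.
Qed.

Definition box t Phi := mavg t (fun h' => mavg t (fun h => cross (zip h h') Phi)).

Lemma boxS t Phi : box t.+1 Phi =
  avg (fun g' => avg (fun g => box t (fun l => Phi (g :: l) * (Phi (g' :: l))^*))).
Proof. by rewrite /box /=; apply: eq_avg => g'; rewrite mavg_avg. Qed.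

Lemma eq_box t Phi Psi : Phi =1 Psi -> box t Phi = box t Psi.
Proof.
by move=> e; apply: eq_mavg => h' _; apply: eq_mavg => h _; apply: eq_cross.
Qed.

(** Products of 1-bounded functions, the i-th of which does not depend on
    coordinate i. *)
Fixpoint lower t b : Prop :=
  if t is t'.+1 then exists b1 b2,
    [/\ forall g l, b (g :: l) = b1 l * b2 (g :: l), forall l, `|b1 l| <= 1 &
        forall g, lower t' (fun l => b2 (g :: l))]
  else b [::] = 1.

Lemma lower_mul t b b' : lower t b -> lower t b' -> lower t (fun l => b l * b' l).
Proof.
elim: t b b' => [|t IHt] b b' /=; first by move=> -> ->; rewrite mulr1.
move=> [b1 [b2 [e hb1 hb2]]] [b1' [b2' [e' hb1' hb2']]].
exists (fun l => b1 l * b1' l), (fun l => b2 l * b2' l); split => [g l|l|g].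
- by rewrite e e' mulrACA.
- by rewrite normrM mulr_ile1.
- exact: IHt (hb2 g) (hb2' g).
Qed.

Lemma lower_conj t b : lower t b -> lower t (fun l => (b l)^*).
Proof.
elim: t b => [|t IHt] b /=; first by move=> ->; rewrite conjC1.
move=> [b1 [b2 [e hb1 hb2]]].
exists (fun l => (b1 l)^*), (fun l => (b2 l)^*); split => [g l|l|g].
- by rewrite e rmorphM.
- by rewrite norm_conjC.
- exact: IHt (hb2 g).
Qed.

Lemma avg_mul_conj (f : G -> C) :
  avg (fun g' => avg (fun g => f g * (f g')^*)) = `|avg f| ^+ 2.
Proof.
rewrite normCK -avg_conj -avgMl; apply: eq_avg => g'.
by rewrite avgMr.
Qed.

(** Cauchy-Schwarz once in each coordinate: the i-th application discards the
    factor of b that does not depend on coordinate i and doubles this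
    coordinate. *)
Lemma mavg_box t Phi b : lower t.+1 b ->
  `|mavg t.+1 (fun l => Phi l * b l)| ^+ (2 ^ t.+1) <= box t.+1 Phi.
Proof.
elim: t Phi b => [|t IHt] Phi b [b1 [b2 [e hb1 hb2]]].
  rewrite boxS [leRHS](avg_mul_conj (fun g => Phi [:: g])) /=.
  rewrite (eq_avg (g := fun g => Phi [:: g] * b1 [::])) => [|g].
    by rewrite avgMr normrM lerXn2r ?nnegrE ?mulr_ge0// ler_piMr.
  by rewrite e hb2 mulr1.
rewrite boxS expr_2S.
pose Phi2 g g' l := Phi (g :: l) * (Phi (g' :: l))^*.
pose b3 g g' l := b2 (g :: l) * (b2 (g' :: l))^*.
pose W l := avg (fun g => Phi (g :: l) * b2 (g :: l)).
have step : `|mavg t.+2 (fun l => Phi l * b l)| ^+ 2 <=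
    avg (fun g' => avg (fun g => `|mavg t.+1 (fun l => Phi2 g g' l * b3 g g' l)|)).
  have -> : mavg t.+2 (fun l => Phi l * b l) = mavg t.+1 (fun l => b1 l * W l).
    rewrite -[LHS]/(avg (fun g => mavg t.+1 (fun l => Phi (g :: l) * b (g :: l)))).
    rewrite -mavg_avg; apply: eq_mavg => l _.
    by rewrite -avgMl; apply: eq_avg => g; rewrite e mulrCA.
  apply: (@le_trans _ _ (mavg t.+1 (fun l => `|W l| ^+ 2))).
    apply: (@le_trans _ _ (mavg t.+1 (fun l => `|b1 l * W l|) ^+ (2 ^ 1))).
      by rewrite lerXn2r ?nnegrE ?ler_norm_mavg// mavg_ge0.
    apply: le_trans (mavg_pow2 _ _ _) _ => //; apply: ler_mavg => l _.
    by rewrite normrM lerXn2r ?nnegrE ?mulr_ge0// ler_piMl.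
  rewrite -[leLHS]ger0_norm; last by apply: mavg_ge0 => l; rewrite exprn_ge0.
  rewrite (eq_mavg (Psi := fun l => avg (fun g' => avg (fun g => Phi2 g g' l * b3 g g' l)))) => [|l _].
    rewrite mavg_avg (le_trans (ler_norm_avg _))//; apply: ler_avg => g'.
    by rewrite mavg_avg ler_norm_avg.
  rewrite -(avg_mul_conj (fun g => Phi (g :: l) * b2 (g :: l))).
  by apply: eq_avg => g'; apply: eq_avg => g; rewrite rmorphM/= mulrACA.
apply: le_trans (lerXn2r _ _ _ step) _; rewrite ?nnegrE ?exprn_ge0//.
  by apply: avg_ge0 => g'; apply: avg_ge0.
apply: le_trans (avg_pow2 _ _) _ => [g'|]; first exact: avg_ge0.
apply: ler_avg => g'; apply: le_trans (avg_pow2 _ _) _ => //.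
apply: ler_avg => g; apply: IHt; apply: lower_mul; first exact: hb2.
by apply: lower_conj; apply: hb2.
Qed.

Fixpoint dmuls (h : seq G) f : G -> C :=
  if h is k :: h' then dmuls h' (dmul k f) else f.

Lemma eq_dmuls h f g : f =1 g -> dmuls h f =1 dmuls h g.
Proof. by elim: h f g => //= k h IHh f g e; apply: IHh; apply: eq_dmul. Qed.

Lemma dmul_dmuls k h f : dmul k (dmuls h f) =1 dmuls h (dmul k f).
Proof.
elim: h f => //= l h IHh f x; rewrite IHh.
by apply: eq_dmuls; exact: dmulC.
Qed.

Lemma bounded1_dmuls h f : bounded1 f -> bounded1 (dmuls h f).
Proof. by elim: h f => //= k h IHh f fb; apply: IHh; apply: bounded1_dmul. Qed.

Lemma gowers_dmuls t s f : gowers (t + s) f = mavg t (fun h => gowers s (dmuls h f)).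
Proof. by elim: t f => //= t IHt f; apply: eq_avg => k; apply: IHt. Qed.

(** The factors of [dmuls l f x] other than the top one, f(x + sum l). *)
Fixpoint dlow (l : seq G) f x : C :=
  if l is k :: l' then (f (x + \sum_(g <- l') g))^* * dlow l' (dmul k f) x else 1.

Lemma dmuls_dlow l f x : dmuls l f x = f (x + \sum_(g <- l) g) * dlow l f x.
Proof.
elim: l f => [|k l IHl] f /=; first by rewrite big_nil addr0 mulr1.
rewrite IHl {1}/dmul big_cons -mulrA; congr (f _ * _).
by rewrite [k + _]addrC addrA.
Qed.

(** Every vertex of a cube other than the top one misses one of the steps. *)
Lemma lower_dlow t f x : bounded1 f -> lower t (fun l => dlow l f x).
Proof.
elim: t f => [|t IHt] f fb //=.
exists (fun l => (f (x + \sum_(g <- l) g))^*).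
exists (fun l => if l is k :: l' then dlow l' (dmul k f) x else 1).
split=> [//|l|g]; first by rewrite norm_conjC.
exact: (IHt _ (bounded1_dmul g fb)).
Qed.

(** The images of boxes under l |-> x + sum l are the cubes over which the
    Gowers norm averages. *)
Lemma box_gowers t f :
  avg (fun x => box t.+1 (fun l => f (x + \sum_(g <- l) g))) = gowers t f.
Proof.
elim: t f => [|t IHt] f.
  rewrite -[RHS](avg_const _ (0 : G)) /=; apply: eq_avg => x.
  rewrite boxS /= -(avg_shift f x) -avg_mul_conj; apply: eq_avg => g'.
  by apply: eq_avg => g; rewrite /box /= !big_seq1 ![x + _]addrC.
under eq_avg => x do rewrite boxS.
rewrite exchange_avg -[RHS](avg_const _ (0 : G)); apply: eq_avg => g'.
rewrite exchange_avg /= -[RHS](avg_shift _ (- g')); apply: eq_avg => g.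
rewrite -IHt -[LHS](avg_shift _ (- g')); apply: eq_avg => x.
apply: eq_box => l; rewrite !big_cons /dmul.
congr (f _ * (f _)^*); last by rewrite addrA subrK.
by rewrite [g + _]addrC addrACA [- g' + _]addrC.
Qed.

End Box.

(** * Fourier analysis on the additive group *)

Section Fourier.
Variables (C : numClosedFieldType) (p : nat) (F : finFieldType) (psi : F -> C).
Hypotheses (p_prime : prime p) (charF : p \in [pchar F]) (psiP : frob_char p psi).

Let charN := char_norm p_prime charF psiP.

Definition fourier (f : F -> C) c := avg (fun x => f x * psi (c * x)).

Lemma sum_char h : \sum_c psi (c * h) = #|F|%:R *+ (h == 0).
Proof.
have [->|h0] := eqVneq h 0.
  under eq_bigr => c _ do rewrite mulr0 (char0 psiP).
  by rewrite sumr_const.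
have := avg_char psiP h0; rewrite /avg => /eqP; rewrite mulf_eq0 invr_eq0.
have -> : (#|F|%:R == 0 :> C) = false.
  by apply/negbTE; rewrite pnatr_eq0 -lt0n; apply/card_gt0P; exists 0.
rewrite orbF mulr0n => /eqP e; rewrite -[RHS]e.
by apply: eq_bigr => c _; rewrite mulrC.
Qed.

Lemma dmul_char f c k x :
  dmul k (fun x => f x * psi (c * x)) x = dmul k f x * psi (c * k).
Proof.
rewrite /dmul rmorphM/= (char_conj p_prime charF psiP) mulrACA -(charD psiP).
by rewrite mulrDr addrAC subrr add0r.
Qed.

Lemma parseval f : \sum_c `|fourier f c| ^+ 2 = avg (fun x => `|f x| ^+ 2).
Proof.
transitivity (\sum_c avg (fun k => avg (dmul k f) * psi (c * k))).
  apply: eq_bigr => c _; rewrite /fourier norm_avg_sqr; apply: eq_avg => k.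
  by rewrite -avgMr; apply: eq_avg => x; exact: dmul_char.
transitivity ((\sum_k avg (dmul k f) * \sum_c psi (c * k)) / #|F|%:R).
  rewrite [in LHS]/avg -mulr_suml exchange_big/=; congr (_ / _).
  by apply: eq_bigr => k _; rewrite mulr_sumr.
under eq_bigr => k _ do rewrite sum_char.
rewrite (bigD1 0)//= [X in _ + X]big1 => [|k k0]; last by rewrite (negbTE k0) mulr0n mulr0.
rewrite eqxx addr0 mulrK; last first.
  by rewrite unitfE pnatr_eq0 -lt0n; apply/card_gt0P; exists 0.
by apply: eq_avg => x; rewrite /dmul addr0 normCK.
Qed.

(** Nonnegative elements of C are comparable, although C is only partially
    ordered. *)
Lemma exists_max (T : finType) (x0 : T) (g : T -> C) : (forall x, 0 <= g x) ->
  exists c, forall x, g x <= g c.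
Proof.
move=> g0; suff [c _ h] : exists2 c, true & {in enum T, forall x, g x <= g c}.
  by exists c => x; apply: h; rewrite mem_enum.
elim: (enum T) => [|y s [c _ IHs]]; first by exists x0.
have /orP[yc|cy] := real_leVge (ger0_real (g0 y)) (ger0_real (g0 c)).
  by exists c => // x; rewrite inE => /predU1P[->//|/IHs].
exists y => // x; rewrite inE => /predU1P[->//|/IHs h].
exact: le_trans h cy.
Qed.

(** The U^2 norm is the sum of the fourth powers of the Fourier coefficients,
    which is at most the largest squared coefficient times the sum of the
    squares, and this sum is at most 1 by Parseval. *)
Lemma gowers1_fourier f : bounded1 f -> exists c, gowers 1 f <= `|fourier f c| ^+ 2.
Proof.
move=> fb.
have [c hc] := @exists_max F 0 (fun c => `|fourier f c| ^+ 2) (fun=> exprn_ge0 2 (normr_ge0 _)).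
exists c; rewrite /= -parseval.
apply: (@le_trans _ _ (\sum_d `|fourier f d| ^+ 2 * `|fourier f c| ^+ 2)).
  apply: ler_sum => d _.
  have -> : fourier (fun k => avg (dmul k f)) d = `|fourier f d| ^+ 2.
    rewrite /fourier norm_avg_sqr; apply: eq_avg => k.
    by rewrite -avgMr; apply: eq_avg => x; rewrite dmul_char.
  by rewrite ger0_norm ?exprn_ge0// expr2 ler_wpM2l ?exprn_ge0.
rewrite -mulr_suml parseval ler_piMl ?exprn_ge0//; apply: avg_le => // x.
by rewrite exprn_ile1.
Qed.

End Fourier.

(** * Degree lowering *)

Section DegreeLowering.
Variables (C : numClosedFieldType) (p : nat) (F : finFieldType) (psi : F -> C).
Hypotheses (p_prime : prime p) (charF : p \in [pchar F]) (psiP : frob_char p psi).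

Let charN := char_norm p_prime charF psiP.
Let q_gt0 : (0 < #|F|)%N. Proof. by apply/card_gt0P; exists 0. Qed.

(** The frequency of the character that [cross] makes of l |-> psi (c l * x). *)
Fixpoint altsum (hh : seq (F * F)) (c : seq F -> F) : F :=
  if hh is gg :: hh' then altsum hh' (fun l => c (gg.1 :: l) - c (gg.2 :: l))
  else c [::].

(** The alternating sum with the vertex [unzip1 hh] left out; as a function
    of the first corners it is a sum of terms each of which ignores a
    coordinate. *)
Fixpoint altrest (hh : seq (F * F)) (c : seq F -> F) : F :=
  if hh is gg :: hh' then
    altrest hh' (fun l => c (gg.1 :: l)) - altsum hh' (fun l => c (gg.2 :: l))
  else 0.

Lemma eq_altsum hh c d : c =1 d -> altsum hh c = altsum hh d.
Proof.
elim: hh c d => [|gg hh IHhh] c d e /=; first exact: e.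
by apply: IHhh => l; rewrite !e.
Qed.

Lemma altsumB hh c d : altsum hh (fun l => c l - d l) = altsum hh c - altsum hh d.
Proof.
elim: hh c d => [|gg hh IHhh] c d //=; rewrite -IHhh; apply: eq_altsum => l.
by rewrite !opprD addrACA.
Qed.

Lemma mavg2_avg (T : finType) t s (Phi : T -> seq F -> seq F -> C) :
  mavg t (fun h' => mavg s (fun h => avg (fun x => Phi x h' h))) =
  avg (fun x => mavg t (fun h' => mavg s (Phi x h'))).
Proof. by rewrite -mavg_avg; apply: eq_mavg => h' _; rewrite mavg_avg. Qed.

Lemma small_mavg t (Phi : seq F -> C) N K : (forall l, 0 <= Phi l) ->
  (forall l, small #|F| N K (Phi l)) -> small #|F| N K (mavg t Phi).
Proof.
elim: t Phi => [|t IHt] Phi P0 Ps //=; apply: small_avg => g; last exact: IHt.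
exact: mavg_ge0.
Qed.

Lemma altsumE hh c : altsum hh c = c (unzip1 hh) + altrest hh c.
Proof.
elim: hh c => [|gg hh IHhh] c /=; first by rewrite addr0.
by rewrite altsumB IHhh addrA.
Qed.

Lemma cross_char hh c x :
  cross hh (fun l => psi (c l * x)) = psi (altsum hh c * x).
Proof.
elim: hh c => [|gg hh IHhh] c //=; rewrite -IHhh; apply: eq_cross => l.
by rewrite (char_conj p_prime charF psiP) -(charD psiP) -mulrBl.
Qed.

Lemma lower_altrest t h' c k : size h' = t ->
  lower t (fun l => psi (altrest (zip l h') c * k)).
Proof.
elim: t h' c => [|t IHt] [|g' h'] c //=; first by rewrite mul0r (char0 psiP).
move=> [sh']; exists (fun l => psi (- altsum (zip l h') (fun l => c (g' :: l)) * k)).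
exists (fun l => if l is g :: l' then psi (altrest (zip l' h') (fun l => c (g :: l)) * k) else 1).
split=> [g l|l|g]; first by rewrite -(charD psiP) -mulrDl addrC.
  by rewrite charN.
exact: IHt.
Qed.

(** The contribution of the boxes whose alternating sum of frequencies
    vanishes, where the average over x gives no cancellation. *)
Definition coincidence t (cf : seq F -> F) (w : seq F -> C) : C :=
  mavg t (fun h' => mavg t (fun h => `|w h| * (altsum (zip h h') cf == 0)%:R)).

Section Bound.
Variables (N0 K0 : nat) (K : F -> F -> C).
Hypothesis K1 : forall y, bounded1 (K y).
Hypothesis KS : forall hh c, c != 0 -> small #|F| N0 K0
  `|avg (fun x => avg (fun y =>
      cross hh (fun l => K y (x + \sum_(g <- l) g)) * psi (c * x)))|.

(** [mavg_box] discards b. What remains on each box is a correlation of a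
    product of translates of K y with the character of frequency [altsum hh
    cf]; it is negligible by [KS] unless this frequency is 0. *)
Lemma dual_interchange t cf (w : seq F -> C) (b : F -> seq F -> C) :
  (forall l, `|w l| <= 1) -> (forall x, lower t.+1 (b x)) ->
  exists E, [/\ 0 <= E, small #|F| N0 K0 E &
    `|avg (fun x => avg (fun y => mavg t.+1 (fun l =>
       K y (x + \sum_(g <- l) g) * psi (cf l * x) * w l * b x l)))| ^+ (2 ^ t.+1)
    <= coincidence t.+1 cf w + E].
Proof.
move=> w1 bl; pose Phi x y l := K y (x + \sum_(g <- l) g) * psi (cf l * x) * w l.
pose X hh := `|avg (fun x => avg (fun y =>
  cross hh (fun l => K y (x + \sum_(g <- l) g)) * psi (altsum hh cf * x)))|.
pose E := mavg t.+1 (fun h' => mavg t.+1 (fun h =>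
  X (zip h h') * (altsum (zip h h') cf != 0)%:R)).
have X0 hh : 0 <= X hh by exact: normr_ge0.
exists E; split.
- by apply: mavg_ge0 => h'; apply: mavg_ge0 => h; rewrite mulr_ge0 ?X0.
- apply: small_mavg => h'; first by apply: mavg_ge0 => h; rewrite mulr_ge0 ?X0.
  apply: small_mavg => h; first by rewrite mulr_ge0 ?X0.
  have [e|ne] := eqVneq; last by rewrite mulr1; exact: KS.
  by rewrite mulr0 /small expr0n expn_eq0/= divr_ge0.
apply: le_trans (norm_avg_pow2 _ _) _.
apply: le_trans (ler_avg (fun x => norm_avg_pow2 _ _)) _.
apply: le_trans (ler_avg (fun x => ler_avg (fun y => mavg_box (Phi x y) (bl x)))) _.
rewrite -[leLHS]ger0_norm; last first.
  apply: avg_ge0 => x; apply: avg_ge0 => y.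
  by apply: le_trans (mavg_box (Phi x y) (bl x)); rewrite exprn_ge0.
have -> : avg (fun x => avg (fun y => box t.+1 (Phi x y))) =
    mavg t.+1 (fun h' => mavg t.+1 (fun h =>
      avg (fun x => avg (fun y => cross (zip h h') (Phi x y))))).
  by rewrite mavg2_avg; apply: eq_avg => x; rewrite mavg2_avg.
apply: le_trans (ler_norm_mavg _ _) _.
rewrite /coincidence /E -mavgD; apply: ler_mavg => h' sh'.
apply: le_trans (ler_norm_mavg _ _) _; rewrite -mavgD; apply: ler_mavg => h sh.
set hh := zip h h'.
have -> : avg (fun x => avg (fun y => cross hh (Phi x y))) = cross hh w *
    avg (fun x => avg (fun y =>
      cross hh (fun l => K y (x + \sum_(g <- l) g)) * psi (altsum hh cf * x))).
  rewrite -avgMl; apply: eq_avg => x; rewrite -avgMl; apply: eq_avg => y.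
  by rewrite !crossM cross_char mulrC.
rewrite normrM -/(X hh); have [e|ne] := eqVneq (altsum hh cf) 0.
  rewrite mulr0 addr0 mulr1.
  have -> : h = unzip1 hh by rewrite unzip1_zip// sh sh'.
  rewrite (le_trans _ (cross_le_top _ w1))// ler_piMr//.
  apply: avg_bounded1 => x; apply: avg_bounded1 => y.
  by rewrite normrM charN mulr1 cross_bounded// => l; apply: K1.
by rewrite mulr0 add0r mulr1 ler_piMl// cross_bounded.
Qed.

End Bound.

(** Fix h'. Where the alternating sum vanishes, cf h equals - [altrest],
    hence its character is a product of functions each of which ignores a
    coordinate of h. So [mavg_box] bounds the average of the squared Fourier
    coefficients at these frequencies by [gowers t.+1 f], whereas arbitrary
    frequencies would cost [gowers t.+2 f]. *)
Lemma coincidence_gowers t cf (f : F -> C) : bounded1 f ->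
  coincidence t.+1 cf (fun h => (avg (fun x => dmuls h f x * psi (cf h * x)))^*)
    ^+ (2 ^ t.+2) <= gowers t.+1 f.
Proof.
move=> fb; set w := fun h => _.
have V h' : size h' = t.+1 ->
    mavg t.+1 (fun h => `|w h| ^+ 2 * (altsum (zip h h') cf == 0)%:R) ^+ (2 ^ t.+1)
      <= gowers t.+1 f.
  move=> sh'.
  pose W := mavg t.+1 (fun h =>
    `|avg (fun x => dmuls h f x * psi (- altrest (zip h h') cf * x))| ^+ 2).
  apply: (@le_trans _ _ (W ^+ (2 ^ t.+1))).
    rewrite lerXn2r ?nnegrE//.
    - by apply: mavg_ge0 => h; rewrite mulr_ge0 ?exprn_ge0.
    - by apply: mavg_ge0 => h; rewrite exprn_ge0.
    apply: ler_mavg => h sh; have [e|_] := eqVneq; last by rewrite mulr0 exprn_ge0.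
    rewrite mulr1 /w norm_conjC le_eqVlt; apply/orP; left; apply/eqP.
    move/eqP: e; rewrite altsumE addr_eq0 unzip1_zip ?sh ?sh'// => /eqP e.
    by rewrite e.
  pose b k x h := dlow h (dmul k f) x * psi (altrest (zip h h') cf * - k).
  have WE : W = avg (fun k => avg (fun x => mavg t.+1 (fun h =>
      dmul k f (x + \sum_(g <- h) g) * b k x h))).
    rewrite /W (eq_mavg (Psi := fun h => avg (fun k => avg (fun x =>
      dmul k f (x + \sum_(g <- h) g) * b k x h)))) => [|h sh].
      by rewrite mavg_avg; apply: eq_avg => k; rewrite mavg_avg.
    rewrite norm_avg_sqr; apply: eq_avg => k; apply: eq_avg => x.
    rewrite (dmul_char p_prime charF psiP) dmul_dmuls dmuls_dlow -mulrA.
    by rewrite /b mulNr mulrN.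
  have W0 : 0 <= W by apply: mavg_ge0 => h; rewrite exprn_ge0.
  rewrite -(ger0_norm W0) WE.
  apply: le_trans (norm_avg_pow2 _ _) _; apply: ler_avg => k.
  apply: le_trans (norm_avg_pow2 _ _) _.
  rewrite -[leRHS]/(gowers t (dmul k f)) -box_gowers; apply: ler_avg => x; apply: mavg_box.
  apply: lower_mul; last exact: lower_altrest.
  by apply: lower_dlow; apply: bounded1_dmul.
have pos h' h : 0 <= `|w h| * (altsum (zip h h') cf == 0)%:R by rewrite mulr_ge0.
have pos2 h' h : 0 <= `|w h| ^+ 2 * (altsum (zip h h') cf == 0)%:R.
  by rewrite mulr_ge0 ?exprn_ge0.
have step : coincidence t.+1 cf w ^+ 2 <= mavg t.+1 (fun h' =>
    mavg t.+1 (fun h => `|w h| ^+ 2 * (altsum (zip h h') cf == 0)%:R)).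
  apply: le_trans (mavg_pow2 1 _ _) _ => [h'|]; first exact: mavg_ge0.
  apply: ler_mavg => h' _; apply: le_trans (mavg_pow2 1 _ _) _ => //.
  by apply: ler_mavg => h _; rewrite exprMn; case: eqP; rewrite ?expr1n ?expr0n.
rewrite expr_2S; apply: le_trans (lerXn2r _ _ _ step) _; rewrite ?nnegrE.
- by rewrite exprn_ge0//; apply: mavg_ge0 => h'; apply: mavg_ge0.
- by apply: mavg_ge0 => h'; apply: mavg_ge0.
apply: le_trans (mavg_pow2 _ _ _) _ => [h'|]; first exact: mavg_ge0.
by apply: mavg_le; [exact: gowers_ge0|exact: V].
Qed.

End DegreeLowering.

(** The dual function x |-> avg_y K y x without its mean c0, halved so as to
    be 1-bounded. *)
Definition centered (C : numClosedFieldType) (F : finFieldType) (K : F -> F -> C) (c0 : C) (x : F) : C :=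
  (avg (fun y => K y x) - c0) / 2.

Lemma bounded1_centered (C : numClosedFieldType) (F : finFieldType) (K : F -> F -> C) c0 :
  (forall y, bounded1 (K y)) -> `|c0| <= 1 -> bounded1 (centered K c0).
Proof.
move=> K1 c01 x; rewrite /centered normrM normfV [ `|2|]ger0_norm// ler_pdivrMr// mul1r.
by rewrite (le_trans (ler_normB _ _))// -[2]/(1 + 1) lerD// avg_bounded1// => y; apply: K1.
Qed.

(** The hypothesis of degree lowering. The induction on the number of
    arbitrary functions provides it, since a product of translates of K y has
    the same shape as K y. *)
Definition twisted_small (C : numClosedFieldType) (F : finFieldType) (psi : F -> C) N0 K0
    (K : F -> F -> C) :=
  forall hh c, c != 0 -> small #|F| N0 K0
  `|avg (fun x => avg (fun y =>
      cross hh (fun l => K y (x + \sum_(g <- l) g)) * psi (c * x)))|.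

Lemma twisted_small_const (C : numClosedFieldType) p (F : finFieldType) (psi : F -> C) N0 K0 c0 :
  frob_char p psi -> twisted_small psi N0 K0 (fun _ _ => c0).
Proof.
move=> psiP hh c c_neq0.
rewrite (eq_avg (g := fun x => cross hh (fun=> c0) * psi (c * x))) => [|x].
  rewrite avgMl (avg_char psiP)// mulr0 normr0 /small expr0n expn_eq0/=.
  by rewrite divr_ge0.
by rewrite avg_const//; exact: (0 : F).
Qed.

(** [gowers t.+2 f] averages over h the U^2 norms [gowers 1] of the
    differences [dmuls h f], and each is at most a squared Fourier
    coefficient, at a frequency [cf h]. In one of the two factors, the top
    vertex of the difference is written out as an average of K minus a
    constant; [dual_interchange] applies to both parts and leaves the
    coincidences of the frequencies, which [coincidence_gowers] bounds by
    [gowers t.+1 f]. *)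
Lemma degree_lowering_step (C : numClosedFieldType) (p : nat) (p_prime : prime p) t N0 K0 N K1 :
  exists N2 K2, forall (F : finFieldType) (charF : p \in [pchar F]) (psi : F -> C)
    (psiP : frob_char p psi) (K : F -> F -> C) c0,
    (forall y, bounded1 (K y)) -> `|c0| <= 1 -> twisted_small psi N0 K0 K ->
    small #|F| N K1 (gowers t.+1 (centered K c0)) ->
    small #|F| N2 K2 (gowers t.+2 (centered K c0)).
Proof.
do 2 eexists; move=> F charF psi psiP K c0 Kb c01 KS g_small.
have q_gt0 : (0 < #|F|)%N by apply/card_gt0P; exists 0.
set f := centered K c0; have fb : bounded1 f by exact: bounded1_centered.
pose cf h := xchoose (gowers1_fourier p_prime charF psiP (bounded1_dmuls h fb)).
pose w h := (avg (fun x => dmuls h f x * psi (cf h * x)))^*.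
have w1 h : `|w h| <= 1.
  rewrite norm_conjC; apply: avg_bounded1 => x.
  by rewrite normrM (char_norm p_prime charF psiP) mulr1; apply: bounded1_dmuls.
have low x : lower t.+1 (fun l => dlow l f x) by exact: lower_dlow.
have [E1 [E10 E1s]] := dual_interchange p_prime charF psiP Kb KS cf w1 low.
have c0b : forall y : F, bounded1 ((fun _ _ => c0) y : F -> C) by move=> y x.
have [E2 [E20 E2s]] := dual_interchange p_prime charF psiP c0b
  (twisted_small_const N0 K0 c0 psiP) cf w1 low.
set A2 := `|_|; set A1 := `|_| => A2le A1le.
have main : gowers t.+2 f <= A1 + A2.
  pose u x y l := K y (x + \sum_(g <- l) g) * psi (cf l * x) * w l * dlow l f x.
  pose v x (y : F) l := c0 * psi (cf l * x) * w l * dlow l f x.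
  have step : gowers t.+2 f <= mavg t.+1 (fun h =>
    2^-1 * avg (fun x => avg (fun y => u x y h)) +
    - 2^-1 * avg (fun x => avg (fun y => v x y h))).
    rewrite -[t.+2]addn1 gowers_dmuls; apply: ler_mavg => h _.
    apply: le_trans (xchooseP (gowers1_fourier p_prime charF psiP (bounded1_dmuls h fb))) _.
    rewrite le_eqVlt; apply/orP; left; apply/eqP.
    rewrite normCK -/(cf h) -/(w h) -avgMr -!avgMl -avgD; apply: eq_avg => x.
    rewrite /u /v !avgMr avg_const; last exact: (0 : F).
    rewrite dmuls_dlow /f /centered; ring.
  have AE : mavg t.+1 (fun h => 2^-1 * avg (fun x => avg (fun y => u x y h)) +
      - 2^-1 * avg (fun x => avg (fun y => v x y h))) =
      2^-1 * avg (fun x => avg (fun y => mavg t.+1 (u x y))) +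
      - 2^-1 * avg (fun x => avg (fun y => mavg t.+1 (v x y))).
    rewrite mavgD !mavgMl !mavg_avg.
    by congr (_ * _ + _ * _); apply: eq_avg => x; rewrite mavg_avg.
  have Y0 := le_trans (gowers_ge0 _ _) step.
  apply: (le_trans step); rewrite -(ger0_norm Y0) AE.
  apply: le_trans (ler_normD _ _) _.
  rewrite [ `|2^-1 * _|]normrM [ `|- 2^-1 * _|]normrM normrN [ `|2^-1|]ger0_norm ?invr_ge0//.
  have half1 : (2^-1 : C) <= 1 by rewrite invf_le1// ler1n.
  by apply: lerD; apply: ler_piMl.
have k0 : 0 <= coincidence t.+1 cf w.
  by apply: mavg_ge0 => h'; apply: mavg_ge0 => h; rewrite mulr_ge0.
have ks : small #|F| (t.+2 + N) (1 ^ (2 ^ N) * K1) (coincidence t.+1 cf w).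
  apply: (small_pow (c := 1) k0 _ g_small); rewrite mul1r.
  by apply: coincidence_gowers p_prime charF psiP _ _ _ fb.
rewrite -[leRHS]mul1r in A1le; rewrite -[leRHS]mul1r in A2le.
have A1s := small_pow (c := 1) (normr_ge0 _) A1le (smallD q_gt0 k0 E10 ks E1s).
have A2s := small_pow (c := 1) (normr_ge0 _) A2le (smallD q_gt0 k0 E20 ks E2s).
apply: small_le main _; first exact: gowers_ge0.
exact: (smallD q_gt0 (normr_ge0 _) (normr_ge0 _) A1s A2s).
Qed.

(** The mean has been removed, so [gowers 0] vanishes. Some Fourier
    coefficient controls [gowers 1]; the one of frequency 0 is the mean, and
    the others are small by hypothesis. The remaining orders follow one at a
    time. *)
Lemma degree_lowering (C : numClosedFieldType) (p : nat) (p_prime : prime p) s N0 K0 :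
  exists M L, forall (F : finFieldType) (charF : p \in [pchar F]) (psi : F -> C)
    (psiP : frob_char p psi) (K : F -> F -> C),
    (forall y, bounded1 (K y)) -> twisted_small psi N0 K0 K ->
    small #|F| M L (gowers s (centered K (avg (fun x => avg (fun y => K y x))))).
Proof.
elim: s => [|[|t] [N [K1 IHs]]].
- exists 0%N, 0%N => F charF psi psiP K Kb KS.
  rewrite /small expr1 mul0r /= /centered avgMr avgB avg_const; last exact: (0 : F).
  by rewrite subrr mul0r normr0 expr0n.
- exists N0, K0 => F charF psi psiP K Kb KS.
  set c0 := avg _.
  have fb : bounded1 (centered K c0).
    apply: bounded1_centered => //.
    by apply: avg_bounded1 => x; apply: avg_bounded1 => y; apply: Kb.
  have [c hc] := gowers1_fourier p_prime charF psiP fb.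
  have [c00|cn0] := eqVneq c 0.
    move: hc; rewrite c00 /fourier.
    rewrite (eq_avg (g := centered K c0)) => [|x]; last by rewrite mul0r (char0 psiP) mulr1.
    rewrite /centered avgMr avgB avg_const; last exact: (0 : F).
    rewrite subrr mul0r normr0 expr0n => g0.
    apply: small_le (gowers_ge0 _ _) g0 _.
    by rewrite /small expr0n expn_eq0/= divr_ge0.
  apply: small_le (gowers_ge0 _ _) _ (KS [::] c cn0).
  apply: le_trans hc _; set A := avg _.
  have -> : fourier psi (centered K c0) c = A / 2.
    rewrite -[A]subr0 -(mulr0 c0) -(avg_char psiP cn0) -avgMl -avgB -avgMr.
    apply: eq_avg => x; rewrite /centered mulrAC mulrBl -avgMr.
    congr ((_ - _) / _); apply: eq_avg => y /=.
    by rewrite big_nil addr0.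
  have A1 : `|A| <= 1.
    apply: avg_bounded1 => x; apply: avg_bounded1 => y.
    by rewrite normrM (char_norm p_prime charF psiP) mulr1; apply: Kb.
  rewrite normrM normfV [ `|2|]ger0_norm// exprMn expr2 -mulrA ler_piMr//.
  rewrite -[leRHS](mulr1 1) ler_pM ?exprn_ge0 ?invr_ge0//.
  by rewrite exprn_ile1 ?invr_ge0// invf_le1// ler1n.
have [N2 [K2 h]] := degree_lowering_step C p_prime t N0 K0 N K1.
exists N2, K2 => F charF psi psiP K Kb KS.
have c01 : `|avg (fun x => avg (fun y => K y x))| <= 1.
  by apply: avg_bounded1 => x; apply: avg_bounded1 => y; apply: Kb.
exact: h charF psi psiP K _ Kb c01 KS (IHs F charF psi psiP K Kb KS).
Qed.

(** * Asymptotics for nondegenerate families *)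

Definition pattern_avg (C : numClosedFieldType) (F : finFieldType) n
    (P : 'I_n -> {poly F}) (f : 'I_n -> F -> C) : C :=
  avg (fun x => avg (fun y => \prod_j f j (x + (P j).[y]))).

Lemma pattern_avg_shift (C : numClosedFieldType) (F : finFieldType) n
    (P : 'I_n -> {poly F}) (f : 'I_n -> F -> C) i k :
  pattern_avg P f = avg (fun x => avg (fun y =>
    f i (x + (P i - P k).[y]) * \prod_(j | j != i) f j (x + (P j - P k).[y]))).
Proof.
rewrite /pattern_avg (avg2_shift _ (fun y => - (P k).[y])).
apply: eq_avg => x; apply: eq_avg => y; rewrite (bigD1 i)//=.
have e j : x - (P k).[y] + (P j).[y] = x + (P j - P k).[y].
  by rewrite hornerD hornerN addrAC addrA.
by rewrite e; congr (_ * _); apply: eq_bigr => j _; rewrite e.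
Qed.

(** PET needs a tracked polynomial of the largest degree. Translating by P
    j0, where j0 maximizes the degree of P i - P j0, makes P i such a
    polynomial. *)
Lemma pet_pattern (C : numClosedFieldType) n D :
  exists s N K, forall (F : finFieldType) (P : 'I_n -> {poly F}),
    (forall j, (size (P j) <= D)%N) ->
    forall (f : 'I_n -> F -> C) i, (forall j, bounded1 (f j)) ->
    (exists j, j != i) -> (forall j, j != i -> ~~ deg_lt 1 (P i - P j)) ->
    `|pattern_avg P f| ^+ (2 ^ N) <= K%:R * (gowers s (f i) + #|F|%:R^-1).
Proof.
have [s [N [K h]]] := pet_control C D D (fun=> n.+1) n.
exists s, N, K => F P sP f i fb [j1 j1i] nc.
have sPB j k : (size (P j - P k)%R <= D)%N.
  by rewrite (leq_trans (size_polyD _ _))// size_polyN geq_max !sP.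
have exd : exists d, [forall j, deg_lt d.+1 (P i - P j)].
  by exists D; apply/forallP => j; apply: deg_ltS; apply: deg_lt_size.
case: (ex_minnP exd) => d /forallP dP dmin.
have d_gt0 : (0 < d)%N by case: (d) dP => // /(_ j1); rewrite (negbTE (nc _ j1i)).
have dD : (d <= D)%N.
  by apply: dmin; apply/forallP => j; apply: deg_ltS; apply: deg_lt_size.
have [j0 hj0] : exists j0, ~~ deg_lt d (P i - P j0).
  apply/existsP; rewrite -negb_forall; apply/negP => hd.
  have := dmin d.-1; rewrite prednK// => /(_ hd).
  by rewrite leqNgt ltn_predL d_gt0.
pose L := [seq (BFun (fb j), P j - P j0) | j <- enum 'I_n & j != i].
have LE : unzip2 L = [seq P j - P j0 | j <- enum 'I_n & j != i].
  by rewrite /unzip2 -map_comp.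
have mem r : r \in (P i - P j0) :: unzip2 L -> exists j, r = P j - P j0.
  by rewrite inE LE => /predU1P[->|/mapP[j _ ->]]; [exists i|exists j].
have sL : (size (unzip2 L) <= n)%N.
  rewrite LE size_map size_filter (leq_trans (count_size _ _))//.
  by rewrite size_enum_ord.
have fam : pet_family D D (fun=> n.+1) n (P i - P j0) (unzip2 L).
  split => //.
  - exists d; rewrite d_gt0 dD; split => // r /mem[j ->].
    rewrite (_ : P j - P j0 = (P i - P j0) - (P i - P j)); last first.
      by rewrite opprB [RHS]addrC addrA subrK.
    by rewrite deg_ltB.
  - by move=> r /mem[j ->].
  - move=> r; rewrite LE => /mapP[j]; rewrite mem_filter => /andP[ji _] ->.
    by rewrite opprB addrA subrK nc.
  - exists (fun=> (P i - P j0) :: unzip2 L) => k _; split; first by rewrite /= ltnS.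
    move=> r rL _ _; apply/hasP; exists r => //.
    by rewrite subrr deg_lt_size// size_poly0.
have -> : pattern_avg P f = pet_avg (f i) (P i - P j0) L.
  rewrite (pattern_avg_shift P f i j0).
  apply: eq_avg => x; apply: eq_avg => y; congr (_ * _).
  by rewrite big_map big_filter big_enum_cond.
exact: (h F _ L (BFun (fb i)) fam).
Qed.

Section Asymptotics.
Variables (C : numClosedFieldType) (p : nat) (p_prime : prime p) (n D : nat).

(** Characters of frequencies c_j contribute to a pattern average only if
    sum_j c_j = 0, because of the average over x. *)
Definition nondegenerate (F : finFieldType) (psi : F -> C) (P : 'I_n -> {poly F}) :=
  forall c : 'I_n -> F, \sum_j c j = 0 -> (exists j, c j != 0) ->
  exists x y, psi (\sum_j c j *: P j).[x] != psi (\sum_j c j *: P j).[y].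

(** Take c to be 1 at i, -1 at j and 0 elsewhere. *)
Lemma nondegenerate_diff (F : finFieldType) (psi : F -> C) (P : 'I_n -> {poly F}) i j :
  nondegenerate psi P -> j != i -> ~~ deg_lt 1 (P i - P j).
Proof.
move=> nd ji; pose c k : F := (k == i)%:R - (k == j)%:R.
have sc (V : lmodType F) (v : 'I_n -> V) : \sum_k c k *: v k = v i - v j.
  under eq_bigr => k _ do rewrite /c scalerBl.
  rewrite sumrB (bigD1 i)//= big1 => [|k /negbTE->]; last by rewrite scale0r.
  rewrite eqxx scale1r addr0 (bigD1 j)//= [X in _ - (_ + X)]big1 => [|k /negbTE->]; last by rewrite scale0r.
  by rewrite eqxx scale1r addr0.
have [||x [y]] := nd c.
- by have := sc F^o (fun=> 1); rewrite subrr => e; rewrite -[RHS]e; apply: eq_bigr => k _; rewrite /GRing.scale/= mulr1.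
- by exists i; rewrite /c eqxx [i == j]eq_sym (negbTE ji) subr0 oner_neq0.
rewrite (sc _ P); apply: contra => /deg_lt1P h.
by rewrite (h x y).
Qed.

Definition char_like (F : finFieldType) (psi : F -> C) (f : F -> C) :=
  exists ac : C * F, `|ac.1| <= 1 /\ forall x, f x = ac.1 * psi (ac.2 * x).

(** The induction is on the number l of arbitrary functions; the remaining
    ones are multiples of characters. *)
Definition pattern_estimate l := exists N K,
  forall (F : finFieldType) (charF : p \in [pchar F]) (psi : F -> C)
    (psiP : frob_char p psi) (P : 'I_n -> {poly F}),
  (forall j, (size (P j) <= D)%N) -> nondegenerate psi P ->
  forall f : 'I_n -> F -> C, (forall j, bounded1 (f j)) ->
  (forall j : 'I_n, (l <= j)%N -> char_like psi (f j)) ->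
  small #|F| N K `|pattern_avg P f - \prod_j avg (f j)|.

(** For characters the average over x vanishes unless the frequencies add up
    to 0, and then the average over y is an exponential sum covered by
    [exp_sum], unless all frequencies are 0. *)
Lemma pattern_estimate0 : pattern_estimate 0.
Proof.
have [N [K h]] := exp_sum C p_prime D.
exists N, K => F charF psi psiP P sP nd f fb fchar.
have [ac hac] : exists ac : 'I_n -> C * F, forall j,
    `|(ac j).1| <= 1 /\ forall x, f j x = (ac j).1 * psi ((ac j).2 * x).
  by apply: (fin_all_exists (P := fun j a => `|a.1| <= 1 /\ forall x, f j x = a.1 * psi (a.2 * x))) => j; exact: fchar.
pose a j := (ac j).1; pose c j := (ac j).2.
have a1 j : `|a j| <= 1 by case: (hac j).
have fE j x : f j x = a j * psi (c j * x) by case: (hac j).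
have s0 : small #|F| N K (0 : C).
  by rewrite /small expr0n expn_eq0/= divr_ge0.
have avgf j : avg (f j) = a j * (c j == 0)%:R.
  rewrite (eq_avg (fE j)) avgMl; congr (_ * _); have [->|c0] := eqVneq (c j) 0.
    rewrite (eq_avg (g := fun=> 1)) => [|x]; last by rewrite mul0r (char0 psiP).
    by rewrite avg_const//; exact: (0 : F).
  by rewrite (avg_char psiP).
have -> : pattern_avg P f = (\prod_j a j) * (avg (fun x => psi ((\sum_j c j) * x))
    * avg (fun y => psi (\sum_j c j *: P j).[y])).
  rewrite -avgMr -avgMl; apply: eq_avg => x; rewrite -!avgMl; apply: eq_avg => y.
  under eq_bigr => j _ do rewrite fE.
  rewrite big_split/=; congr (_ * _); rewrite -(charD psiP) -(char_sum psiP).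
  congr (psi _); rewrite horner_sum mulr_suml -big_split/=; apply: eq_bigr => j _.
  by rewrite hornerZ mulrDr.
have prod0 j : c j != 0 -> \prod_j avg (f j) = 0.
  by move=> c0; rewrite (bigD1 j)//= avgf (negbTE c0) mulr0 mul0r.
have [sc0|sc0] := eqVneq (\sum_j c j) 0; last first.
  rewrite (avg_char psiP sc0) mul0r mulr0 sub0r.
  have [/existsP[j cj]|] := boolP [exists j, c j != 0]; first by rewrite (prod0 j)// oppr0 normr0.
  rewrite negb_exists => /forallP c0; case/negP: sc0; apply/eqP.
  by apply: big1 => j _; apply/eqP; have := c0 j; rewrite negbK.
rewrite [X in _ * (X * _)](_ : _ = 1) ?mul1r; last first.
  rewrite sc0 (eq_avg (g := fun=> 1)) => [|x]; last by rewrite mul0r (char0 psiP).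
  by rewrite avg_const//; exact: (0 : F).
have [/existsP[j cj]|] := boolP [exists j, c j != 0].
  rewrite (prod0 j)// subr0; apply: small_le (h F charF psi (\sum_j c j *: P j) psiP _ _) => //.
  - rewrite normrM ler_piMl// norm_prod_le1//.
  - rewrite (leq_trans (size_sum _ _ _))//; apply/bigmax_leqP => k _.
    by rewrite (leq_trans (size_scale_leq _ _))// ltnW// ltnS.
  - by apply: nd => //; exists j.
rewrite negb_exists => /forallP c0.
have {}c0 j : c j = 0 by apply/eqP; have := c0 j; rewrite negbK.
rewrite (eq_avg (g := fun=> 1)) => [|x].
  rewrite avg_const ?mulr1; last exact: (0 : F).
  under [X in _ - X]eq_bigr => j _ do rewrite avgf c0 eqxx mulr1.
  by rewrite subrr normr0.
by rewrite big1 ?horner0 ?(char0 psiP)// => j _; rewrite c0 scale0r.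
Qed.

(** Let i be the index l and let K y x be the product over the other indices,
    so that the pattern average is the correlation of f i with the dual
    function avg_y K y. With a character in place of f i the induction
    hypothesis says that [twisted_small] holds, so all Gowers norms of the
    centered dual function Ft are small by [degree_lowering]. The pattern
    average with the conjugate of Ft in place of f i is 2 avg |Ft|^2, and by
    [pet_pattern] it is controlled by such a norm. Hence Ft is small in L^2,
    f i may be replaced by its mean, and a constant is a multiple of a
    character. *)
Lemma pattern_estimateS l : (1 < n)%N -> (l < n)%N -> pattern_estimate l -> pattern_estimate l.+1.
Proof.
move=> n1 ln [N [K IH]]; pose i := Ordinal ln.
have [s [N1 [K1 hpet]]] := pet_pattern C n D.
have [M [L hdeg]] := degree_lowering C p_prime s N K.
do 2 eexists; move=> F charF psi psiP P sP nd f fb fchar.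
have q_gt0 : (0 < #|F|)%N by apply/card_gt0P; exists 0.
pose upd (g : F -> C) j := if j == i then g else f j.
have updb g : bounded1 g -> forall j, bounded1 (upd g j).
  by move=> gb j; rewrite /upd; case: eqP.
pose Kf y x := \prod_(j | j != i) f j (x + (P j - P i).[y]).
have Kb y : bounded1 (Kf y).
  by move=> x; apply: norm_prod_le1 => j; apply: fb.
have updE g : pattern_avg P (upd g) = avg (fun x => g x * avg (fun y => Kf y x)).
  rewrite (pattern_avg_shift P _ i i); apply: eq_avg => x; rewrite -avgMl.
  apply: eq_avg => y; rewrite subrr horner0 addr0 /upd eqxx; congr (_ * _).
  by apply: eq_bigr => j /negbTE->.
have prodE g : \prod_j avg (upd g j) = avg g * \prod_(j | j != i) avg (f j).
  rewrite (bigD1 i)//= /upd eqxx; congr (_ * _).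
  by apply: eq_bigr => j /negbTE->.
have fE : pattern_avg P f = pattern_avg P (upd (f i)).
  apply: eq_avg => x; apply: eq_avg => y; apply: eq_bigr => j _.
  by rewrite /upd; case: eqP => // ->.
have fprodE : \prod_j avg (f j) = \prod_j avg (upd (f i) j).
  by apply: eq_bigr => j _; rewrite /upd; case: eqP => // ->.
have upd_other g j : j != i -> upd g j = f j by rewrite /upd => /negbTE->.
have later (j : 'I_n) : (l <= j)%N -> j != i -> (l < j)%N.
  by rewrite leq_eqVlt => /predU1P[e|//]; case/negP; apply/eqP/val_inj.
have [j1 j1i] : exists j, j != i.
  have [l0|l0] := posnP l; first by exists (Ordinal n1); rewrite -val_eqE/= l0.
  by exists (Ordinal (ltnW n1)); rewrite -val_eqE/= ltn_eqF.
have KS : twisted_small psi N K Kf.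
  move=> hh c cn0.
  pose f2 j z := if j == i then psi (c * z) else
    cross hh (fun l => f j (z + \sum_(g <- l) g)).
  have -> : avg (fun x => avg (fun y =>
      cross hh (fun l => Kf y (x + \sum_(g <- l) g)) * psi (c * x))) =
      pattern_avg P f2 - \prod_j avg (f2 j).
    rewrite (bigD1 i)//= {2}/f2 eqxx (avg_char psiP cn0) mul0r subr0.
    rewrite (pattern_avg_shift P f2 i i); apply: eq_avg => x; apply: eq_avg => y.
    rewrite subrr horner0 addr0 {1}/f2 eqxx mulrC cross_prod; congr (_ * _).
    apply: eq_bigr => j /negbTE ji; rewrite /f2 ji; apply: eq_cross => hs.
    by rewrite addrAC.
  apply: (IH F charF psi psiP) => // [j z|j lj]; rewrite /f2.
    case: eqP => _; first by rewrite (char_norm p_prime charF psiP).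
    by apply: cross_bounded => hs; apply: fb.
  have [_|ji] := eqVneq j i.
    by exists (1, c); split=> [|x]; rewrite ?normr1 ?mul1r.
  have [[a d] /= [a1 fjE]] := fchar j (later j lj ji).
  exists (cross hh (fun hs => a * psi (d * \sum_(g <- hs) g)), altsum hh (fun=> d)).
  split=> /= [|x].
    apply: cross_bounded => hs.
    by rewrite normrM (char_norm p_prime charF psiP) mulr1.
  rewrite -(cross_char p_prime charF psiP) -crossM; apply: eq_cross => hs.
  by rewrite fjE mulrDr addrC (charD psiP) mulrA.
set c0 := avg (fun x => avg (fun y => Kf y x)).
have c01 : `|c0| <= 1 by apply: avg_bounded1 => x; apply: avg_bounded1 => y; apply: Kb.
pose Ft := centered Kf c0.
have Ftb : bounded1 Ft by apply: bounded1_centered.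
have gs : small #|F| M L (gowers s Ft) := hdeg F charF psi psiP Kf Kb KS.
have Ftcb : bounded1 (fun x => (Ft x)^*) by apply: bounded1_conj.
pose X := `|pattern_avg P (upd (fun x => (Ft x)^*))|.
have hX : X ^+ (2 ^ N1) <= K1%:R * (gowers s Ft + #|F|%:R^-1).
  rewrite -gowers_conj; set g := fun x => (Ft x)^*.
  have -> : g = upd g i by rewrite /upd eqxx.
  apply: (hpet F P sP (upd g) i (updb g Ftcb)); first by exists j1.
  by move=> j; apply: nondegenerate_diff nd.
have KfE x : avg (fun y => Kf y x) = 2 * Ft x + c0.
  by rewrite /Ft /centered mulrC divfK ?pnatr_eq0// subrK.
have Ft0 : avg Ft = 0.
  rewrite /Ft /centered avgMr avgB avg_const; last exact: (0 : F).
  by rewrite subrr mul0r.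
have Xs := small_pow (normr_ge0 _) hX
  (smallD q_gt0 (gowers_ge0 s Ft) (invq_ge0 C #|F|) gs (small_invq C #|F|)).
pose A := avg (fun x => `|Ft x|).
have A0 : 0 <= A by apply: avg_ge0.
have hA : A ^+ (2 ^ 1) <= 1%:R * X.
  rewrite mul1r; apply: le_trans (avg_sqr _) _ => //.
  have -> : X = 2 * avg (fun x => `|Ft x| ^+ 2).
    rewrite /X updE -[RHS]ger0_norm; last first.
      by rewrite mulr_ge0//; apply: avg_ge0 => x; rewrite exprn_ge0.
    congr (`|_|); rewrite -[RHS]addr0 -(mulr0 c0) -conjC0 -Ft0 -avg_conj -!avgMl -avgD.
    by apply: eq_avg => x; rewrite KfE normCK; ring.
  by rewrite ler_peMl ?ler1n//; apply: avg_ge0 => x; rewrite exprn_ge0.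
have As := small_pow A0 hA Xs.
pose B := `|pattern_avg P (upd (fun=> 1)) - \prod_j avg (upd (fun=> 1) j)|.
have Bs : small #|F| N K B.
  apply: (IH F charF psi psiP) => // [|j lj]; first by apply: updb => x; rewrite normr1.
  have [ji|ji] := eqVneq j i.
    exists (1, 0); rewrite normr1 /upd ji eqxx; split => // x.
    by rewrite mul0r (char0 psiP) mulr1.
  by rewrite upd_other//; apply: fchar; apply: later.
have AA0 := addr_ge0 A0 A0.
apply: small_le (smallD q_gt0 AA0 (normr_ge0 _) (smallD q_gt0 A0 A0 As As) Bs) => //.
rewrite fE fprodE updE prodE.
have -> : avg (fun x => f i x * avg (fun y => Kf y x)) =
    2 * avg (fun x => f i x * Ft x) + avg (f i) * c0.
  rewrite -avgMl -avgMr -avgD; apply: eq_avg => x; rewrite KfE; ring.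
have BE : B = `|c0 - \prod_(j | j != i) avg (f j)|.
  rewrite /B updE prodE avg_const ?mul1r; last exact: (0 : F).
  by congr (`|_ - _|); apply: eq_avg => x; rewrite mul1r.
rewrite -addrA -mulrBr; apply: le_trans (ler_normD _ _) _; apply: lerD.
  rewrite normrM [ `|2|]ger0_norm// mulr_natl mulr2n.
  suff h : `|avg (fun x => f i x * Ft x)| <= A by apply: lerD.
  apply: le_trans (ler_norm_avg _) _; apply: ler_avg => x.
  by rewrite normrM ler_piMl//; apply: fb.
by rewrite normrM -BE ler_piMl ?normr_ge0// avg_bounded1.
Qed.

Theorem pattern_asymptotics : (1 < n)%N -> exists N K,
  forall (F : finFieldType) (charF : p \in [pchar F]) (psi : F -> C)
    (psiP : frob_char p psi) (P : 'I_n -> {poly F}),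
  (forall j, (size (P j) <= D)%N) -> nondegenerate psi P ->
  forall f : 'I_n -> F -> C, (forall j, bounded1 (f j)) ->
  small #|F| N K `|pattern_avg P f - \prod_j avg (f j)|.
Proof.
move=> n1; have H l : (l <= n)%N -> pattern_estimate l.
  elim: l => [|l IHl] ln; first exact: pattern_estimate0.
  by apply: pattern_estimateS => //; apply: IHl; apply: ltnW.
have [N [K h]] := H n (leqnn n).
exists N, K => F charF psi psiP P sP nd f fb; apply: (h F charF psi psiP) => // j.
by rewrite leqNgt ltn_ord.
Qed.

(** Pairing the error E with itself: E is a bounded function of x, hence may
    be used as the function of index i0, and this makes the L^2 norm of E
    small. Cauchy-Schwarz against the indicator of A then gains the square
    root of its density. *)
Theorem pattern_asymptotics_L2 (i0 : 'I_n) : (1 < n)%N -> exists N K,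
  forall (F : finFieldType) (charF : p \in [pchar F]) (psi : F -> C)
    (psiP : frob_char p psi) (P : 'I_n -> {poly F}),
  (forall j, (size (P j) <= D)%N) -> nondegenerate psi P -> P i0 = 0 ->
  forall (f : 'I_n -> F -> C) (A : pred F), (forall j, bounded1 (f j)) ->
  (forall x, f i0 x = (A x)%:R) ->
  `|pattern_avg P f - \prod_j avg (f j)| ^+ (2 ^ N.+1) <=
    K%:R * (#|A|%:R / #|F|%:R) ^+ (2 ^ N) / #|F|%:R.
Proof.
move=> n1; have [N [K h]] := pattern_asymptotics n1.
exists N, (2 ^ 2 ^ N * K)%N => F charF psi psiP P sP nd P0 f A fb fA.
pose upd (g : F -> C) j := if j == i0 then g else f j.
pose H x := avg (fun y => \prod_(j | j != i0) f j (x + (P j).[y])).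
pose c0 := \prod_(j | j != i0) avg (f j).
pose E x := H x - c0.
have updE g : pattern_avg P (upd g) - \prod_j avg (upd g j) = avg (fun x => g x * E x).
  have -> : \prod_j avg (upd g j) = avg g * c0.
    rewrite (bigD1 i0)//= /upd eqxx; congr (_ * _).
    by apply: eq_bigr => j /negbTE->.
  rewrite (pattern_avg_shift P _ i0 i0) -avgMr -avgB; apply: eq_avg => x.
  rewrite mulrBr -avgMl; congr (_ - _); apply: eq_avg => y.
  rewrite subrr horner0 addr0 /upd eqxx; congr (_ * _).
  by apply: eq_bigr => j /negbTE->; rewrite P0 subr0.
have E2 x : `|E x| <= 2.
  rewrite (le_trans (ler_normB _ _))// -[2]/(1 + 1) lerD//.
    by apply: avg_bounded1 => y; apply: norm_prod_le1 => j; apply: fb.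
  by apply: norm_prod_le1 => j; apply: avg_bounded1; apply: fb.
pose g x := (E x)^* / 2.
have gb j : bounded1 (upd g j).
  rewrite /upd; case: eqP => // _ x; rewrite /g normrM norm_conjC normfV.
  by rewrite [ `|2|]ger0_norm// ler_pdivrMr// mul1r.
pose Y := avg (fun x => `|E x| ^+ 2).
have Y0 : 0 <= Y by apply: avg_ge0 => x; rewrite exprn_ge0.
have hY : Y ^+ (2 ^ N) <= (2 ^ 2 ^ N)%:R * (K%:R / #|F|%:R).
  have := h F charF psi psiP P sP nd (upd g) gb; rewrite updE /small.
  have -> : avg (fun x => g x * E x) = Y / 2.
    by rewrite -avgMr; apply: eq_avg => x; rewrite /g normCK mulrAC [E x * _]mulrC.
  have Y20 : 0 <= Y / 2 by rewrite divr_ge0.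
  rewrite (ger0_norm Y20) exprMn exprVn => hY.
  by rewrite natrX mulrC -ler_pdivrMr ?exprn_gt0.
have -> : pattern_avg P f - \prod_j avg (f j) = avg (fun x => (A x)%:R * E x).
  rewrite -updE; congr (_ - _).
    apply: eq_avg => x; apply: eq_avg => y; apply: eq_bigr => j _.
    by rewrite /upd; case: eqP => // ->; rewrite fA.
  apply: eq_bigr => j _; rewrite /upd; case: eqP => // ->.
  by apply: eq_avg => x; rewrite fA.
have q_gt0 : (0 : C) < #|F|%:R by rewrite ltr0n; apply/card_gt0P; exists 0.
have X2 : `|avg (fun x => (A x)%:R * E x)| ^+ 2 <= #|A|%:R / #|F|%:R * Y.
  apply: (@le_trans _ _ (((\sum_(x | A x) `|E x|) / #|F|%:R) ^+ 2)).
    rewrite lerXn2r ?nnegrE ?divr_ge0 ?sumr_ge0//.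
    apply: le_trans (ler_norm_avg _) _; rewrite ler_wpM2r ?invr_ge0//.
    rewrite [leRHS]big_mkcond/=; apply: ler_sum => x _.
    by case: (A x); rewrite ?mul1r ?mul0r ?normr0.
  rewrite exprMn exprVn /Y /avg mulrACA -invfM -expr2 ler_wpM2r ?invr_ge0 ?exprn_ge0//.
  apply: le_trans (sum_sqr_le A (fun x => normr_ge0 (E x))) _.
  rewrite ler_wpM2l// [leRHS](bigID A)/= lerDl.
  by apply: sumr_ge0 => x _; rewrite exprn_ge0.
have Aq0 : 0 <= #|A|%:R / #|F|%:R :> C by rewrite divr_ge0.
have AY0 := mulr_ge0 Aq0 Y0.
rewrite expr_2S; apply: le_trans (lerXn2r _ _ _ X2) _; rewrite ?nnegrE ?exprn_ge0//.
rewrite exprMn natrM; apply: le_trans (ler_wpM2l (exprn_ge0 _ Aq0) hY) _.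
rewrite le_eqVlt; apply/orP; left; apply/eqP; ring.
Qed.

End Asymptotics.

(** * The annihilator of a polynomial curve *)

Section Diagonal.
Variables (I : Type) (K : zmodType) (H : (I -> nat -> K) -> Prop).
Hypothesis H0 : H (fun _ _ => 0).
Hypothesis HD : forall x y, H x -> H y -> H (fun i j => x i j + y i j).
Hypothesis Hclosed : forall x, (forall M : nat, exists y, H y /\
  forall i j, (j < M)%N -> y i j = x i j) -> H x.
Hypothesis Hsmall : forall N : nat, exists h, [/\ H h,
  forall i j, (j < N)%N -> h i j = 0 & exists i j, h i j != 0].

(** A diagonal argument. The element x is an infinite sum of smaller and
    smaller elements of H; at stage k an element is added exactly if the
    partial sum agrees with r k at the place [pos (nn k)], where that element
    is nonzero and which later stages do not touch. *)
Lemma closed_group_uncountable (r : nat -> I -> nat -> K) :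
  exists x, H x /\ forall k, exists i j, x i j != r k i j.
Proof.
have [h hP] := choice Hsmall.
have /choice[pos posP] : forall N : nat, exists ij : I * nat, h N ij.1 ij.2 != 0.
  by move=> N; have [_ _ [i [j hij]]] := hP N; exists (i, j).
have posN N : (N <= (pos N).2)%N.
  rewrite leqNgt; apply/negP => lt; have [_ h0 _] := hP N.
  by have := posP N; rewrite h0// eqxx.
pose nn := fix nn k := if k is k'.+1 then (pos (nn k')).2.+1 else 0%N.
have nnS k : nn k.+1 = (pos (nn k)).2.+1 by [].
pose S := fix S k := if k is k'.+1 then
  let: (i, j) := pos (nn k') in
  if S k' i j == r k' i j then (fun i j => S k' i j + h (nn k') i j) else S k'
  else fun _ _ => 0.
have SS k : S k.+1 = let: (i, j) := pos (nn k) in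
  if S k i j == r k i j then (fun i j => S k i j + h (nn k) i j) else S k by [].
have HS k : H (S k).
  elim: k => [|k IHk]; first exact: H0.
  rewrite SS; case: (pos (nn k)) => i j; case: eqP => _ //.
  by apply: HD => //; have [] := hP (nn k).
have nn_le k : (k <= nn k)%N.
  by elim: k => // k IHk; rewrite nnS ltnS (leq_trans IHk).
have Sstep k i j : (j < nn k)%N -> S k.+1 i j = S k i j.
  move=> jk; rewrite SS; case: (pos (nn k)) => i' j'; case: eqP => _ //.
  by have [_ h0 _] := hP (nn k); rewrite h0// addr0.
have nn_mono k l : (k <= l)%N -> (nn k <= nn l)%N.
  move=> /subnK <-; elim: (l - k)%N => // d IHd; rewrite addSn nnS.
  by rewrite (leq_trans IHd)// (leq_trans (posN _)).
have Sstable k l i j : (k <= l)%N -> (j < nn k)%N -> S l i j = S k i j.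
  move=> /subnK <- jk; elim: (l - k)%N => // d IHd.
  by rewrite addSn Sstep// (leq_trans jk)// nn_mono// leq_addl.
exists (fun i j => S j.+1 i j); split.
  apply: Hclosed => M; exists (S M); split => // i j jM.
  by apply: Sstable => //; rewrite nn_le.
move=> k; exists (pos (nn k)).1, (pos (nn k)).2.
set i := (_).1; set j := (_).2.
have -> : S j.+1 i j = S k.+1 i j.
  have jk1 : (j < nn k.+1)%N by rewrite nnS.
  have [jk|kj] := leqP j.+1 k.+1; last exact: Sstable (ltnW kj) jk1.
  by apply/esym; apply: Sstable => //; rewrite nn_le.
rewrite SS (surjective_pairing (pos (nn k))) -/i -/j.
case: ifP => [/eqP e|/negbT//]; rewrite e -subr_eq0 addrAC subrr add0r.
exact: posP.
Qed.

End Diagonal.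

Lemma pigeonhole_prefix (I K : finType) (g : nat -> I -> nat -> K) (N : nat) :
  exists k l, k != l /\ forall i j, (j < N)%N -> g k i j = g l i j.
Proof.
pose T := {ffun I * 'I_N -> K}.
pose f (k : 'I_(#|T|.+1)) : T := [ffun ij : I * 'I_N => g k ij.1 ij.2].
have /injectivePn[k [l kl fkl]] : ~~ injectiveb f.
  by apply/negP => /injectiveP/leq_card; rewrite card_ord ltnn.
exists (k : nat), (l : nat); split => // i j jN.
by have /ffunP/(_ (i, Ordinal jN)) := fkl; rewrite !ffunE.
Qed.

Section Evaluation.
Variable p : nat.
Implicit Types (v w : {poly 'F_p}).

(** The coefficient of t^-1 in v * x, where x = sum_j x_j t^(-1-j). Every
    additive map 'F_p[t] -> 'F_p is the pairing with some x. *)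
Definition residue v (x : nat -> 'F_p) : 'F_p := \sum_(l < size v) v`_l * x l.

Lemma residueE n v x : (size v <= n)%N -> residue v x = \sum_(l < n) v`_l * x l.
Proof.
move=> vn; rewrite /residue (big_ord_widen_cond n predT (fun l => v`_l * x l))//=.
rewrite [in RHS](bigID (fun l : 'I_n => (l < size v)%N))/=.
rewrite [X in _ = _ + X]big1 ?addr0// => l; rewrite -leqNgt => vl.
by rewrite nth_default ?mul0r.
Qed.

Lemma residueDl v w x : residue (v + w) x = residue v x + residue w x.
Proof.
rewrite !(@residueE (maxn (size v) (size w))) ?leq_maxl ?leq_maxr ?size_polyD//.
by rewrite -big_split; apply: eq_bigr => l _; rewrite coefD mulrDl.
Qed.

Lemma residueDr v x y : residue v (fun j => x j + y j) = residue v x + residue v y.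
Proof. by rewrite /residue -big_split; apply: eq_bigr => l _; rewrite mulrDr. Qed.

Lemma residueN v x : residue v (fun j => - x j) = - residue v x.
Proof. by rewrite /residue -sumrN; apply: eq_bigr => l _; rewrite mulrN. Qed.

Lemma residueX j x : residue 'X^j x = x j.
Proof.
rewrite /residue size_polyXn big_ord_recr/= coefXn eqxx mul1r big1 ?add0r// => l _.
by rewrite coefXn ltn_eqF ?mul0r.
Qed.

Lemma eq_residue v x y : (forall j, (j < size v)%N -> x j = y j) -> residue v x = residue v y.
Proof. by move=> xy; apply: eq_bigr => l _; rewrite xy. Qed.

Lemma irredp_coprime (Q Q' : {poly 'F_p}) :
  irreducible_poly Q -> irreducible_poly Q' -> size Q != size Q' -> coprimep Q Q'.
Proof.
move=> irQ irQ' sQ; rewrite irreducible_poly_coprime//; apply/negP => QQ'.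
case/negP: sQ; apply/eqP; apply: eqp_size; apply: irQ'.2 => //.
by case: irQ => sQ1 _; rewrite neq_ltn sQ1 orbT.
Qed.

Variables (m : nat) (P : 'I_m -> {poly {poly 'F_p}}).

(** The characters of 'F_p[t]^m that are constant along the curve n |->
    (P_i(n))_i. *)
Definition curve_annihilator (x : 'I_m -> nat -> 'F_p) := forall n,
  \sum_i residue (P i).[n] (x i) = \sum_i residue (P i).[0] (x i).

Lemma annihilator0 : curve_annihilator (fun _ _ => 0).
Proof.
have r0 v : residue v (fun=> 0) = 0 by rewrite /residue big1// => l _; rewrite mulr0.
by move=> n; rewrite !big1.
Qed.

Lemma annihilatorD (x y : 'I_m -> nat -> 'F_p) : curve_annihilator x -> curve_annihilator y ->
  curve_annihilator (fun i j => x i j + y i j).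
Proof.
move=> hx hy n; under eq_bigr => i _ do rewrite residueDr.
under [RHS]eq_bigr => i _ do rewrite residueDr.
by rewrite !big_split/= hx hy.
Qed.

Lemma annihilatorN (x : 'I_m -> nat -> 'F_p) : curve_annihilator x -> curve_annihilator (fun i j => - x i j).
Proof.
move=> hx n; under eq_bigr => i _ do rewrite residueN.
under [RHS]eq_bigr => i _ do rewrite residueN.
by rewrite !sumrN hx.
Qed.

(** Each of the equations involves only finitely many digits of x. *)
Lemma annihilator_closed (x : 'I_m -> nat -> 'F_p) : (forall M : nat, exists y, curve_annihilator y /\
  forall i j, (j < M)%N -> y i j = x i j) -> curve_annihilator x.
Proof.
move=> h n.
pose M := \max_i maxn (size (P i).[n]) (size (P i).[0]).
have [y [hy yx]] := h M.
have e (v : 'I_m -> {poly 'F_p}) : (forall i, (size (v i) <= M)%N) ->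
    \sum_i residue (v i) (x i) = \sum_i residue (v i) (y i).
  by move=> vM; apply: eq_bigr => i _; apply: eq_residue => j jv; rewrite yx// (leq_trans jv).
have Mge i : (maxn (size (P i).[n]) (size (P i).[0]) <= M)%N.
  exact: (leq_bigmax (F := fun i => maxn (size (P i).[n]) (size (P i).[0]))).
rewrite !e => [|i|i]; first exact: hy.
  by rewrite (leq_trans _ (Mge i))// leq_maxr.
by rewrite (leq_trans _ (Mge i))// leq_maxl.
Qed.

(** Two nonzero elements that are killed by primes Q of different degrees are
    distinct, for otherwise they would be killed by 1. By pigeonhole two of
    infinitely many agree in their first N digits, and their difference is
    small. *)
Lemma annihilator_small : (forall k0 : nat, exists (Q : {poly 'F_p}) x,
    [/\ irreducible_poly Q, (k0 < size Q)%N, curve_annihilator x,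
        forall i v, residue (v * Q) (x i) = 0 & exists i j, x i j != 0]) ->
  forall N : nat, exists h, [/\ curve_annihilator h,
    forall i j, (j < N)%N -> h i j = 0 & exists i j, h i j != 0].
Proof.
move=> bad N.
have /choice[g gP] : forall k0 : nat, exists Qx : {poly 'F_p} * ('I_m -> nat -> 'F_p),
   [/\ irreducible_poly Qx.1, (k0 < size Qx.1)%N, curve_annihilator Qx.2,
        forall i v, residue (v * Qx.1) (Qx.2 i) = 0 & exists i j, Qx.2 i j != 0].
  by move=> k0; have [Q [x h]] := bad k0; exists (Q, x).
pose s := fix s k := if k is k'.+1 then size (g (s k')).1 else 0%N.
have sS k : (s k < s k.+1)%N by case: (gP (s k)).
have smono k l : (k < l)%N -> (s k < s l)%N.
  move=> /subnK <-; elim: (l - k.+1)%N => [|d IHd]; first exact: sS.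
  by rewrite addSn (ltn_trans IHd).
have [k [l [kl xkl]]] := pigeonhole_prefix (fun k => (g (s k)).2) N.
have [irQk _ hk Qk [i0 [j0 ij0]]] := gP (s k).
have [irQl _ hl Ql _] := gP (s l).
exists (fun i j => (g (s k)).2 i j + - (g (s l)).2 i j); split.
- by apply: annihilatorD => //; apply: annihilatorN.
- by move=> i j jN; rewrite xkl// subrr.
apply: contrapT => /forallNP h.
have e i j : (g (s k)).2 i j = (g (s l)).2 i j.
  apply/eqP; rewrite -subr_eq0; apply/negPn/negP => ne.
  by apply: (h i); exists j.
have : coprimep (g (s k)).1 (g (s l)).1.
  apply: irredp_coprime => //; rewrite -[size _]/(s k.+1) -[X in _ != X]/(s l.+1).
  by move: kl; rewrite !neq_ltn => /orP[] lt; rewrite (smono _.+1 _.+1 lt) ?orbT.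
case/Bezout_eq1_coprimepP => -[u u'] /= uu'.
case/negP: ij0; apply/eqP; rewrite -residueX -['X^j0]mulr1 -uu' mulrDr !mulrA residueDl Qk add0r.
by rewrite (eq_residue (y := (g (s l)).2 i0)) ?Ql.
Qed.

End Evaluation.

(** * Equidistribution makes annihilators rational *)

Section FractionalLaurent.
Local Open Scope quotient_scope.
Local Open Scope classical_set_scope.
Variable p : nat.

Definition frac_laurent_coef (x : nat -> 'F_p) (j : int) : 'F_p :=
  if j is Negz n then x n else 0.

Lemma frac_laurent_subproof x : frac_laurent_coef x \in @laurent_pred p.
Proof. by apply/asboolP; exists 0 => -[]. Qed.

Definition frac_laurent x : laurent p := Laurent (frac_laurent_subproof x).

Lemma scale_frac_laurent (v : {poly 'F_p}) x :
  (v *: frac_laurent x) (Negz 0) = residue v x.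
Proof.
apply: eq_bigr => i _; congr (_ * _).
by rewrite (_ : Negz 0 - i%:Z = Negz i)//; lia.
Qed.

Lemma lcoef_sum (I : Type) (r : seq I) (Q : pred I) (f : I -> laurent p) j :
  (\sum_(i <- r | Q i) f i : laurent p) j = \sum_(i <- r | Q i) f i j.
Proof. by apply: (big_morph (fun x : laurent p => x j)). Qed.

(** The leading digit of x is multiplied by the leading coefficient of v. *)
Lemma frac_laurent_torsion_free (v : {poly 'F_p}) x :
  v != 0 -> v *: frac_laurent x = 0 -> forall j, x j = 0.
Proof.
move=> v0 vx j; apply/eqP; apply: contrapT => /negP xj.
have exj : exists j, x j != 0 by exists j.
case: (ex_minnP exj) => j0 xj0 jmin.
have small k : (0 < k)%N -> frac_laurent x (Negz j0 + k%:Z) = 0.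
  move=> k0; rewrite /= /frac_laurent_coef; case E: (Negz j0 + k%:Z) => [//|a].
  apply/eqP; apply: contrapT => /negP /jmin; apply/negP; rewrite -ltnNge.
  by move: E; rewrite !NegzE; lia.
have sv : size v = (size v).-1.+1 by rewrite prednK// size_poly_gt0.
have : (v *: frac_laurent x) (Negz j0 + ((size v).-1)%:Z) = 0 by rewrite vx.
rewrite [LHS](@lscaleE _ (size v).-1.+1); last by rewrite -sv.
rewrite big_ord_recr big1 => [|i _]; last first.
  rewrite (_ : _ - i%:Z = Negz j0 + ((size v).-1 - i)%N%:Z).
    by rewrite [X in _ * X]small ?mulr0// subn_gt0.
  by have := ltn_ord i; lia.
rewrite Monoid.mul1m addrK => /eqP; rewrite mulf_eq0 => /orP[|].
  by rewrite -/(lead_coef v) lead_coef_eq0 (negbTE v0).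
by rewrite /= (negbTE xj0).
Qed.

(** The fraction w / v determines x; therefore rational points are countable. *)
Lemma rational_unique (v w : {poly 'F_p}) x y : v != 0 ->
  v *: frac_laurent x = laurent_of_poly w -> v *: frac_laurent y = laurent_of_poly w ->
  x =1 y.
Proof.
move=> v0 vx vy j; apply/eqP; rewrite -subr_eq0; apply/eqP.
apply: (frac_laurent_torsion_free (x := fun j => x j - y j) v0).
rewrite (_ : frac_laurent _ = frac_laurent x - frac_laurent y).
  by rewrite scalerBr vx vy subrr.
by apply/laurent_eqP => -[i|i]; rewrite lcoefB//= subrr.
Qed.

End FractionalLaurent.

Section Equidistribution.
Local Open Scope quotient_scope.
Local Open Scope classical_set_scope.
Variables (R : realType) (p : nat).
Hypothesis p_prime : prime p.

Lemma measurable_cyl (s : seq 'F_p) : measurable (cyl s : set (borel_torus p)).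
Proof. by apply: sub_sigma_algebra; exact: cyl_open. Qed.

(** A coset of a clopen subgroup of index p cannot have full measure: it has
    a disjoint translate, of the same measure. *)
Lemma haar_cyl1 (c : 'F_p) : haar R p (cyl [:: c]) != 1%E.
Proof.
apply/negP => /eqP h1.
pose one : torus p := \pi_(torus p) (frac_laurent (fun=> 1)).
have one0 : frac_coef one 0 = 1 by rewrite frac_coef_pi.
have E : (fun y => one + y) @` cyl [:: c] = cyl [:: 1 + c].
  apply/seteqP; split => [_ [y yc <-]|y yc].
    by move=> [|//] _; rewrite frac_coefD one0 (yc 0%N).
  exists (y - one); last by rewrite addrCA subrr addr0.
  move=> [|//] _; rewrite frac_coefD frac_coefN one0 (yc 0%N)//=.
  by rewrite addrAC subrr add0r.
have h2 : haar R p (cyl [:: 1 + c]) = 1%E.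
  by rewrite -E haarP//; exact: measurable_cyl.
have dis : cyl [:: c] `&` cyl [:: 1 + c] = set0.
  apply/seteqP; split => // y [/(_ 0%N (ltn0Sn _)) /= e1 /(_ 0%N (ltn0Sn _)) /=].
  rewrite e1 => /eqP; rewrite -subr_eq0 opprD addrCA subrr addr0 oppr_eq0.
  by rewrite (negbTE (oner_neq0 _)).
have [m1 m2] := (measurable_cyl [:: c], measurable_cyl [:: 1 + c]).
set A := cyl [:: c] in h1 m1 dis *; set B := cyl _ in h2 m2 dis *.
have : (haar R p A + haar R p B <= 1)%E.
  by rewrite -measureU//; apply: probability_le1; apply: measurableU.
rewrite h1 h2 -EFinD lee_fin -subr_ge0 opprD addrA subrr add0r oppr_ge0.
by rewrite ler10.
Qed.

Definition poly_box (N : nat) : {fset {poly 'F_p}} :=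
  [fset v in [seq Poly (tval t) | t <- enum {: N.-tuple 'F_p}]]%fset.

Lemma in_poly_box N v : (v \in poly_box N) = (size v <= N)%N.
Proof.
rewrite !inE; apply/mapP/idP => [[t _ ->]|vN].
  by rewrite (leq_trans (size_Poly _))// size_tuple.
have sz : size (mkseq (fun i => v`_i) N) == N by rewrite size_mkseq.
exists (Tuple sz); first by rewrite mem_enum.
apply/polyP => i; rewrite coef_Poly /=; have [iN|Ni] := ltnP i N.
  by rewrite nth_mkseq.
by rewrite !nth_default ?size_mkseq// (leq_trans vN).
Qed.

(** A box is a group that contains n as soon as N is large. *)
Lemma folner_poly_box : folner R poly_box.
Proof.
split=> [N|n].
  by apply/fset0Pn; exists 0; rewrite in_poly_box size_poly0.
move=> shift; apply: cvg_near_cst; exists (size n) => // N /= nN.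
have -> : shift N = poly_box N.
  apply/fsetP => v; apply/imfsetP/idP => /= [[w]|vN].
    rewrite !in_poly_box => wN ->; rewrite (leq_trans (size_polyD _ _))//.
    by rewrite geq_max wN.
  exists (v - n); last by rewrite subrK.
  rewrite !in_poly_box in vN *; rewrite (leq_trans (size_polyD _ _))//.
  by rewrite size_polyN geq_max vN.
by rewrite fsetDv fsetU0 cardfs0 mul0r.
Qed.

(** The test function is the indicator of the cylinder in which the
    coefficient of t^-1 is c: it is locally constant, and its averages are 1
    while its integral is not. *)
Lemma not_well_distributed (a : {poly 'F_p} -> laurent p) (c : 'F_p) :
  (forall n, a n (Negz 0) = c) -> ~ well_distributed R a.
Proof.
move=> ac wd.
pose f (x : torus p) : R[i] := (frac_coef x 0 == c)%:R.
have fc : continuous (f : torus p -> (R[i])^o).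
  move=> x; apply: (@cvg_near_cst _ (R[i])^o _ f (nbhs x) (nbhs_filter x)).
  have hx : nbhs x (cyl [:: frac_coef x 0]).
    apply: open_nbhs_nbhs; split; first exact: cyl_open.
    by move=> [|].
  by apply: filterS hx => y /(_ 0%N (ltn0Sn _)) /= e; rewrite /f e.
have lim1 := wd f fc _ folner_poly_box.
have avg1 N : (#|` poly_box N|%:R)^-1 * \sum_(n <- poly_box N) f (\pi_(torus p) (a n)) = 1 :> R[i].
  rewrite big_seq (eq_bigr (fun=> 1)) => [|n _]; last by rewrite /f frac_coef_pi ac eqxx.
  rewrite -big_seq big_const_seq count_predT iter_addr_0 mulVf// pnatr_eq0.
  rewrite -lt0n cardfs_gt0; exact: (folner_poly_box.1 N).
have i1 : (haar_integral f : (R[i])^o) = 1.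
  apply: (@cvg_unique (R[i])^o (@norm_hausdorff _ _) _ _ _ _ lim1).
  by apply: cvg_near_cst; apply: nearW => N; exact: avg1.
have := congr1 (@complex.Re R) i1; rewrite /= /Rintegral.
have -> : (\int[haar R p]_x (complex.Re (f x))%:E = haar R p (cyl [:: c]))%E.
  have II := integral_indic (haar R p) measurableT (measurable_cyl [:: c]).
  rewrite setIT in II; rewrite -II.
  apply: eq_integral => x _; congr (_%:E)%E; rewrite indicE /f.
  have -> : (x \in (cyl [:: c])) = (frac_coef x 0 == c).
    apply/idP/eqP; rewrite in_setE; first by move=> /(_ 0%N (ltn0Sn _)).
    by move=> xc [|].
  by case: (_ == _).
move=> h; move/negP: (haar_cyl1 c); apply; apply/eqP.
by rewrite -[LHS]fineK ?h// fin_num_measure//; exact: measurable_cyl.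
Qed.

Variables (m : nat) (P : 'I_m -> {poly {poly 'F_p}}).
Hypothesis P_good : good_for_irrational_equidistribution R (fun i n => (P i).[n]).

Lemma annihilator_rational x : curve_annihilator P x ->
  forall i, is_rational (frac_laurent (x i)).
Proof.
move=> hx; apply: contrapT => /(P_good (alpha := fun i => frac_laurent (x i))).
apply: (@not_well_distributed _ (\sum_i residue (P i).[0] (x i))) => n.
rewrite lcoef_sum -(hx n); apply: eq_bigr => i _; exact: scale_frac_laurent.
Qed.

(** Otherwise [annihilator_small] would make the annihilator uncountable; but
    its elements are rational, so they are determined by their numerators and
    denominators. *)
Lemma annihilator_prime : exists k0 : nat, forall (Q : {poly 'F_p}) x,
  irreducible_poly Q -> (k0 < size Q)%N -> curve_annihilator P x ->
  (forall i v, residue (v * Q) (x i) = 0) -> forall i j, x i j = 0.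
Proof.
apply: contrapT => /forallNP bad.
have small := annihilator_small (P := P).
have {}/small small : forall k0 : nat, exists (Q : {poly 'F_p}) x,
    [/\ irreducible_poly Q, (k0 < size Q)%N, curve_annihilator P x,
        forall i v, residue (v * Q) (x i) = 0 & exists i j, x i j != 0].
  move=> k0; have := bad k0 => /existsNP[Q /existsNP[x]].
  move=> /not_implyP[irQ] /not_implyP[k0Q] /not_implyP[hx] /not_implyP[Qx].
  move=> /existsNP[i /existsNP[j /eqP xij]].
  by exists Q, x; split => //; exists i, j.
pose fracs (T : {ffun 'I_m -> {poly 'F_p} * {poly 'F_p}}) (x : 'I_m -> nat -> 'F_p) :=
  forall i, (T i).2 != 0 /\ (T i).2 *: frac_laurent (x i) = laurent_of_poly (T i).1.
(* The sequence r contains every element that is represented by fractions;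
   the 0 is a junk value for codes without such an element. *)
have /choice[r rP] : forall k : nat, exists x : 'I_m -> nat -> 'F_p,
    forall T y, choice.unpickle k = Some T -> fracs T y -> fracs T x.
  move=> k; case: (choice.unpickle k) => [T|]; last by exists (fun _ _ => 0).
  have [[x hx]|nx] := pselect (exists x, fracs T x).
    by exists x => T' y [<-].
  by exists (fun _ _ => 0) => T' y [<-] hy; exfalso; apply: nx; exists y.
have [x [hx xr]] := closed_group_uncountable (annihilator0 P) (@annihilatorD _ _ P)
  (@annihilator_closed _ _ P) small r.
have /fin_all_exists[T hT] : forall i, exists Ti : {poly 'F_p} * {poly 'F_p},
    Ti.2 != 0 /\ Ti.2 *: frac_laurent (x i) = laurent_of_poly Ti.1.
  by move=> i; have [w [v [v0 vx]]] := annihilator_rational hx i; exists (w, v).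
have hfx : fracs [ffun i => T i] x by move=> i; rewrite ffunE.
have hfr := rP (choice.pickle [ffun i => T i]) _ _ (choice.pickleK _) hfx.
have [i [j /eqP]] := xr (choice.pickle [ffun i => T i]); apply.
have [v0 vx] := hfx i; have [_ vr] := hfr i.
exact: (rational_unique v0 vx vr).
Qed.

End Equidistribution.

(** * Residue fields and their characters *)

Section Trace.
Variables (p : nat) (F : finFieldType) (k : nat).
Hypotheses (p_prime : prime p) (charF : p \in [pchar F]).
Hypotheses (cardF : #|F| = (p ^ k)%N) (k_gt0 : (0 < k)%N).

Definition trace (z : F) : F := \sum_(i < k) z ^+ (p ^ i).

Lemma traceD x y : trace (x + y) = trace x + trace y.
Proof.
rewrite /trace -big_split; apply: eq_bigr => i _.
elim: (i : nat) x y => [|j IHj] x y; first by rewrite !expr1.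
by rewrite expnS !exprM -IHj -!(pFrobenius_autE charF) pFrobenius_autD_comm//; apply: mulrC.
Qed.

Lemma trace_frob z : trace (z ^+ p) = trace z.
Proof.
have [k' kE] : exists k', k = k'.+1 by exists k.-1; rewrite prednK.
rewrite /trace kE big_ord_recr [RHS]big_ord_recl /= addrC; congr (_ + _).
  by rewrite -exprM -expnS -kE -cardF expf_card expr1.
by apply: eq_bigr => i _; rewrite -exprM -expnS.
Qed.

(** As a polynomial the trace has degree p ^ k.-1, which is less than the
    number of points. *)
Lemma trace_neq0 : exists z, trace z != 0.
Proof.
pose T : {poly F} := \sum_(i < k) 'X^(p ^ i).
have TE z : T.[z] = trace z.
  by rewrite horner_sum; apply: eq_bigr => i _; rewrite hornerXn.
have [p0 p1] := (prime_gt0 p_prime, prime_gt1 p_prime).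
have T0 : T != 0.
  apply/eqP => /polyP/(_ 1%N)/eqP; rewrite coef0 coef_sum.
  rewrite (bigD1 (Ordinal k_gt0))//= expn0 coefXn eqxx big1 ?addr0 ?oner_eq0// => i i0.
  rewrite coefXn -[1%N](expn0 p) eqn_exp2l// eq_sym.
  by rewrite (negbTE (_ : (i : nat) != 0%N)).
have sT : (size T <= (p ^ k.-1).+1)%N.
  rewrite (leq_trans (size_sum _ _ _))//; apply/bigmax_leqP => i _.
  by rewrite size_polyXn ltnS leq_pexp2l// -ltnS prednK.
apply/existsP; rewrite -[X in is_true X]negbK negb_exists; apply/negP => /forallP h.
have : (size (enum F) < size T)%N.
  apply: max_poly_roots T0 _ (enum_uniq _).
  by apply/allP => z _; rewrite /root TE; have := h z; rewrite negbK.
rewrite -cardE cardF => /leq_trans/(_ sT); rewrite ltnS leqNgt => /negP; apply.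
by rewrite ltn_exp2l// prednK.
Qed.

End Trace.

Section ResidueField.
Variables (p : nat) (Q : {poly 'F_p}) (hQ : monic_irreducible_poly Q).
Hypothesis p_prime : prime p.
Local Notation Fq := {poly %/ Q with hQ}.
Local Notation red := (in_qpoly Q : {poly 'F_p} -> Fq).

Lemma pcharFq : p \in [pchar Fq].
Proof. by rewrite (pchar_lalg Fq) pchar_Fp. Qed.

Lemma cardFq : #|Fq| = (p ^ (size Q).-1)%N.
Proof. by rewrite card_qfpoly card_Fp. Qed.

Lemma sizeQ_gt1 : (1 < size Q)%N.
Proof. by case: hQ => -[]. Qed.

Lemma red_surj (z : Fq) : exists v, z = red v.
Proof.
exists (z : {poly 'F_p}); apply/esym/val_inj.
by apply: in_qpoly_small; exact: size_mk_monic.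
Qed.

(** Any coordinate of a multiple of the trace is additive and invariant under
    Frobenius; dividing the trace by its value at z0 makes the constant
    coefficient equal to 1 at z0. *)
Lemma frob_functional : exists lam : Fq -> 'F_p,
  [/\ {morph lam : x y / x + y}, forall x, lam (x ^+ p) = lam x & exists x, lam x != 0].
Proof.
have k0 : (0 < (size Q).-1)%N by have := sizeQ_gt1; case: (size Q) => [|[]].
have [z0 hz0] := trace_neq0 p_prime cardFq k0.
pose lam0 (z : Fq) : 'F_p := (z : {poly 'F_p})`_0.
exists (fun z => lam0 ((trace p (size Q).-1 z0)^-1 * trace p (size Q).-1 z)); split.
- move=> x y; rewrite (traceD _ pcharFq) mulrDr /lam0.
  exact: coefD.
- by move=> x; rewrite (trace_frob cardFq k0).
- by exists z0; rewrite mulVf// /lam0 coefC eqxx oner_neq0.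
Qed.

(** The digits of an additive functional are its values at the powers of t. *)
Lemma functional_red (lam : Fq -> 'F_p) (c : Fq) v : {morph lam : x y / x + y} ->
  lam (c * red v) = residue v (fun j => lam (c * red 'X^j)).
Proof.
move=> lamD; have lam0 : lam 0 = 0.
  by apply: (addrI (lam 0)); rewrite -lamD !addr0.
have lamZ a (z : Fq) : lam (a *: z) = a * lam z.
  have lamn n : lam (z *+ n) = lam z *+ n.
    by elim: n => [|n IHn]; rewrite ?mulr0n// !mulrS lamD IHn.
  by rewrite -(natr_Zp a) scaler_nat lamn mulr_natl.
rewrite -{1}[v]coefK poly_def /residue.
have -> : red (\sum_(i < size v) v`_i *: 'X^i) = \sum_(i < size v) v`_i *: red 'X^i.
  by rewrite linear_sum; apply: eq_bigr => i _; rewrite linearZ.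
rewrite mulr_sumr (big_morph lam lamD lam0); apply: eq_bigr => i _.
by rewrite -scalerAr lamZ.
Qed.

Lemma eval_mod_red (P : {poly {poly 'F_p}}) n :
  eval_mod P (red n) = red P.[n].
Proof. exact: (horner_map (in_qpoly Q)). Qed.

Section Character.
Variables (zeta : algC) (zetaP : p.-primitive_root zeta) (lam : Fq -> 'F_p).
Hypotheses (lamD : {morph lam : x y / x + y}).
Hypotheses (lamF : forall x, lam (x ^+ p) = lam x) (lam_neq0 : exists x, lam x != 0).

Definition expchar (z : Fq) : algC := zeta ^+ (lam z).

Lemma expcharE x y : (expchar x == expchar y) = (lam x == lam y).
Proof.
rewrite /expchar (eq_prim_root_expr zetaP) !modn_small//.
  by rewrite -{2}(Fp_cast p_prime) ltn_ord.
by rewrite -{2}(Fp_cast p_prime) ltn_ord.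
Qed.

Lemma expchar_frob_char : frob_char p expchar.
Proof.
have lam0 : lam 0 = 0 by apply: (addrI (lam 0)); rewrite -lamD !addr0.
have e0 : expchar 0 = 1 by rewrite /expchar lam0.
split=> // [x y||x].
- rewrite /expchar lamD -exprD /= -[RHS](expr_mod _ (prim_expr_order zetaP)).
  by congr (_ ^+ (_ %% _)%N); exact: Fp_cast.
- by have [x lx] := lam_neq0; exists x; rewrite -e0 expcharE lam0.
- by rewrite /expchar lamF.
Qed.

Variables (m : nat) (P : 'I_m -> {poly {poly 'F_p}}).

(** The index ord0 stands for the entry x of the pattern. *)
Definition pattern_poly (j : 'I_m.+1) : {poly Fq} :=
  if unlift ord0 j is Some i then map_poly red (P i) else 0.

Lemma pattern_poly0 : pattern_poly ord0 = 0.
Proof. by rewrite /pattern_poly unlift_none. Qed.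

Lemma pattern_polyS i : pattern_poly (lift ord0 i) = map_poly red (P i).
Proof. by rewrite /pattern_poly liftK. Qed.

(** If psi o sum_j c_j P_j is constant on the field, then so is its exponent
    lam o sum_j c_j P_j, and v_i |-> lam (c_i v_i mod Q) is an element of the
    annihilator that is killed by Q. By hypothesis it is 0, so that c_i = 0
    for all i other than ord0, and c_ord0 = 0 follows as the sum is 0. *)
Lemma nondegenerate_pattern k0 : (k0 < size Q)%N ->
  (forall (Q : {poly 'F_p}) x,
    irreducible_poly Q -> (k0 < size Q)%N -> curve_annihilator P x ->
    (forall i v, residue (v * Q) (x i) = 0) -> forall i j, x i j = 0) ->
  nondegenerate expchar pattern_poly.
Proof.
move=> k0Q hann c sc0 [j cj]; apply: contrapT => nc.
have const x y : lam (\sum_j c j *: pattern_poly j).[x] = lam (\sum_j c j *: pattern_poly j).[y].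
  apply/eqP; rewrite -expcharE; apply/negPn/negP => ne.
  by apply: nc; exists x, y.
have lam0 : lam 0 = 0 by apply: (addrI (lam 0)); rewrite -lamD !addr0.
pose x (i : 'I_m) l := lam (c (lift ord0 i) * red 'X^l).
have xE (v : 'I_m -> {poly 'F_p}) :
    \sum_i residue (v i) (x i) = lam (\sum_i c (lift ord0 i) * red (v i)).
  by rewrite (big_morph lam lamD lam0); apply: eq_bigr => i _; rewrite functional_red.
have hx : curve_annihilator P x.
  move=> n; rewrite !xE.
  have e w : \sum_i c (lift ord0 i) * red (P i).[w] =
      (\sum_j c j *: pattern_poly j).[red w].
    rewrite horner_sum big_ord_recl pattern_poly0 scaler0 horner0 add0r.
    apply: eq_bigr => i _; rewrite pattern_polyS hornerZ -eval_mod_red.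
    by [].
  by rewrite !e.
have kill i v : residue (v * Q) (x i) = 0.
  rewrite -functional_red// (_ : red (v * Q) = 0) ?mulr0//.
  apply: val_inj => /=; rewrite (mk_monicE hQ).
  by rewrite Pdiv.RingMonic.rmodp_mull//; case: hQ.
have x0 := hann Q x hQ.1 k0Q hx kill.
have c0 i : c (lift ord0 i) = 0.
  apply/eqP; apply: contrapT => /negP ci0; have [z lz] := lam_neq0.
  have [v zv] := red_surj ((c (lift ord0 i))^-1 * z).
  case/negP: lz; rewrite -(mulVKf ci0 z) zv functional_red// /residue.
  by rewrite big1// => l _; rewrite -[lam _]/(x i l) x0 mulr0.
case/negP: cj; apply/eqP; case: (unliftP ord0 j) => [i ->|->]; first exact: c0.
by move: sc0; rewrite big_ord_recl big1 ?addr0.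
Qed.

End Character.

End ResidueField.

(** * From averages to counts *)

Section Transfer.
Variables (c q a0 K n1 n2 n : nat) (a : 'I_n -> nat).

(** Characters take values in the algebraic numbers whereas the conclusion is
    about real numbers; the inequality only involves rational numbers and may
    be moved from one field to the other. *)
Definition count_ineq (S : numFieldType) : bool :=
  `|c%:R / q%:R ^+ 2 - \prod_j ((a j)%:R / q%:R)| ^+ n1 <=
    K%:R * (a0%:R / q%:R) ^+ n2 / q%:R :> S.

Lemma count_ineq_rat (S : numFieldType) : count_ineq S = count_ineq rat.
Proof.
rewrite /count_ineq -[RHS](ler_rat S) rmorphXn/= ratr_norm rmorphB/= !fmorph_div/=.
rewrite !rmorphM !rmorphXn !fmorph_div/= !ratr_nat rmorph_prod.
congr (`|_ - _| ^+ _ <= _); apply: eq_bigr => j _.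
by rewrite fmorph_div/= !ratr_nat.
Qed.

End Transfer.

Lemma prod_bool (S : comPzSemiRingType) (I : finType) (b : I -> bool) :
  \prod_i (b i)%:R = [forall i, b i]%:R :> S.
Proof.
have [/forallP h|] := boolP [forall i, b i].
  by rewrite big1// => i _; rewrite h.
by move=> /forallPn[i bi]; rewrite (bigD1 i)//= (negbTE bi) mul0r.
Qed.

Section Count.
Variables (p : nat) (Q : {poly 'F_p}) (hQ : monic_irreducible_poly Q).
Local Notation Fq := {poly %/ Q with hQ}.
Variables (m : nat) (P : 'I_m -> {poly {poly 'F_p}}) (A : 'I_m.+1 -> {set Fq}).

Definition pattern_set : {set Fq * Fq} := [set xy : Fq * Fq |
  (xy.1 \in A ord0) && [forall i : 'I_m, xy.1 + eval_mod (P i) xy.2 \in A (lift ord0 i)]]%SET.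

Lemma pattern_avg_count (C : numClosedFieldType) :
  pattern_avg (pattern_poly hQ P) (fun j x => (x \in A j)%:R : C) =
  #|pattern_set|%:R / #|Fq|%:R ^+ 2.
Proof.
rewrite /pattern_avg /avg -mulr_suml -mulrA -invfM -expr2; congr (_ / _).
rewrite pair_bigA/= -sum1_card natr_sum big_mkcond/= [RHS]big_mkcond/=.
apply: eq_bigr => -[x y] _; rewrite inE/= big_ord_recl pattern_poly0 horner0 addr0.
under eq_bigr => i _ do rewrite pattern_polyS -[_.[_]]/(eval_mod (P i) y).
rewrite prod_bool -natrM mulnb.
by case: (_ && _).
Qed.

End Count.

Section RealRoot.
Variable R : realType.

(** The root of order 2 ^ N.+1, which is where gamma = 1 / 2 ^ N.+1 comes
    from. *)
Lemma real_root (q a0 K N : nat) (x : R) : (0 < q)%N ->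
  `|x| ^+ (2 ^ N.+1) <= K%:R * (a0%:R / q%:R) ^+ (2 ^ N) / q%:R ->
  q%:R ^+ 2 * `|x| <=
    K.+1%:R * (Num.sqrt a0%:R * q%:R `^ (3 / 2 - (2 ^ N.+1)%:R^-1)).
Proof.
move=> q0 h; pose n := (2 ^ N.+1)%N.
have n0 : (0 < n)%N by rewrite expn_gt0.
have qR0 : (0 : R) < q%:R by rewrite ltr0n.
have rhs0 : 0 <= K.+1%:R * (Num.sqrt a0%:R * q%:R `^ (3 / 2 - n%:R^-1)) :> R.
  by rewrite !mulr_ge0// ?sqrtr_ge0// powR_ge0.
rewrite -(ler_pXn2r n0) ?nnegrE ?mulr_ge0 ?exprn_ge0//.
rewrite [leLHS]exprMn [leRHS]exprMn [in leRHS]exprMn.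
rewrite -[(_ `^ _) ^+ n]powR_mulrn ?powR_ge0// -powRrM.
have -> : (3 / 2 - n%:R^-1) * n%:R = (3 * 2 ^ N - 1)%N%:R :> R.
  rewrite natrB; last by rewrite muln_gt0 expn_gt0.
  rewrite mulrBl mulVf ?pnatr_eq0 -?lt0n// /n expnS !natrM; congr (_ - _).
  by rewrite mulrA divfK ?pnatr_eq0.
rewrite powR_mulrn ?ler0n//.
have -> : Num.sqrt (a0%:R : R) ^+ n = a0%:R ^+ (2 ^ N).
  by rewrite /n expnS exprM sqr_sqrtr.
apply: (@le_trans _ _ (q%:R ^+ 2 ^+ n * (K%:R * (a0%:R / q%:R) ^+ (2 ^ N) / q%:R) : R)).
  by rewrite ler_wpM2l// exprn_ge0// exprn_ge0.
have -> : q%:R ^+ 2 ^+ n * (K%:R * (a0%:R / q%:R) ^+ (2 ^ N) / q%:R) =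
    K%:R * (a0%:R ^+ (2 ^ N) * q%:R ^+ (3 * 2 ^ N - 1)) :> R.
  have -> : q%:R ^+ 2 ^+ n = q%:R ^+ (3 * 2 ^ N - 1) * q%:R ^+ (2 ^ N) * q%:R :> R.
    rewrite -exprM -exprD -exprSr; congr (_ ^+ _); rewrite /n expnS.
    by have := expn_gt0 2 N; lia.
  rewrite exprMn exprVn; field.
  by rewrite expf_neq0 ?gt_eqF.
rewrite ler_wpM2r// ?mulr_ge0 ?exprn_ge0//.
rewrite -natrX ler_nat (leq_trans (leqnSn K))//.
by rewrite -{1}[K.+1]expn1 leq_pexp2l.
Qed.

End RealRoot.

Section Density.
Variable R : realType.

(** Dividing by a^(1/2) leaves a^(m + 1/2) on the left. Since a <= q and g <=
    1, the term a q^(m - 1), which will come from trivial patterns, is then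
    dominated by the error term. *)
Lemma density_bound (q a m : nat) (M c g : R) : (0 < m)%N -> (0 < q)%N -> (a <= q)%N ->
  0 < g <= 1 -> 0 <= M -> 0 <= c ->
  a%:R ^+ m.+1 <= M * (a%:R * q%:R ^+ (m - 1)) +
    c * (Num.sqrt a%:R * q%:R `^ (m%:R + 1 / 2 - g)) ->
  a%:R <= (M + c) `^ (m%:R + 1 / 2)^-1 * q%:R `^ (1 - g / (m%:R + 1 / 2)).
Proof.
move=> m0 q0 aq /andP[g0 g1] M0 c0 h.
have [->|a0] := posnP a; first by rewrite mulr_ge0// powR_ge0.
have aR : (0 : R) < a%:R by rewrite ltr0n.
have q1 : (1 : R) <= q%:R by rewrite ler1n.
have qR : (0 : R) < q%:R by rewrite ltr0n.
have e0 : (0 : R) < m%:R + 1 / 2 by rewrite ltr_wpDl.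
pose Z := q%:R `^ (m%:R + 1 / 2 - g).
have main : a%:R `^ (m%:R + 1 / 2) <= (M + c) * Z.
  have s0 : 0 < a%:R `^ (1 / 2) :> R by rewrite powR_gt0.
  rewrite -(ler_pM2r s0) -powRD; last by rewrite gt_eqF ?implybT.
  rewrite -addrA -splitr natr1 powR_mulrn ?ler0n//.
  apply: (le_trans h); rewrite mulrDl mulrDl; apply: lerD; last first.
    rewrite -mulrA ler_wpM2l// mulrC ler_wpM2l ?powR_ge0//.
    by rewrite div1r powR12_sqrt ?ler0n.
  rewrite -mulrA ler_wpM2l//.
  have aE : a%:R = a%:R `^ (1 / 2) * a%:R `^ (1 / 2) :> R.
    by rewrite -powRD ?gt_eqF ?implybT// -splitr powRr1 ?ler0n.
  rewrite {1}aE -mulrA [leRHS]mulrC ler_wpM2l ?powR_ge0//.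
  apply: (@le_trans _ _ (q%:R `^ (1 / 2) * q%:R ^+ (m - 1))).
    rewrite ler_wpM2r ?exprn_ge0 ?ler0n//.
    by apply: ge0_ler_powR; rewrite ?nnegrE ?ler0n// ?ler_nat// divr_ge0.
  rewrite -powR_mulrn ?ler0n// -powRD; last by rewrite gt_eqF ?implybT.
  apply: ler_powR => //; rewrite natrB//.
  lra.
have inv0 : 0 <= (m%:R + 1 / 2)^-1 :> R by rewrite invr_ge0 ltW.
have := ge0_ler_powR inv0 _ _ main.
rewrite !nnegrE powR_ge0 mulr_ge0 ?addr_ge0 ?powR_ge0// => /(_ isT isT).
rewrite -powRrM mulfV ?gt_eqF// powRr1 ?ler0n// => /le_trans; apply.
rewrite powRM ?addr_ge0 ?powR_ge0// ler_wpM2l ?powR_ge0//.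
by rewrite /Z -powRrM mulrBl mulfV ?gt_eqF.
Qed.

End Density.

Section Assembly.
Variables (R : realType) (p : nat) (p_prime : prime p).
Variables (m : nat) (m_gt0 : (1 <= m)%N) (P : 'I_m -> {poly {poly 'F_p}}).
Hypothesis P_good : good_for_irrational_equidistribution R (fun i n => (P i).[n]).

Lemma pattern_count_estimate : exists N K k0 D : nat,
  forall (k : nat) (Q : {poly 'F_p}) (hQ : monic_irreducible_poly Q),
    size Q = k.+1 -> (p ^ k0 <= p ^ k)%N ->
  (forall A : 'I_m.+1 -> {set {poly %/ Q with hQ}},
    count_ineq #|pattern_set P A| (p ^ k) #|A ord0| K (2 ^ N.+1) (2 ^ N)
      (fun j => #|A j|) R) /\
  (forall i j, j != i -> (size (pattern_poly hQ P i - pattern_poly hQ P j)%R <= D)%N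
      /\ ~~ deg_lt 1 (pattern_poly hQ P i - pattern_poly hQ P j)).
Proof.
pose D := \max_i size (P i).
have [N [K hNK]] := pattern_asymptotics_L2 algC p_prime D (ord0 : 'I_m.+1) m_gt0.
have [k0 hk0] := annihilator_prime P_good.
have [zeta zetaP] := C_prim_root_exists (prime_gt0 p_prime).
exists N, K, k0, D => k Q hQ sQ; rewrite leq_exp2l ?prime_gt1// => k0k.
have [lam [lamD lamF lam_neq0]] := frob_functional hQ p_prime.
have cardE : #|{poly %/ Q with hQ}| = (p ^ k)%N by rewrite cardFq// sQ.
pose psi := expchar zeta lam.
have psiP : frob_char p psi by exact: expchar_frob_char.
have nd : nondegenerate psi (pattern_poly hQ P).
  by apply: (nondegenerate_pattern p_prime zetaP lamD lam_neq0 _ hk0); rewrite sQ ltnS.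
have sP j : (size (pattern_poly hQ P j) <= D)%N.
  rewrite /pattern_poly; case: unlift => [i|]; last by rewrite size_poly0.
  rewrite (leq_trans (size_poly _ _))//.
  exact: (leq_bigmax (F := fun i => size (P i))).
split => [A|i j ji]; last first.
  split; last exact: nondegenerate_diff nd ji.
  by rewrite (leq_trans (size_polyD _ _))// size_polyN geq_max !sP.
rewrite count_ineq_rat -(count_ineq_rat _ _ _ _ _ _ _ algC) /count_ineq.
pose f j (x : {poly %/ Q with hQ}) : algC := (x \in A j)%:R.
have fb j : bounded1 (f j) by move=> x; rewrite /f; case: (_ \in _); rewrite ?normr1 ?normr0.
have := hNK _ (pcharFq hQ p_prime) psi psiP _ sP nd (pattern_poly0 hQ P) f (mem (A ord0)) fb (fun=> erefl).
rewrite pattern_avg_count cardE.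
rewrite (eq_bigr (fun j => #|A j|%:R / (p ^ k)%:R))// => j _.
rewrite /avg cardE; congr (_ / _); rewrite -sum1_card natr_sum [RHS]big_mkcond/=.
by apply: eq_bigr => x _; rewrite /f; case: (_ \in _).
Qed.

End Assembly.

(** * Trivial patterns and the conclusion *)

(** All patterns in A are trivial, and two entries of a pattern coincide only
    if y is a root of the difference of two of the polynomials, which is
    nonzero and has bounded degree. *)
Lemma trivial_pattern_card (p : nat) (Q : {poly 'F_p}) (hQ : monic_irreducible_poly Q)
    (m D : nat) (P : 'I_m -> {poly {poly 'F_p}}) (A : {set {poly %/ Q with hQ}}) :
  (forall i j, j != i -> (size (pattern_poly hQ P i - pattern_poly hQ P j)%R <= D)%N
      /\ ~~ deg_lt 1 (pattern_poly hQ P i - pattern_poly hQ P j)) ->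
  ~ (exists x y : {poly %/ Q with hQ},
       uniq (pattern P x y) /\ {subset pattern P x y <= A}) ->
  (#|pattern_set P (fun=> A)| <= #|A| * (m.+1 ^ 2 * D))%N.
Proof.
move=> dist nopat.
pose pairs := [seq ij <- enum {: 'I_m.+1 * 'I_m.+1} | ij.2 != ij.1].
pose diffs := [seq pattern_poly hQ P ij.1 - pattern_poly hQ P ij.2 | ij <- pairs].
pose B : pred {poly %/ Q with hQ} := [pred y | has (fun r => root r y) diffs].
have BD : (#|B| <= m.+1 ^ 2 * D)%N.
  apply: leq_trans (card_has_le (P := fun r => [pred y | root r y]) (D := D) _) _ => [r|].
    case/mapP => ij; rewrite mem_filter => /andP[ji _] ->.
    have [sD nc] := dist _ _ ji; apply: card_roots_le => //.
    by apply: contraNneq nc => ->; rewrite deg_lt_size// size_poly0.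
  rewrite leq_mul2r size_map size_filter (leq_trans (count_size _ _)) ?orbT//.
  by rewrite -cardE card_prod card_ord.
apply: (@leq_trans #|finset.setX A [set y in B]%SET|); last first.
  by rewrite cardsX leq_mul2l cardsE BD orbT.
apply: subset_leq_card; apply/fintype.subsetP => -[x y].
rewrite !inE /= => /andP[xA /forallP hA]; rewrite xA /=.
apply: contrapT => /negP/hasPn hB; apply: nopat; exists x, y.
have patE : pattern P x y = [seq x + (pattern_poly hQ P j).[y] | j <- enum 'I_m.+1].
  rewrite enum_ordSl /= pattern_poly0 horner0 addr0 -map_comp /pattern.
  by congr (_ :: _); apply: eq_map => i /=; rewrite pattern_polyS.
split.
  rewrite patE map_inj_in_uniq ?enum_uniq// => i j _ _ /addrI ij.
  apply/eqP; apply: contrapT => /negP ne.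
  have /hB : pattern_poly hQ P i - pattern_poly hQ P j \in diffs.
    by apply/mapP; exists (i, j); rewrite // mem_filter mem_enum /= eq_sym ne.
  by rewrite /root hornerD hornerN ij subrr eqxx.
move=> z; rewrite inE => /predU1P[->//|/mapP[i _ ->]]; exact: hA.
Qed.

Theorem corollary1p13 (R : realType) (p : nat) (p_prime : prime p)
    (m : nat) (m_gt0 : (1 <= m)%N) (P : 'I_m -> {poly {poly 'F_p}})
    (P_good : good_for_irrational_equidistribution R (fun i n => (P i).[n])) :
  exists gamma : R, [/\ 0 < gamma,
    exists C : R, 0 < C /\ exists q0 : nat,
      forall (k : nat) (Q : {poly 'F_p}) (hQ : monic_irreducible_poly Q),
        size Q = k.+1 -> (q0 <= p ^ k)%N ->
      forall A : 'I_m.+1 -> {set {poly %/ Q with hQ}},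
        `| #|[set xy : {poly %/ Q with hQ} * {poly %/ Q with hQ} |
               (xy.1 \in A ord0) &&
               [forall i : 'I_m,
                  xy.1 + eval_mod (P i) xy.2 \in A (lift ord0 i)]]%SET|%:R
           - (p ^ k)%:R ^- (m - 1) * \prod_(i < m.+1) #|A i|%:R |
        <= C * (Num.sqrt #|A ord0|%:R * (p ^ k)%:R `^ (3 / 2 - gamma))
  & exists K : R, 0 < K /\
      forall (k : nat) (Q : {poly 'F_p}) (hQ : monic_irreducible_poly Q),
        size Q = k.+1 ->
      forall A : {set {poly %/ Q with hQ}},
        ~ (exists x y : {poly %/ Q with hQ},
             uniq (pattern P x y) /\ {subset pattern P x y <= A}) ->
        #|A|%:R <= K * (p ^ k)%:R `^ (1 - gamma / (m%:R + 1 / 2))].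
Proof.
have [N [K [k0 [D est]]]] := pattern_count_estimate p_prime m_gt0 P_good.
pose g : R := (2 ^ N.+1)%:R^-1.
have q_gt0 k : (0 < p ^ k)%N by rewrite expn_gt0 prime_gt0.
have g0 : 0 < g by rewrite invr_gt0 ltr0n expn_gt0.
have g1 : g <= 1 by rewrite invf_le1 ?ler1n ?ltr0n expn_gt0.
have count_est k Q (hQ : monic_irreducible_poly Q) (A : 'I_m.+1 -> {set {poly %/ Q with hQ}}) :
    size Q = k.+1 -> (p ^ k0 <= p ^ k)%N ->
    `| #|pattern_set P A|%:R - (p ^ k)%:R ^- (m - 1) * \prod_(i < m.+1) #|A i|%:R | <=
      K.+1%:R * (Num.sqrt #|A ord0|%:R * (p ^ k)%:R `^ (3 / 2 - g)) :> R.
  move=> sQ qk; have [/(_ A) h _] := est k Q hQ sQ qk.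
  apply: le_trans (real_root (q_gt0 k) h).
  have qR : ((p ^ k)%:R : R) != 0 by rewrite pnatr_eq0 -lt0n.
  have e (y : R) : (p ^ k)%:R ^+ 2 * `|y| = `|(p ^ k)%:R ^+ 2 * y|.
    by rewrite normrM [ `|_ ^+ 2|]ger0_norm ?exprn_ge0.
  rewrite e le_eqVlt; apply/orP; left.
  apply/eqP; congr (`|_|); rewrite mulrBr mulrCA mulfV ?expf_neq0// mulr1.
  congr (_ - _); rewrite big_split/= prodr_const card_ord mulrCA mulrC; congr (_ * _).
  rewrite (_ : m.+1 = (m - 1 + 2)%N); last by lia.
  by rewrite exprD !exprVn mulrCA mulfV ?expf_neq0// mulr1.
exists g; split => //.
  by exists K.+1%:R; split; [rewrite ltr0n|exists (p ^ k0)%N => k Q hQ sQ qk A; exact: count_est].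
pose M : R := (m.+1 ^ 2 * D)%:R.
exists ((M + K.+1%:R) `^ (m%:R + 1 / 2)^-1 + (p ^ k0)%:R); split.
  by rewrite ltr_wpDl ?powR_ge0// ltr0n.
move=> k Q hQ sQ A nopat.
have e0 : 0 <= 1 - g / (m%:R + 1 / 2).
  rewrite subr_ge0 ler_pdivrMr; last by rewrite ltr_wpDl.
  have m1 : (1 : R) <= m%:R by rewrite ler1n.
  by rewrite mul1r (le_trans g1)//; lra.
have Aq : (#|A| <= p ^ k)%N by rewrite (leq_trans (max_card _))// cardFq// sQ.
(* The second summand of the constant takes care of the small fields, to
   which the estimate does not apply. *)
rewrite mulrDl; have [qk|kq] := leqP (p ^ k0) (p ^ k); last first.
  apply: (@le_trans _ _ ((p ^ k0)%:R * 1)).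
    by rewrite mulr1 ler_nat (leq_trans Aq)// ltnW.
  rewrite ler_wpDl ?mulr_ge0 ?powR_ge0// ler_wpM2l//.
  by rewrite -[leLHS](powRr0 (p ^ k)%:R) ler_powR// ler1n.
rewrite -[leLHS]addr0; apply: lerD; last by rewrite mulr_ge0 ?powR_ge0.
apply: density_bound; rewrite ?g0 ?ler0n//.
have := count_est k Q hQ (fun=> A) sQ qk; rewrite prodr_const card_ord.
have [_ dist] := est k Q hQ sQ qk.
have := trivial_pattern_card dist nopat.
rewrite -(ler_nat R) natrM -/M => cnt; rewrite ler_distlC => /andP[_ h2].
have qR : (0 : R) < (p ^ k)%:R by rewrite ltr0n.
have := ler_wpM2l (exprn_ge0 (m - 1) (ltW qR)) h2; rewrite mulVKf ?gt_eqF ?exprn_gt0//.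
move=> /le_trans; apply; rewrite mulrDr; apply: lerD.
  by rewrite [leLHS]mulrC [leRHS]mulrA [M * _]mulrC ler_wpM2r ?exprn_ge0 ?ler0n.
rewrite mulrCA ler_wpM2l// mulrCA ler_wpM2l ?sqrtr_ge0//.
rewrite -powR_mulrn ?ler0n// -powRD; last by rewrite (gt_eqF qR) implybT.
apply: ler_powR; first by rewrite ler1n.
by rewrite natrB//; lra.
Qed.
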